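(* For each $z \in B_{\ell_\infty}$ the following two statements hold: 1. If $\displaystyle\limsup_{n \to \infty} \frac{1}{\log n} \sum_{j=1}^{n} (z^{*}_{j})^2 < 1$, then $z \in \operatorname{mon} H_\infty(B_{\ell_\infty})$. 2. If $z \in \operatorname{mon} H_\infty(B_{\ell_\infty})$, then $\displaystyle\limsup_{n \to \infty} \frac{1}{\log n} \sum_{j=1}^{n} (z^{*}_{j})^2 \leq 1$. Moreover, the converse implication in 2 is false, i.e. there is $z\in B_{\ell_\infty}$ with $\limsup_{n \to \infty} \frac{1}{\log n} \sum_{j=1}^{n} (z^{*}_{j})^2 \leq 1$ but $z \notin \operatorname{mon} H_\infty(B_{\ell_\infty})$.
   Context: $\ell_\infty$ is the Banach space of bounded complex sequences and $B_{\ell_\infty}$ its open unit ball. $H_\infty(B_{\ell_\infty})$ is the Banach space (sup norm) of all bounded holomorphic (i.e. Fréchet differentiable) functions $f:B_{\ell_\infty}\to\mathbb{C}$. $\mathbb{N}_0^{(\mathbb{N})}$ is the set of finitely supported sequences $\alpha$ of nonnegative integers, and $z^\alpha=\prod_k z_k^{\alpha_k}$. For $f\in H_\infty(B_{\ell_\infty})$ there is a unique family of monomial coefficients $(c_\alpha(f))_{\alpha\in\mathbb{N}_0^{(\mathbb{N})}}$ such that for every $k$ and every $z\in\mathbb{D}^k$ (identified with $\mathbb{D}^k\times\{0\}\subset B_{\ell_\infty}$) one has $f(z)=\sum_{\alpha\in\mathbb{N}_0^k} c_\alpha(f)z^\alpha$; explicitly $c_\alpha(f)=\partial^\alpha f(0)/\alpha!$.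 The set of monomial convergence is $$\operatorname{mon} H_\infty(B_{\ell_\infty})=\Big\{z\in B_{\ell_\infty} : \forall f\in H_\infty(B_{\ell_\infty}),\ f(z)=\sum_{\alpha\in \mathbb{N}_0^{(\mathbb{N})}} c_\alpha(f)z^\alpha\Big\},$$ where the sum over the countable index set is understood as an (unconditionally, equivalently absolutely) convergent sum. The decreasing rearrangement of $z\in\ell_\infty$ is $z_n^*=\inf\{\sup_{j\in\mathbb{N}\setminus J}|z_j| : J\subset\mathbb{N},\ \operatorname{card}(J)<n\}$. *)

(* Defs.v *)
From HB Require Import structures.
From mathcomp Require Import all_boot all_order all_algebra finmap complex.
From mathcomp Require Import all_classical all_reals all_analysis summability.

Set Implicit Arguments.
Unset Strict Implicit.
Unset Printing Implicit Defensive.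

Import Order.TTheory GRing.Theory Num.Theory.
Import numFieldNormedType.Exports.
Import Normc.

Local Open Scope classical_set_scope.
Local Open Scope ring_scope.
Local Open Scope complex_scope.

(* R[i]^o is R[i] viewed as a normed space over itself. *)
Definition bounded_seq (R : realType) : {pred nat -> R[i]} :=
  fun z => `[< bounded_fun (z : nat -> R[i]^o) >].

Lemma bounded_seqP (R : realType) (z : nat -> R[i]) :
  reflect (exists M : R, forall n, normc (z n) <= M) (z \in @bounded_seq R).
Proof.
apply: (iffP (asboolP _)) => [|[M zM]].
- move=> [M0 [M0real zM]].
  have Mr : M0 < (complex.Re M0 + 1)%:C.
    case: M0 M0real {zM} => a b.
    by rewrite complex_real /= => /eqP ->; rewrite ltcR ltrDl.
  exists (complex.Re M0 + 1) => n; rewrite -lecR.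
  by have := zM _ Mr n I.
- exists M%:C; split; first by rewrite complex_real.
  move=> x Mx n _ /=; apply: le_trans (ltW Mx).
  by rewrite -[leLHS]/((normc (z n))%:C) lecR.
Qed.

Lemma bounded_seq_submod_closed (R : realType) :
  submod_closed (@bounded_seq R).
Proof.
split; first by apply/bounded_seqP; exists 0 => n; rewrite normc0.
move=> a u v /bounded_seqP[M uM] /bounded_seqP[N vN]; apply/bounded_seqP.
exists (normc a * M + N) => n.
apply: le_trans (le_normcD _ _) _; apply: lerD (vN n).
by rewrite normcM ler_wpM2l // -lecR; exact: (@normr_ge0 _ R[i] a).
Qed.

HB.instance Definition _ (R : realType) :=
  GRing.isSubmodClosed.Build R[i] (nat -> R[i]) (@bounded_seq R)
    (@bounded_seq_submod_closed R).

(* Coordinates are numbered from 0. *)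
Record linfty (R : realType) := Linfty {
  linfty_val :> nat -> R[i];
  _ : linfty_val \in @bounded_seq R
}.

HB.instance Definition _ (R : realType) := [isSub for @linfty_val R].
HB.instance Definition _ (R : realType) := [Choice of linfty R by <:].
HB.instance Definition _ (R : realType) :=
  [SubChoice_isSubLmodule of linfty R by <:].

Definition linfty_norm (R : realType) (z : linfty R) : R :=
  sup [set normc (z n) | n in setT].

Lemma linfty_has_sup (R : realType) (z : linfty R) :
  has_sup [set normc (z n) | n in setT].
Proof.
split; first by exists (normc (z 0)); exists 0%N.
have /bounded_seqP[M zM] := valP z.
by exists M => _ [n _ <-]; exact: zM.
Qed.

Lemma le_linfty_norm (R : realType) (z : linfty R) n :
  normc (z n) <= linfty_norm z.
Proof. by apply: ub_le_sup; [exact: (linfty_has_sup z).2|exists n]. Qed.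

Lemma linfty_norm_le (R : realType) (z : linfty R) (M : R) :
  (forall n, normc (z n) <= M) -> linfty_norm z <= M.
Proof.
by move=> zM; apply: ge_sup => [|_ [n _ <-] //]; exact: (linfty_has_sup z).1.
Qed.

Lemma normc_ge0 (R : realType) (x : R[i]) : 0 <= normc x.
Proof. by rewrite -lecR; exact: (@normr_ge0 _ R[i] x). Qed.

Lemma linfty_norm_ge0 (R : realType) (z : linfty R) : 0 <= linfty_norm z.
Proof. exact: le_trans (normc_ge0 _) (le_linfty_norm z 0). Qed.

Lemma ler_linfty_normD (R : realType) (x y : linfty R) :
  linfty_norm (x + y) <= linfty_norm x + linfty_norm y.
Proof.
apply: linfty_norm_le => n; apply: le_trans (le_normcD _ _) _.
by apply: lerD; exact: le_linfty_norm.
Qed.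

Lemma linfty_normZ (R : realType) (a : R[i]) (x : linfty R) :
  linfty_norm (a *: x) = normc a * linfty_norm x.
Proof.
have leZ (b : R[i]) (y : linfty R) : linfty_norm (b *: y) <= normc b * linfty_norm y.
  apply: linfty_norm_le => n; rewrite [X in normc X]/(b * y n) normcM.
  by rewrite ler_wpM2l ?normc_ge0// le_linfty_norm.
apply/eqP; rewrite eq_le leZ /=.
have [->|a0] := eqVneq a 0; first by rewrite normc0 mul0r linfty_norm_ge0.
have na0 : 0 < normc a.
  by rewrite lt_def normc_ge0 andbT; apply: contra a0 => /eqP/eq0_normc ->.
rewrite -ler_pdivlMl// -normcV.
by have := leZ a^-1 (a *: x); rewrite scalerA mulVf// scale1r.
Qed.

Lemma linfty_norm_eq0 (R : realType) (x : linfty R) :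
  linfty_norm x = 0 -> x = 0.
Proof.
move=> x0; apply/val_inj/funext => n; apply: eq0_normc.
by apply/eqP; rewrite eq_le normc_ge0 andbT -x0; exact: le_linfty_norm.
Qed.

(* A normed module over R[i] has its norm in R[i]. *)
Lemma ler_linfty_normCD (R : realType) (x y : linfty R) :
  (linfty_norm (x + y))%:C <= (linfty_norm x)%:C + (linfty_norm y)%:C.
Proof. by rewrite -rmorphD lecR ler_linfty_normD. Qed.

Lemma linfty_normCZ (R : realType) (a : R[i]) (x : linfty R) :
  (linfty_norm (a *: x))%:C = `|a| * (linfty_norm x)%:C.
Proof. by rewrite linfty_normZ rmorphM. Qed.

Lemma linfty_normC_eq0 (R : realType) (x : linfty R) :
  (linfty_norm x)%:C = 0 -> x = 0.
Proof. by move=> /complexI; exact: linfty_norm_eq0. Qed.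

HB.instance Definition _ (R : realType) :=
  Lmodule_isNormed.Build R[i] (linfty R)
    (@ler_linfty_normCD R) (@linfty_normCZ R) (@linfty_normC_eq0 R).

Lemma linfty_normE (R : realType) (z : linfty R) :
  `|z| = (sup [set normc (z n) | n in setT])%:C.
Proof. by []. Qed.

Lemma bounded_seq_delta (R : realType) (k : nat) :
  (fun j => (j == k)%:R) \in @bounded_seq R.
Proof.
apply/bounded_seqP; exists 1 => j.
by case: (j == k); rewrite ?normc1 // normc0 ler01.
Qed.

Definition linfty_delta (R : realType) (k : nat) : linfty R :=
  Linfty (bounded_seq_delta R k).

(* Functions on the open unit ball are represented by total functions, whose
   values outside of the ball are irrelevant. *)
Definition Hoo_ball (R : realType) : set (linfty R -> R[i]^o) :=
  [set f | (forall z, ball (0 : linfty R) 1 z -> differentiable f z) /\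
           [bounded f z | z in ball (0 : linfty R) 1]].

Definition multi_index := {fsfun nat -> nat with 0%N}.

Definition mfact (a : multi_index) : nat := (\prod_(k <- finsupp a) (a k)`!)%N.

Definition monomial (R : realType) (a : multi_index) (z : linfty R) : R[i] :=
  \prod_(k <- finsupp a) z k ^+ a k.

(* 'D_v over the scalar field R[i] is the complex directional derivative. *)
Definition mderive (R : realType) (a : multi_index) (f : linfty R -> R[i]^o) :
    linfty R -> R[i]^o :=
  foldr (fun k g => iter (a k) (fun h => 'D_(linfty_delta R k) h) g)
    f (finsupp a).

Definition mcoef (R : realType) (f : linfty R -> R[i]^o) (a : multi_index) :
    R[i] :=
  mderive a f 0 / (mfact a)%:R.

(* The limit along the filter [totally] of the directed set of finite subsets
   of the index set expresses unconditional convergence of the sum. *)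
Definition mon_Hoo_ball (R : realType) : set (linfty R) :=
  [set z | ball (0 : linfty R) 1 z /\
    forall f, Hoo_ball f ->
      partial_sum (fun a => mcoef f a * monomial a z : R[i]^o) @ totally
        --> f z].

(* The rearrangement is numbered from n = 1. *)
Definition decr_rearr (R : realType) (z : linfty R) (n : nat) : R :=
  inf [set sup [set normc (z j) | j in [set j | j \notin J]]
      | J in [set J : {fset nat} | (#|` J| < n)%N]].

Definition log_mean_sq (R : realType) (z : linfty R) (n : nat) : R :=
  (ln n%:R)^-1 * \sum_(1 <= j < n.+1) decr_rearr z j ^+ 2.

(* Main.v *)
(* Part 1. List the letters by decreasing |z_l| and let k = 2 ^ j be large. A monomial of
   degree m + k is a word of its k smallest letters times a monomial b in letters that are
   at least as large. Bohnenblust-Hille for the words, combined with hypercontractivity of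
   homogeneous polynomials for the b, bounds the l^(2k/(k+1)) norm, over the words, of the
   l^2 norm, over b, of the coefficients. Against it one sums |z|^(2b) over the letters up
   to l, at most prod_(v <= l) 1 / (1 - t |z_v|^2), a power of l with exponent below 1
   when the limsup is below 1; for k large the remaining sum over words converges by
   Hoelder. The constants t^(-1/2) 4^(1/2k) < 1 make the degrees a geometric series, and the
   bounds are uniform in the finite set of letters.

   Parts 2 and 3. If the sums of z*_j^2 exceed log n + sqrt(log n) infinitely often, then,
   for m = floor(log n) and T the sum of |z_j|^2 over n letters, the sum V >= T^m / m! of
   |z^a|^2 over the a of degree m beats the norm O(m sqrt(n V)) of the random polynomial
   sum_a +-conj(z^a) w^a by any prescribed factor. A gliding hump of such polynomials with
   weights 2^-j is bounded and holomorphic, but its monomial series does not converge at z.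
   For Part 3, the z*_j^2 are the increments of log x + 2 sqrt(log x). *)

Require Import Defs.
From HB Require Import structures.
From mathcomp Require Import all_boot all_order all_algebra finmap complex.
From mathcomp Require Import all_classical all_reals all_analysis summability.
From mathcomp Require Import ring lra zify.

Set Implicit Arguments.
Unset Strict Implicit.
Unset Printing Implicit Defensive.

Import Order.TTheory GRing.Theory Num.Theory.
Import Normc. Import numFieldNormedType.Exports.

Local Open Scope classical_set_scope.
Local Open Scope ring_scope.

(** The coefficients are iterated derivatives of a function assumed differentiable only once, so
    Cauchy's theory comes first: sums over [2 ^ n] points, on which bisection acts exactly, stand
    for contour integrals, and Weierstrass' theorem makes the coordinate derivatives holomorphic and
    commuting on the ball.

    In Part 1 the degree [m + k] grows while [k] is fixed. Bohnenblust-Hille is used in degree [k]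
    only, and its differentiations cost [(e (m + k)) ^ k]. Exponential in [m] are just the
    hypercontractive loss [4 ^ (m / 2k)] and the gain [t ^ (- m / 2)], so every [t > 1] admits a
    suitable [k]; it is a power of 2 since Bohnenblust-Hille is proved by doubling.

    In Parts 2 and 3 Stirling's formula makes [m ^ m / m!] comparable to [n], up to powers of [m],
    for [m] near [log n]. So [T = log n] is critical, and an excess of order [sqrt (log n)] brings a
    factor exponential in [sqrt m], which beats all powers of [m]. One criterion thus serves both a
    limsup above 1 and the example. *)

Section ComplexNorm.
Variable R : realType.
Implicit Types x y z : R[i].

Lemma normr_normc z : `|z| = (normc z)%:C%C.
Proof. by []. Qed.

Lemma le_normcB x y : normc (x - y) <= normc x + normc y.
Proof. by rewrite -(normcN y) le_normcD. Qed.

Lemma normc_distC x y : normc (x - y) = normc (y - x).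
Proof. by rewrite -normcN opprB. Qed.

Lemma normcX x n : normc (x ^+ n) = normc x ^+ n.
Proof. by elim: n => [|n IH]; rewrite ?normc1// !exprS normcM IH. Qed.

Lemma normc_eq0 x : (normc x == 0) = (x == 0).
Proof. by apply/eqP/eqP => [/eq0_normc//|->]; exact: normc0. Qed.

Lemma normc_gt0 x : (0 < normc x) = (x != 0).
Proof. by rewrite lt_def normc_ge0 andbT normc_eq0. Qed.

Lemma normc_real (a : R) : normc a%:C%C = `|a|.
Proof. by rewrite /normc/= expr0n addr0 sqrtr_sqr. Qed.

Lemma normc_nat n : normc (n%:R : R[i]) = n%:R.
Proof. by rewrite -(rmorph_nat (real_complex R)) normc_real normr_nat. Qed.

Lemma le_normc_sum I (r : seq I) (P : pred I) (F : I -> R[i]) :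
  normc (\sum_(i <- r | P i) F i) <= \sum_(i <- r | P i) normc (F i).
Proof.
elim/big_rec2 : _ => [|i a b _ h]; first by rewrite normc0.
by apply: le_trans (le_normcD _ _) _; rewrite lerD2l.
Qed.

Lemma normc_prod I (r : seq I) (P : pred I) (F : I -> R[i]) :
  normc (\prod_(i <- r | P i) F i) = \prod_(i <- r | P i) normc (F i).
Proof. by elim/big_rec2 : _ => [|i a b _ <-]; rewrite ?normc1 ?normcM. Qed.

Lemma normc_conj x : normc (x^*)%C = normc x.
Proof. by case: x => a b; rewrite /= sqrrN. Qed.

Lemma le_normc_dist x y z : normc (x - z) <= normc (x - y) + normc (y - z).
Proof. by apply: le_trans (le_normcD _ _); rewrite addrA subrK. Qed.

Lemma mul_conjc x : x * (x^*)%C = (normc x ^+ 2)%:C%C.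
Proof.
case: x => a b; rewrite /= sqr_sqrtr ?addr_ge0 ?sqr_ge0//.
by apply/eqP; rewrite eq_complex/=; apply/andP; split; apply/eqP; ring.
Qed.

Lemma ReB x y : complex.Re (x - y) = complex.Re x - complex.Re y.
Proof. by case: x; case: y. Qed.

Lemma ImB x y : complex.Im (x - y) = complex.Im x - complex.Im y.
Proof. by case: x; case: y. Qed.

Lemma norm_Re_le x : `|complex.Re x| <= normc x.
Proof.
by case: x => a b /=; rewrite -sqrtr_sqr ler_sqrt ?addr_ge0 ?sqr_ge0// lerDl sqr_ge0.
Qed.

Lemma norm_Im_le x : `|complex.Im x| <= normc x.
Proof.
by case: x => a b /=; rewrite -sqrtr_sqr ler_sqrt ?addr_ge0 ?sqr_ge0// lerDr sqr_ge0.
Qed.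

Lemma normc_le_ReIm x : normc x <= `|complex.Re x| + `|complex.Im x|.
Proof.
case: x => a b /=; rewrite -[leRHS]ger0_norm ?addr_ge0// -sqrtr_sqr.
rewrite ler_sqrt ?sqr_ge0// sqrrD !real_normK ?num_real//.
by rewrite lerD2r lerDl mulrn_wge0// mulr_ge0.
Qed.

End ComplexNorm.

(** * Cauchy's formula and Taylor series in one variable *)

Section Cousin.
Variable R : realType.

Lemma half_exp_lt (d : R) : 0 < d -> exists n, forall m, (n <= m)%N -> (2 ^+ m)^-1 < d.
Proof.
move=> d0; have [n dn] : exists n, d^-1 < n%:R.
  by exists (Num.bound d^-1); rewrite archi_boundP// invr_ge0 ltW.
exists n => m nm; rewrite invf_plt ?posrE ?exprn_gt0//; apply: lt_trans dn _.
by rewrite -natrX ltr_nat; apply: leq_ltn_trans nm _; rewrite ltn_expl.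
Qed.

(* Bisection form of the compactness of the unit square. *)
Lemma cousin (P : R -> R -> R -> Prop) :
  (forall x y s, P x y (s / 2) -> P (x + s / 2) y (s / 2) ->
    P x (y + s / 2) (s / 2) -> P (x + s / 2) (y + s / 2) (s / 2) -> P x y s) ->
  (forall p q, 0 <= p <= 1 -> 0 <= q <= 1 -> exists2 d : R, 0 < d &
    forall x y s, 0 <= x -> x + s <= 1 -> 0 <= y -> y + s <= 1 -> 0 <= s < d ->
      x <= p <= x + s -> y <= q <= y + s -> P x y s) ->
  P 0 0 1.
Proof.
move=> Pquad Ploc; apply: contrapT => nP.
pose child (a b : R * R * R) := [/\ ~ P b.1.1 b.1.2 b.2, b.2 = a.2 / 2,
  a.1.1 <= b.1.1 /\ b.1.1 + b.2 <= a.1.1 + a.2 &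
  a.1.2 <= b.1.2 /\ b.1.2 + b.2 <= a.1.2 + a.2].
have childP a : 0 <= a.2 -> ~ P a.1.1 a.1.2 a.2 -> exists b, child a b.
  case: a => [[x y] s] /= s0 nPa; apply: contrapT => nb; apply: nPa; apply: Pquad.
  - by apply: contrapT => h; apply: nb; exists (x, y, s / 2); split=> //=; lra.
  - by apply: contrapT => h; apply: nb; exists (x + s / 2, y, s / 2); split=> //=; lra.
  - by apply: contrapT => h; apply: nb; exists (x, y + s / 2, s / 2); split=> //=; lra.
  - by apply: contrapT => h; apply: nb; exists (x + s / 2, y + s / 2, s / 2); split=> //=; lra.
(* Nested squares of side [2 ^- n] on which [P] fails. By [childP] the default value of [xget] is
   never taken. *)
pose u n : R * R * R := iter n (fun a => xget a [set b | child a b]) (0, 0, 1).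
have uE n : u n.+1 = xget (u n) [set b | child (u n) b] by [].
have us n : ~ P (u n).1.1 (u n).1.2 (u n).2 /\ (u n).2 = (2 ^+ n)^-1.
  elim: n => [|n [IH1 IH2]]; first by rewrite /u /= expr0 invr1.
  have [b bP] := childP (u n) ltac:(by rewrite IH2 invr_ge0 exprn_ge0) IH1.
  have : child (u n) (u n.+1) by rewrite uE; apply: xgetPex; exists b.
  by case=> h1 h2 _ _; split => //; rewrite h2 IH2 exprSr invfM.
have uc n : child (u n) (u n.+1).
  have [h1 h2] := us n.
  have [b bP] := childP (u n) ltac:(by rewrite h2 invr_ge0 exprn_ge0) h1.
  by rewrite uE; apply: xgetPex; exists b.
have s0 n : 0 <= (u n).2 by rewrite (us n).2 invr_ge0 exprn_ge0.
have mono (f : R * R * R -> R) (g : R * R * R -> R) :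
    (forall n, f (u n) <= f (u n.+1) /\ g (u n.+1) <= g (u n)) ->
    (forall n, f (u n) <= g (u n)) ->
    exists p, forall n, f (u n) <= p <= g (u n).
  move=> h fg.
  have hf m n : (m <= n)%N -> f (u m) <= f (u n).
    move=> /subnK <-; elim: (n - m)%N => //= k IH.
    by apply: le_trans IH _; exact: (h (k + m)%N).1.
  have hg m n : (m <= n)%N -> g (u n) <= g (u m).
    move=> /subnK <-; elim: (n - m)%N => //= k IH.
    by apply: le_trans _ IH; exact: (h (k + m)%N).2.
  have ub n : ubound (range (f \o u)) (g (u n)).
    move=> _ [m _ <-] /=; case: (leqP m n) => mn.
      by apply: le_trans (hf _ _ mn) (fg n).
    by apply: le_trans (fg m) (hg _ _ (ltnW mn)).
  exists (sup (range (f \o u))) => n; apply/andP; split.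
    by apply: ub_le_sup; [exists (g (u 0%N)); exact: ub|exists n].
  by apply: ge_sup (ub n); exists (f (u 0%N)); exists 0%N.
have [p pP] : exists p, forall n, (u n).1.1 <= p <= (u n).1.1 + (u n).2.
  apply: (mono (fun a => a.1.1) (fun a => a.1.1 + a.2)) => n.
    by have [_ _ + _] := uc n.
  by rewrite lerDl.
have [q qP] : exists q, forall n, (u n).1.2 <= q <= (u n).1.2 + (u n).2.
  apply: (mono (fun a => a.1.2) (fun a => a.1.2 + a.2)) => n.
    by have [_ _ _ +] := uc n.
  by rewrite lerDl.
have inn n : [/\ 0 <= (u n).1.1, (u n).1.1 + (u n).2 <= 1, 0 <= (u n).1.2 &
    (u n).1.2 + (u n).2 <= 1].
  elim: n => [|n [h1 h2 h3 h4]]; first by rewrite /u /=; split; lra.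
  by have [_ _ [a1 a2] [b1 b2]] := uc n; split; lra.
have [d d0 dP] := Ploc p q ltac:(have := pP 0%N; rewrite /u/=; lra)
  ltac:(have := qP 0%N; rewrite /u/=; lra).
have [n nP'] := half_exp_lt d0.
have [a1 a2 a3 a4] := inn n.
case: (us n) => + _; apply; apply: dP => //.
by rewrite s0 (us n).2 nP'.
Qed.

End Cousin.

Section DiscreteGoursat.
Variable R : realType.
Implicit Types (l : R[i] -> R[i]) (c : R -> R[i]).

(** Complex differentiability without a division by [h], so that [h = 0] is no exception. *)
Definition cdiff l (t d : R[i]) := forall e : R, 0 < e -> exists2 r : R, 0 < r &
  forall h, normc h < r -> normc (l (t + h) - l t - d * h) <= e * normc h.

Definition trapezoid l (u v : R[i]) := (l u + l v) / 2 * (v - u).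

(** Trapezoidal sums for the integral of [l] along [c]. With [2 ^ n] pieces they split exactly when
    the path is halved, so Goursat's bisection runs on the sums themselves. *)
Definition path_sum l c n (a s : R) := \sum_(i < 2 ^ n)
  trapezoid l (c (a + s * (i%:R / 2 ^+ n))) (c (a + s * (i.+1%:R / 2 ^+ n))).

Lemma path_sum_split l c n a s :
  path_sum l c n.+1 a s = path_sum l c n a (s / 2) + path_sum l c n (a + s / 2) (s / 2).
Proof.
have e2 : 2 ^+ n != 0 :> R by rewrite expf_neq0.
have -> : path_sum l c n.+1 a s = \sum_(0 <= i < 2 ^ n + 2 ^ n)
  trapezoid l (c (a + s * (i%:R / 2 ^+ n.+1))) (c (a + s * (i.+1%:R / 2 ^+ n.+1))).
  by rewrite /path_sum big_mkord expnS mul2n -addnn.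
rewrite (big_cat_nat (n := (2 ^ n)%N)) ?leq_addr//=; congr (_ + _).
  rewrite big_mkord; apply: eq_bigr => i _; congr trapezoid; congr c; rewrite exprS;
  by field.
rewrite -{1}(add0n (2 ^ n)%N) big_addn addnK big_mkord; apply: eq_bigr => i _.
by congr trapezoid; congr c; rewrite exprS -?addSn natrD natrX; field.
Qed.

Definition boundary_sum l (g : R -> R -> R[i]) n (x y s : R) :=
  path_sum l (g ^~ y) n x s + path_sum l (g (x + s)) n y s
  - path_sum l (g ^~ (y + s)) n x s - path_sum l (g x) n y s.

(** Each inner side is run through twice, in opposite directions. *)
Lemma boundary_sum_split l g n x y s : boundary_sum l g n.+1 x y s =
  boundary_sum l g n x y (s / 2) + boundary_sum l g n (x + s / 2) y (s / 2) +
  boundary_sum l g n x (y + s / 2) (s / 2) + boundary_sum l g n (x + s / 2) (y + s / 2) (s / 2).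
Proof.
have h a : a + s / 2 + s / 2 = a + s by field.
by rewrite /boundary_sum !path_sum_split !h; ring.
Qed.

Definition affine_prim (p l0 l1 t : R[i]) := l0 * t + l1 * (t - p) ^+ 2 / 2.

(** The trapezoidal rule is exact on affine functions and their primitive [affine_prim] telescopes.
    What is left is the first-order remainder [eta] times the length of the path, at most
    [K * s]. *)
Lemma path_sum_affine l c n (a s K eta : R) (p l0 l1 : R[i]) : 0 <= s -> 0 <= K ->
  (forall x y, a <= x <= a + s -> a <= y <= a + s -> normc (c x - c y) <= K * `|x - y|) ->
  (forall x, a <= x <= a + s -> normc (l (c x) - l0 - l1 * (c x - p)) <= eta) ->
  normc (path_sum l c n a s - (affine_prim p l0 l1 (c (a + s)) - affine_prim p l0 l1 (c a)))
    <= eta * K * s.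
Proof.
move=> s0 K0 cK lc; set L := affine_prim p l0 l1.
have e2 : 0 < 2 ^+ n :> R by rewrite exprn_gt0.
have e20 : 2 ^+ n != 0 :> R by rewrite gt_eqF.
pose t i : R := a + s * (i%:R / 2 ^+ n).
have tin i : (i <= 2 ^ n)%N -> a <= t i <= a + s.
  move=> ile; rewrite /t; apply/andP; split.
    by rewrite lerDl mulr_ge0// divr_ge0// ltW.
  by rewrite lerD2l ler_piMr// ler_pdivrMr// mul1r -natrX ler_nat.
have -> : L (c (a + s)) - L (c a) = \sum_(i < 2 ^ n) (L (c (t i.+1)) - L (c (t i))).
  rewrite -(big_mkord xpredT (fun i => L (c (t i.+1)) - L (c (t i)))) telescope_sumr//.
  by rewrite /t natrX divff// mulr1 mul0r mulr0 addr0.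
rewrite /path_sum -sumrB; apply: le_trans (le_normc_sum _ _ _) _.
apply: (@le_trans _ _ (\sum_(i < 2 ^ n) eta * K * s / 2 ^+ n)); last first.
  by rewrite sumr_const card_ord -[leLHS]mulr_natr natrX divfK.
apply: ler_sum => i _; rewrite -!/(t _).
set u := c (t i); set v := c (t i.+1).
have -> : trapezoid l u v - (L v - L u) =
    ((l u - l0 - l1 * (u - p)) + (l v - l0 - l1 * (v - p))) / 2 * (v - u).
  by rewrite /trapezoid /L /affine_prim; field.
rewrite !normcM -!mulrA; have -> : s / 2 ^+ n = `|t i.+1 - t i|.
  have -> : t i.+1 - t i = s / 2 ^+ n by rewrite /t -natr1; field.
  by rewrite ger0_norm// divr_ge0// ltW.
rewrite mulrA; apply: ler_pM; rewrite ?mulr_ge0 ?normc_ge0//; last first.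
  by apply: cK; apply: tin; [exact: ltn_ord|exact: ltnW].
rewrite normcV normc_nat ler_pdivrMr// mulr_natr mulr2n; apply: le_trans (le_normcD _ _) _.
by apply: lerD; apply: lc; apply: tin; [exact: ltnW|exact: ltn_ord].
Qed.

(** The bound [e * s ^+ 2] is additive under division into four squares, so [cousin] asks for it
    only on small squares around a point of differentiability. There the affine part telescopes
    around the boundary, and the remainder is of order [s] on sides of length at most [K * s]. *)
Lemma discrete_goursat l (g : R -> R -> R[i]) (K : R) : 0 <= K ->
  (forall x y x' y', 0 <= x <= 1 -> 0 <= x' <= 1 ->
     normc (g x y - g x' y') <= K * (`|x - x'| + `|y - y'|)) ->
  (forall x y, 0 <= x <= 1 -> 0 <= y <= 1 -> exists d, cdiff l (g x y) d) ->
  forall e : R, 0 < e -> exists n0, forall n, (n0 <= n)%N -> normc (boundary_sum l g n 0 0 1) <= e.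
Proof.
move=> K0 gK ld e e0.
suff: exists n0, forall n, (n0 <= n)%N -> normc (boundary_sum l g n 0 0 1) <= e * 1 ^+ 2.
  by rewrite expr1n mulr1.
apply: (@cousin R (fun x y s => exists n0, forall n, (n0 <= n)%N ->
    normc (boundary_sum l g n x y s) <= e * s ^+ 2)).
  move=> x y s [n1 h1] [n2 h2] [n3 h3] [n4 h4].
  exists (maxn (maxn n1 n2) (maxn n3 n4)).+1 => -[//|n].
  rewrite ltnS !geq_max => /andP[/andP[k1 k2] /andP[k3 k4]].
  rewrite boundary_sum_split; apply: le_trans (le_normcD _ _) _.
  have -> : e * s ^+ 2 = (e * (s / 2) ^+ 2 + e * (s / 2) ^+ 2 + e * (s / 2) ^+ 2) +
    e * (s / 2) ^+ 2 by field.
  apply: lerD (h4 _ k4); apply: le_trans (le_normcD _ _) _.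
  apply: lerD (h3 _ k3); apply: le_trans (le_normcD _ _) _.
  by apply: lerD (h1 _ k1) (h2 _ k2).
move=> p q pI qI; have [d dP] := ld p q pI qI.
have K1 : 0 < K + 1 by lra.
(* The boundary lies within [2 * (K + 1) * s] of the image of [(p, q)]; this constant then makes the
   four sides contribute at most [e * s ^+ 2 * (K / (K + 1))]. *)
have [r r0 rP] := dP (e / (8 * (K + 1) ^+ 2)) ltac:(by rewrite divr_gt0// mulr_gt0// exprn_gt0).
exists (r / (2 * (K + 1))); first by rewrite divr_gt0// mulr_gt0.
move=> x y s x0 x1 y0 y1 /andP[s0 sd] px qy; exists 0%N => n _.
set eta := e / (8 * (K + 1) ^+ 2) * (2 * (K + 1) * s).
have near x' y' : x <= x' <= x + s -> y <= y' <= y + s ->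
    normc (l (g x' y') - l (g p q) - d * (g x' y' - g p q)) <= eta.
  move=> hx hy.
  have hg : normc (g x' y' - g p q) <= 2 * (K + 1) * s.
    apply: le_trans (gK _ _ _ _ _ pI) _; first lra.
    apply: (@le_trans _ _ (K * (s + s))).
      by apply: ler_wpM2l => //; apply: lerD; rewrite ler_norml; lra.
    by have := mulr_ge0 K0 s0; lra.
  have hr : normc (g x' y' - g p q) < r.
    apply: le_lt_trans hg _; move: sd; rewrite ltr_pdivlMr ?mulr_gt0//; lra.
  have := rP _ hr; rewrite (addrC (g p q)) subrK => h; apply: le_trans h _.
  by apply: ler_wpM2l hg; rewrite divr_ge0 ?mulr_ge0 ?exprn_ge0 ?ltW.
pose L := affine_prim (g p q) (l (g p q)) d.
have path c a : (forall x y, a <= x <= a + s -> a <= y <= a + s ->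
      normc (c x - c y) <= K * `|x - y|) ->
    (forall x, a <= x <= a + s ->
      normc (l (c x) - l (g p q) - d * (c x - g p q)) <= eta) ->
    normc (path_sum l c n a s - (L (c (a + s)) - L (c a))) <= eta * K * s.
  by move=> h1 h2; exact: (path_sum_affine n s0 K0 h1 h2).
have h1 := path (g ^~ y) x _ (fun x' hx => near x' y hx ltac:(lra)).
have h2 := path (g (x + s)) y _ (fun y' hy => near (x + s) y' ltac:(lra) hy).
have h3 := path (g ^~ (y + s)) x _ (fun x' hx => near x' (y + s) hx ltac:(lra)).
have h4 := path (g x) y _ (fun y' hy => near x y' ltac:(lra) hy).
have gx yy : forall x' x'', x <= x' <= x + s -> x <= x'' <= x + s ->
    normc (g x' yy - g x'' yy) <= K * `|x' - x''|.
  move=> x' x'' H1 H2; have := gK x' yy x'' yy ltac:(lra) ltac:(lra).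
  by rewrite subrr normr0 addr0.
have gy xx : 0 <= xx <= 1 -> forall x' x'', y <= x' <= y + s -> y <= x'' <= y + s ->
    normc (g xx x' - g xx x'') <= K * `|x' - x''|.
  move=> H x' x'' H1 H2; have := gK xx x' xx x'' H H.
  by rewrite subrr normr0 add0r.
move: (h1 (gx _)) (h2 (gy (x + s) ltac:(lra))) (h3 (gx _)) (h4 (gy x ltac:(lra))).
rewrite /boundary_sum; set A := path_sum _ _ _ _ _; set B := path_sum _ (g (x + s)) _ _ _.
set C := path_sum _ _ _ _ _; set D := path_sum _ (g x) _ _ _ => k1 k2 k3 k4.
have -> : A + B - C - D = (A - (L (g (x + s) y) - L (g x y))) +
   (B - (L (g (x + s) (y + s)) - L (g (x + s) y))) -
   (C - (L (g (x + s) (y + s)) - L (g x (y + s)))) -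
   (D - (L (g x (y + s)) - L (g x y))) by ring.
apply: le_trans (le_normcB _ _) _; apply: (@le_trans _ _ (4 * (eta * K * s))).
  have -> : 4 * (eta * K * s) = eta * K * s + eta * K * s + eta * K * s + eta * K * s by ring.
  apply: lerD k4; apply: le_trans (le_normcB _ _) _; apply: lerD k3.
  by apply: le_trans (le_normcD _ _) _; exact: lerD.
have -> : 4 * (eta * K * s) = e * s ^+ 2 * (K / (K + 1)).
  by rewrite /eta; field; rewrite gt_eqF.
rewrite ler_piMr ?mulr_ge0 ?sqr_ge0 ?(ltW e0)//.
by rewrite ler_pdivrMr// mul1r lerDl.
Qed.

End DiscreteGoursat.

Lemma sum_pow2_const (K : nzRingType) m (x : K) : \sum_(0 <= i < 2 ^ m) x = 2 ^+ m * x.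
Proof. by rewrite sumr_const_nat subn0 -[LHS]mulr_natl natrX. Qed.

Lemma dyadic_in (R : realType) m i : (i <= 2 ^ m)%N -> 0 <= (i%:R / 2 ^+ m : R) <= 1.
Proof.
move=> im; apply/andP; split; first by rewrite divr_ge0// exprn_ge0.
by rewrite ler_pdivrMr ?exprn_gt0// mul1r -natrX ler_nat.
Qed.

(** * Means over equidistant points of a circle *)

Section Circle.
Variable R : realType.
Implicit Types (k l : R[i] -> R[i]) (y : R).

Definition cis y : R[i] := Complex (cos (pi *+ 2 * y)) (sin (pi *+ 2 * y)).

Lemma cisD x y : cis (x + y) = cis x * cis y.
Proof.
rewrite /cis mulrDr sinD cosD; apply/eqP; rewrite eq_complex/=.
by apply/andP; split; apply/eqP; ring.
Qed.

Lemma cis0 : cis 0 = 1. Proof. by rewrite /cis mulr0 cos0 sin0. Qed.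
Lemma cis1 : cis 1 = 1. Proof. by rewrite /cis mulr1 cos2pi sin2pi. Qed.
Lemma cis_half : cis 2^-1 = -1.
Proof.
rewrite /cis (_ : pi *+ 2 * 2^-1 = pi) ?cospi ?sinpi; last by field.
by apply/eqP; rewrite eq_complex/= oppr0 !eqxx.
Qed.

Lemma cis_neq0 y : cis y != 0.
Proof.
apply/eqP => h; have := cisD y (- y); rewrite subrr cis0 h mul0r => /eqP.
by rewrite oner_eq0.
Qed.

Lemma cisN y : cis (- y) = (cis y)^-1.
Proof.
by apply: (mulfI (cis_neq0 y)); rewrite -cisD subrr cis0 mulfV// cis_neq0.
Qed.

Lemma cisMn y n : cis (n%:R * y) = cis y ^+ n.
Proof.
by elim: n => [|n IH]; rewrite ?mul0r ?cis0// -natr1 mulrDl mul1r cisD IH exprSr.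
Qed.

Lemma normc_cis y : normc (cis y) = 1.
Proof. by rewrite /= cos2Dsin2 sqrtr1. Qed.

Lemma conj_cis y : ((cis y)^*)%C = (cis y)^-1.
Proof. by rewrite -cisN /cis /= mulrN cosN sinN. Qed.

Lemma cis_neq1 y : 0 < y < 1 -> cis y != 1.
Proof.
move=> /andP[y0 y1]; rewrite eq_complex/= negb_and; apply/orP; left.
have -> : pi *+ 2 * y = (pi * y) *+ 2 by rewrite mulrnAl.
rewrite cos_mulr2n cos2sin2; have := @sin_gt0_pi R (pi * y).
rewrite mulr_gt0 ?pi_gt0// gtr_pMr ?pi_gt0// => /(_ y1) s0.
have : 0 < sin (pi * y) ^+ 2 by rewrite exprn_gt0.
by move=> s20; apply/eqP; lra.
Qed.

Lemma sum_cis (N d : nat) : (0 < d < N)%N ->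
  \sum_(i < N) cis (d%:R / N%:R) ^+ i = 0.
Proof.
move=> /andP[d0 dN]; have N0 : (0 < N)%N by apply: leq_ltn_trans dN.
have N0' : N%:R != 0 :> R by rewrite pnatr_eq0 -lt0n.
set z := cis _; have z1 : z != 1.
  by apply: cis_neq1; rewrite divr_gt0 ?ltr0n//= ltr_pdivrMr ?ltr0n// mul1r ltr_nat.
have zN : z ^+ N = 1.
  by rewrite -cisMn mulrC divfK// -[d%:R]mulr1 cisMn cis1 expr1n.
have /esym/eqP := subrX1 z N.
by rewrite zN subrr mulf_eq0 subr_eq0 (negbTE z1) => /eqP.
Qed.

Lemma MVT_lip (f df : R -> R) (a b : R) :
  (forall x : R, is_derive x 1 f (df x)) -> (forall x, `|df x| <= 1) ->
  `|f a - f b| <= `|a - b|.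
Proof.
move=> fd d1; wlog ab : a b / a <= b.
  by move=> h; case: (leP a b) => [/h//|/ltW/h]; rewrite distrC (distrC b).
have fc : {within `[a, b], continuous f}.
  apply: derivable_within_continuous => x _; exact: (@ex_derive _ _ _ _ _ _ _ (fd x)).
have [c _ h] := MVT_segment ab (fun x _ => fd x) fc.
by rewrite distrC h normrM (distrC a) ler_piMl.
Qed.

Lemma normc_cisB x y : normc (cis x - cis y) <= 4 * pi * `|x - y|.
Proof.
apply: le_trans (normc_le_ReIm _) _ => /=.
have e : `|pi *+ 2 * x - pi *+ 2 * y| = 2 * pi * `|x - y|.
  have p0 : 0 <= pi *+ 2 :> R by apply: mulrn_wge0; exact: pi_ge0.
  by rewrite -mulrBr normrM (ger0_norm p0) -(mulr_natl pi 2).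
have -> : 4 * pi * `|x - y| = 2 * pi * `|x - y| + 2 * pi * `|x - y| by lra.
rewrite -e.
apply: lerD.
  by apply: (@MVT_lip cos (fun x => - sin x)) => z; rewrite ?normrN ?sin_max.
by apply: (@MVT_lip sin cos) => z; rewrite cos_max.
Qed.

Definition circle_avg n k (r : R) := (2 ^+ n)^-1 * \sum_(i < 2 ^ n) k (r%:C%C * cis (i%:R / 2 ^+ n)).

Lemma circle_avg_le n k r M : (forall y, normc (k (r%:C%C * cis y)) <= M) ->
  normc (circle_avg n k r) <= M.
Proof.
move=> kM; rewrite /circle_avg normcM normcV normcX normc_nat ler_pdivrMl ?exprn_gt0//.
apply: le_trans (le_normc_sum _ _ _) _.
apply: (@le_trans _ _ (\sum_(i < 2 ^ n) M)); first exact: ler_sum.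
by rewrite sumr_const card_ord -[leLHS]mulr_natl natrX.
Qed.

Lemma eq_circle_avg n k k' r : (forall y, k (r%:C%C * cis y) = k' (r%:C%C * cis y)) ->
  circle_avg n k r = circle_avg n k' r.
Proof. by move=> h; rewrite /circle_avg; congr (_ * _); apply: eq_bigr => i _. Qed.

Lemma circle_avgD n k k' r : circle_avg n (fun t => k t + k' t) r = circle_avg n k r + circle_avg n k' r.
Proof. by rewrite /circle_avg big_split mulrDr. Qed.

Lemma circle_avgZ n a k r : circle_avg n (fun t => a * k t) r = a * circle_avg n k r.
Proof. by rewrite /circle_avg -mulr_sumr mulrCA. Qed.

Lemma circle_avg_sum n I (s : seq I) (F : I -> R[i] -> R[i]) r :
  circle_avg n (fun t => \sum_(i <- s) F i t) r = \sum_(i <- s) circle_avg n (F i) r.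
Proof. by rewrite /circle_avg exchange_big/= mulr_sumr. Qed.

(** For consecutive points [u] and [v = u * w] the trapezoid [(l u + l v) / 2 * (v - u)] is a
    multiple of [l u * u] plus a multiple of [l v * v]; along the closed polygon the two sums merge.
    Boundary sums thereby turn into averages. *)
Lemma path_sum_circle l n (r : R) :
  path_sum l (fun y => r%:C%C * cis y) n 0 1 =
  2 ^+ n * (cis (2 ^+ n)^-1 - (cis (2 ^+ n)^-1)^-1) / 2 * circle_avg n (fun t => l t * t) r.
Proof.
set h := (2 ^+ n)^-1; set w := cis h.
have e2 : 2 ^+ n != 0 :> R[i] by rewrite expf_neq0.
have e2' : 2 ^+ n != 0 :> R by rewrite expf_neq0.
have w0 : w != 0 by exact: cis_neq0.
pose u i := r%:C%C * w ^+ i.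
pose k t := l t * t.
have uE i : r%:C%C * cis (0 + 1 * (i%:R / 2 ^+ n)) = u i by rewrite /u -cisMn mul1r add0r.
have uE' i : r%:C%C * cis (i%:R / 2 ^+ n) = u i by rewrite /u -cisMn.
have uN : u (2 ^ n)%N = u 0%N by rewrite /u -cisMn natrX mulfV// cis1 expr0.
rewrite /circle_avg; under [X in _ = _ * (_ * X)]eq_bigr do rewrite uE'.
have -> : path_sum l (fun y => r%:C%C * cis y) n 0 1 = \sum_(i < 2 ^ n) trapezoid l (u i) (u i.+1).
  by apply: eq_bigr => i _; rewrite !uE.
have -> : \sum_(i < 2 ^ n) trapezoid l (u i) (u i.+1) =
    \sum_(i < 2 ^ n) (k (u i) * ((w - 1) / 2) + k (u i.+1) * ((1 - w^-1) / 2)).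
  apply: eq_bigr => i _; rewrite /trapezoid /k.
  have -> : u i.+1 = u i * w by rewrite /u exprSr mulrA.
  by field.
rewrite big_split/= -!mulr_suml.
have -> : \sum_(i < 2 ^ n) k (u i.+1) = \sum_(i < 2 ^ n) k (u i).
  have N0 : (0 < 2 ^ n)%N by rewrite expn_gt0.
  move: uN; rewrite -(prednK N0); set m := (2 ^ n).-1 => uN.
  by rewrite big_ord_recr [RHS]big_ord_recl /= uN addrC.
by field; rewrite e2 w0.
Qed.

(** Rotation by [w ^+ 2] leads from 1 to -1, over a distance of 2, in [2 ^ n] steps of length
    [normc (w - w^-1)]. Hence the factor in [path_sum_circle] stays away from 0. *)
Lemma cis_sin_lower n : 8 <= 2 ^+ n.+2 * normc (cis (2 ^+ n.+2)^-1 - (cis (2 ^+ n.+2)^-1)^-1).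
Proof.
set h := (2 ^+ n.+2)^-1; set w := cis h.
have e2' : 2 ^+ n != 0 :> R by rewrite expf_neq0.
have w0 : w != 0 by exact: cis_neq0.
have : \sum_(0 <= j < 2 ^ n) ((w ^+ 2) ^+ j.+1 - (w ^+ 2) ^+ j) = - 2.
  rewrite telescope_sumr// expr0 -exprM /w -cisMn.
  have -> : (2 * 2 ^ n)%:R * h = 2^-1.
    by rewrite /h natrM natrX !exprS; field.
  by rewrite cis_half; ring.
rewrite big_mkord => /(congr1 (@normc R)); rewrite normcN normc_nat => e.
have : 2 <= \sum_(i < 2 ^ n) normc (w - w^-1).
  rewrite -e; apply: le_trans (le_normc_sum _ _ _) _; apply: ler_sum => i _.
  have -> : (w ^+ 2) ^+ i.+1 - (w ^+ 2) ^+ i = (w ^+ 2) ^+ i * w * (w - w^-1).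
    by rewrite exprS; field.
  by rewrite !normcM !normcX /w normc_cis !expr1n !mul1r.
rewrite sumr_const card_ord -[X in _ <= X -> _]mulr_natl natrX !exprS; lra.
Qed.

(** Goursat's theorem in polar coordinates on the annulus: the two radial sides coincide because
    [cis 0 = cis 1], and cancel; the circular sides are averages. *)
Lemma circle_avg_goursat l (r0 r1 : R) : 0 <= r0 <= r1 ->
  (forall t, r0 <= normc t <= r1 -> exists d, cdiff l t d) ->
  forall e : R, 0 < e -> exists n0, forall n, (n0 <= n)%N ->
    normc (circle_avg n (fun t => l t * t) r1 - circle_avg n (fun t => l t * t) r0) <= e.
Proof.
move=> /andP[r00 r01] ld e e0.
pose g x y := (r0 + x * (r1 - r0))%:C%C * cis y.
have rin x : 0 <= x <= 1 -> r0 <= r0 + x * (r1 - r0) <= r1 by nra.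
(* The factor of [path_sum_circle] has modulus at least 4, whence [4 * e]. *)
have [] := @discrete_goursat R l g (r1 - r0 + r1 * (4 * pi)) _ _ _ (4 * e) _.
- by rewrite addr_ge0 ?subr_ge0// !mulr_ge0 ?pi_ge0//; lra.
- move=> x y x' y' xI xI'.
  have -> : g x y - g x' y' = ((x - x') * (r1 - r0))%:C%C * cis y +
      (r0 + x' * (r1 - r0))%:C%C * (cis y - cis y').
    by rewrite /g !rmorphD !rmorphM !rmorphB; ring.
  apply: le_trans (le_normcD _ _) _; rewrite !normcM normc_cis mulr1 !normc_real.
  have /andP[h1 h2] := rin _ xI'.
  rewrite normrM (@ger0_norm _ (r1 - r0)) ?subr_ge0// (@ger0_norm _ (r0 + _)); last lra.
  have := normc_cisB y y' => h3.
  have := normr_ge0 (x - x'); have := normr_ge0 (y - y'); have := @pi_ge0 R => p0 a0 b0.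
  have h4 : (r0 + x' * (r1 - r0)) * normc (cis y - cis y') <= r1 * (4 * pi * `|y - y'|).
    by apply: ler_pM => //; [lra|exact: normc_ge0].
  have k1 : 0 <= r1 * (4 * pi) * `|x - x'| by rewrite !mulr_ge0//; lra.
  have k2 : 0 <= (r1 - r0) * `|y - y'| by rewrite !mulr_ge0//; lra.
  lra.
- move=> x y xI _; apply: ld; rewrite /g normcM normc_cis mulr1 normc_real ger0_norm.
    exact: rin.
  by have := rin _ xI; lra.
- lra.
move=> n0 h; exists (n0 + 2)%N => n nn; have := h n (leq_trans (leq_addr _ _) nn).
rewrite /boundary_sum.
have -> : path_sum l (g^~ (0 + 1)) n 0 1 = path_sum l (g^~ 0) n 0 1.
  by rewrite /g add0r cis0 cis1.
have -> : g (0 + 1) = (fun y => r1%:C%C * cis y).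
  by apply/funext => y; rewrite /g; congr (_%:C%C * _); ring.
have -> : g 0 = (fun y => r0%:C%C * cis y).
  by apply/funext => y; rewrite /g; congr (_%:C%C * _); ring.
rewrite (addrC (path_sum l (g^~ 0) n 0 1)) addrK !path_sum_circle -mulrBr.
rewrite !normcM normcV normcX !normc_nat => h'.
have [m nE] : exists m, n = m.+2.
  by exists (n - 2)%N; rewrite -[LHS](@subnK 2) ?addn2// (leq_trans _ nn)// leq_addl.
have := cis_sin_lower m; rewrite -nE => h8.
set D := normc _; have D0 : 0 <= D by exact: normc_ge0.
have := ler_wpM2r D0 h8.
move: h'; rewrite -/D; lra.
Qed.

Definition ccont k t := forall e : R, 0 < e -> exists2 d : R, 0 < d &
  forall h, normc h < d -> normc (k (t + h) - k t) <= e.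

(** The radius varies as well, so that the mean over a circle can be compared with the means over
    nearby circles. *)
Lemma circle_uniform k (r : R) : (forall t, normc t = `|r| -> ccont k t) ->
  forall e : R, 0 < e -> exists2 d : R, 0 < d & forall y1 y2 r', 0 <= y1 <= 1 ->
    `|y1 - y2| < d -> `|r' - r| < d ->
    normc (k (r%:C%C * cis y1) - k (r'%:C%C * cis y2)) <= e.
Proof.
move=> kc e e0.
suff: exists2 d : R, 0 < d & forall y1 y2 r', 0 <= y1 <= 0 + 1 ->
    `|y1 - y2| < d -> `|r' - r| < d ->
    normc (k (r%:C%C * cis y1) - k (r'%:C%C * cis y2)) <= e by rewrite add0r.
apply: (@cousin R (fun x y s => exists2 d : R, 0 < d &
    forall y1 y2 r', y <= y1 <= y + s ->
    `|y1 - y2| < d -> `|r' - r| < d ->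
    normc (k (r%:C%C * cis y1) - k (r'%:C%C * cis y2)) <= e)).
  move=> x y s [d1 d10 h1] _ [d2 d20 h2] _.
  exists (Num.min d1 d2); first by rewrite lt_min d10.
  move=> y1 y2 r' yI; rewrite !lt_min => /andP[a1 a2] /andP[b1 b2].
  by case: (leP y1 (y + s / 2)) => c; [apply: h1|apply: h2] => //; lra.
move=> p q _ qI.
have [d d0 dP] := kc (r%:C%C * cis q) ltac:(by rewrite normcM normc_cis mulr1 normc_real)
  (e / 2) ltac:(lra).
(* A change of the radius by less than [m] and of the angle by less than [2 * m] moves the point by
   less than [m * K], which is at most [d]. *)
pose K := 1 + (`|r| + 1) * (8 * pi).
have K1 : 1 <= K by rewrite /K lerDl !mulr_ge0 ?pi_ge0// addr_ge0.
have K0 : 0 < K by lra.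
pose m := Num.min (d / K) 1.
have m0 : 0 < m by rewrite lt_min ltr01 divr_gt0.
have m1 : m <= 1 by rewrite ge_min lexx orbT.
have mK : m * K <= d by rewrite -ler_pdivlMr// ge_min lexx.
exists m => //.
move=> x y s _ _ y0 y1 /andP[s0 sm] _ qy; exists m => // z1 z2 r' zI zz rr.
have near r2 z : `|r2 - r| < m -> `|z - q| < 2 * m ->
    normc (k (r2%:C%C * cis z) - k (r%:C%C * cis q)) <= e / 2.
  move=> hr hz; rewrite -[r2%:C%C * cis z](subrK (r%:C%C * cis q)) addrC.
  rewrite (addrC (_ - r%:C%C * cis q)) addrC; apply: dP.
  have -> : r2%:C%C * cis z - r%:C%C * cis q = (r2 - r)%:C%C * cis z + r%:C%C * (cis z - cis q).
    by rewrite rmorphB; ring.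
  apply: le_lt_trans (le_normcD _ _) _; rewrite !normcM normc_cis mulr1 !normc_real.
  have := normc_cisB z q => h3; have p0 := @pi_gt0 R; have r0 := normr_ge0 r.
  have : `|r| * normc (cis z - cis q) <= (`|r|) * (4 * pi * (2 * m)).
    apply: ler_wpM2l => //; apply: le_trans h3 _; apply: ler_wpM2l; first lra.
    exact: ltW.
  have : 0 <= m * pi by rewrite mulr_ge0 ?ltW.
  move: mK; rewrite /K; lra.
apply: le_trans (le_normc_dist _ (k (r%:C%C * cis q)) _) _.
have -> : e = e / 2 + e / 2 by field.
apply: lerD.
  by apply: near; rewrite ?subrr ?normr0// ltr_norml; lra.
rewrite normc_distC; apply: near => //; move: zz; rewrite !ltr_norml; lra.
Qed.

End Circle.

Section Taylor.
Variable R : realType.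
Implicit Types (k l g : R[i] -> R[i]).

Definition ccvg (u : nat -> R[i]) (a : R[i]) := forall e : R, 0 < e ->
  exists n0, forall n, (n0 <= n)%N -> normc (u n - a) <= e.

Lemma ccauchy (u : nat -> R[i]) :
  (forall e : R, 0 < e -> exists n, forall m, normc (u (n + m)%N - u n) <= e) ->
  exists a, ccvg u a.
Proof.
move=> uc.
have real (v : nat -> R) : (forall e : R, 0 < e -> exists n, forall m,
    `|v (n + m)%N - v n| <= e) -> exists a : R, forall e : R, 0 < e ->
    exists n0, forall n, (n0 <= n)%N -> `|v n - a| <= e.
  move=> vc.
  have : cvg (v @ \oo).
    apply: cauchy_cvg; apply: cauchy_exP => e e0.
    have [n nP] := vc (e / 2) ltac:(by rewrite divr_gt0).
    exists (v n); exists n => // m /= nm; rewrite /ball/= distrC.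
    by rewrite -(subnKC nm); apply: le_lt_trans (nP _) _; lra.
  move=> /cvg_ex[a va]; exists a => e e0.
  have /cvgrPdist_le/(_ e e0)[n _ nP] := va.
  by exists n => m nm; rewrite distrC; exact: nP.
have [a aP] : exists a : R, forall e : R, 0 < e ->
    exists n0, forall n, (n0 <= n)%N -> `|complex.Re (u n) - a| <= e.
  apply: real => e e0; have [n nP] := uc e e0; exists n => m.
  by rewrite -ReB; apply: le_trans (norm_Re_le _) (nP m).
have [b bP] : exists b : R, forall e : R, 0 < e ->
    exists n0, forall n, (n0 <= n)%N -> `|complex.Im (u n) - b| <= e.
  apply: real => e e0; have [n nP] := uc e e0; exists n => m.
  by rewrite -ImB; apply: le_trans (norm_Im_le _) (nP m).
exists (Complex a b) => e e0.
have [n1 h1] := aP (e / 2) ltac:(by rewrite divr_gt0).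
have [n2 h2] := bP (e / 2) ltac:(by rewrite divr_gt0).
exists (maxn n1 n2) => n; rewrite geq_max => /andP[k1 k2].
apply: le_trans (normc_le_ReIm _) _; rewrite ReB ImB /=.
by have := h1 _ k1; have := h2 _ k2; lra.
Qed.

Lemma ccvg_unique u a b : ccvg u a -> ccvg u b -> a = b.
Proof.
move=> ua ub; apply/eqP; rewrite -subr_eq0 -normc_eq0; apply/eqP/le_anti.
rewrite normc_ge0 andbT; apply/ler_addgt0Pr => e e0; rewrite add0r.
have [n1 h1] := ua (e / 2) ltac:(by rewrite divr_gt0).
have [n2 h2] := ub (e / 2) ltac:(by rewrite divr_gt0).
apply: le_trans (le_normc_dist _ (u (maxn n1 n2)) _) _; rewrite (normc_distC a).
by have := h1 _ (leq_maxl n1 n2); have := h2 _ (leq_maxr n1 n2); lra.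
Qed.

Lemma cdiff_ccont l t d : cdiff l t d -> ccont l t.
Proof.
move=> ld e e0; have [r r0 rP] := ld 1 ltr01.
pose K := normc d + 1; have K0 : 0 < K by rewrite /K ltr_wpDl ?normc_ge0.
exists (Num.min r (e / K)); first by rewrite lt_min r0 divr_gt0.
move=> h; rewrite lt_min => /andP[h1]; rewrite ltr_pdivlMr// => h2.
have -> : l (t + h) - l t = (l (t + h) - l t - d * h) + d * h by ring.
apply: le_trans (le_normcD _ _) _; rewrite normcM; have := rP _ h1; rewrite /K in h2; nra.
Qed.

Lemma cdiff_local l l' t d (r : R) : 0 < r -> (forall h, normc h < r -> l (t + h) = l' (t + h)) ->
  cdiff l t d -> cdiff l' t d.
Proof.
move=> r0 ll ld e e0; have [s s0 sP] := ld e e0.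
exists (Num.min r s); first by rewrite lt_min r0.
move=> h; rewrite lt_min => /andP[h1 h2]; rewrite -ll//.
by rewrite -[t in l' t]addr0 -ll ?normc0// addr0; exact: sP.
Qed.

(* Quotient rule for division by [t - a], written out because only this case occurs. *)
Lemma cdiff_divB g (a c t d : R[i]) : t != a -> cdiff g t d ->
  exists d', cdiff (fun t => (g t - c) / (t - a)) t d'.
Proof.
move=> ta gd; have ta0 : t - a != 0 by rewrite subr_eq0.
set w := t - a; set G := g t - c.
exists (d / w - G / w ^+ 2) => e e0.
have w0 : 0 < normc w by rewrite normc_gt0.
pose D := normc d; pose N := normc G.
have D0 : 0 <= D by exact: normc_ge0.
have N0 : 0 <= N by exact: normc_ge0.
pose W := normc w.
have [r r0 rP] := gd (e * W / 4) ltac:(by rewrite divr_gt0// mulr_gt0).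
pose K := 2 * D / W ^+ 2 + 2 * N / W ^+ 3 + 1.
have K0 : 0 < K by rewrite /K ltr_wpDl// addr_ge0// divr_ge0 ?mulr_ge0// ?exprn_ge0// ltW.
exists (Num.min r (Num.min (W / 2) (e / 2 / K))).
  by rewrite !lt_min r0 !divr_gt0.
move=> h; rewrite !lt_min => /and3P[h1 h2]; rewrite ltr_pdivlMr// => h3.
have hw : W / 2 <= normc (w + h).
  have := le_normcB (w + h) h; rewrite addrK -/W; lra.
have wh0 : w + h != 0 by rewrite -normc_gt0; apply: lt_le_trans hw; rewrite divr_gt0.
have -> : (g (t + h) - c) / (t + h - a) - (g t - c) / (t - a) - (d / w - G / w ^+ 2) * h =
    (g (t + h) - g t - d * h) / (w + h) - d * h ^+ 2 / (w * (w + h))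
    + G * h ^+ 2 / (w ^+ 2 * (w + h)).
  have -> : t + h - a = w + h by rewrite /w; ring.
  by rewrite -/w /G; field; rewrite wh0.
apply: le_trans (le_normcD _ _) _.
apply: (@le_trans _ _ (e * W / 4 * normc h / (W / 2) + D * normc h ^+ 2 / (W * (W / 2))
   + N * normc h ^+ 2 / (W ^+ 2 * (W / 2)))); last first.
  have -> : e * W / 4 * normc h / (W / 2) + D * normc h ^+ 2 / (W * (W / 2))
   + N * normc h ^+ 2 / (W ^+ 2 * (W / 2)) = e / 2 * normc h +
     (2 * D / W ^+ 2 + 2 * N / W ^+ 3) * normc h * normc h.
    by field; rewrite gt_eqF.
  have h0 : 0 <= normc h by exact: normc_ge0.
  have : (2 * D / W ^+ 2 + 2 * N / W ^+ 3) * normc h <= e / 2.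
    by move: h3; rewrite /K; lra.
  by move=> /(ler_wpM2r h0); lra.
have mon (x y : R) (u v : R[i]) : normc u <= x -> 0 < y -> y <= normc v -> normc (u / v) <= x / y.
  move=> ux y0 yv; rewrite normcM normcV; apply: ler_pM; rewrite ?normc_ge0 ?invr_ge0 ?normc_ge0//.
  by rewrite lef_pV2// posrE// (lt_le_trans y0).
apply: lerD.
  apply: le_trans (le_normcB _ _) _; apply: lerD; apply: mon.
  - by exact: rP.
  - by rewrite divr_gt0.
  - by [].
  - by rewrite normcM normcX.
  - by rewrite mulr_gt0// divr_gt0.
  - by rewrite normcM ler_wpM2l ?normc_ge0.
apply: mon.
- by rewrite normcM normcX.
- by rewrite mulr_gt0 ?exprn_gt0// divr_gt0.
- by rewrite normcM normcX ler_wpM2l// exprn_ge0// ltW.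
Qed.

Lemma ccontM k l t : ccont k t -> ccont l t -> ccont (fun t => k t * l t) t.
Proof.
move=> kc lc e e0; set a := normc (k t); set b := normc (l t).
have a0 : 0 <= a by exact: normc_ge0.
have b0 : 0 <= b by exact: normc_ge0.
pose m := Num.min 1 (e / (a + b + 1)).
have s0 : 0 < a + b + 1 by rewrite ltr_wpDl ?addr_ge0.
have m0 : 0 < m by rewrite lt_min ltr01 divr_gt0.
have m1 : m <= 1 by rewrite ge_min lexx.
have me : m * (a + b + 1) <= e by rewrite -ler_pdivlMr// ge_min lexx orbT.
have [r r0 rP] := kc m m0; have [s ss0 sP] := lc m m0.
exists (Num.min r s); first by rewrite lt_min r0.
move=> h; rewrite lt_min => /andP[/rP h1 /sP h2].
have -> : k (t + h) * l (t + h) - k t * l t = (k (t + h) - k t) * (l (t + h) - l t) +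
  (k (t + h) - k t) * l t + k t * (l (t + h) - l t) by ring.
apply: le_trans (le_normcD _ _) _; apply: le_trans (lerD (le_normcD _ _) (lexx _)) _.
rewrite !normcM -/a -/b.
have x0 := normc_ge0 (k (t + h) - k t); have y0 := normc_ge0 (l (t + h) - l t).
nra.
Qed.

Lemma ccont_id (t : R[i]) : ccont id t.
Proof. by move=> e e0; exists e => // h he; rewrite /= addrC addKr ltW. Qed.

Lemma ccontV (t : R[i]) : t != 0 -> ccont (fun t => t^-1) t.
Proof.
move=> t0 e e0; have T0 : 0 < normc t by rewrite normc_gt0.
exists (Num.min (normc t / 2) (e * (normc t ^+ 2 / 2))).
  by rewrite lt_min divr_gt0// mulr_gt0// divr_gt0// exprn_gt0.
move=> h; rewrite lt_min => /andP[h1 h2].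
have hw : normc t / 2 <= normc (t + h).
  have := le_normcB (t + h) h; rewrite addrK; lra.
have wh0 : t + h != 0 by rewrite -normc_gt0; apply: lt_le_trans hw; rewrite divr_gt0.
have -> : (t + h)^-1 - t^-1 = - h / (t * (t + h)) by field; rewrite wh0.
rewrite normcM normcN normcV normcM ler_pdivrMr; last by rewrite mulr_gt0// normc_gt0.
apply: le_trans (ltW h2) _; apply: ler_wpM2l; first exact: ltW.
by rewrite expr2 -mulrA ler_wpM2l ?normc_ge0.
Qed.

(* [circle_avg n k r] averages [k] over [2 ^ n] equidistant points of a circle, a discrete
   substitute for the circular mean. *)
Lemma circle_avg_cauchy k (r : R) : (forall t, normc t = `|r| -> ccont k t) ->
  exists a, ccvg (fun n => circle_avg n k r) a.
Proof.
move=> kc; apply: ccauchy => e e0; have [d d0 dP] := circle_uniform kc e0.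
(* Means over the arc from [a] to [a + s], which split exactly under halving; after [n] halvings the
   arcs are so short that [k] varies by at most [e] on each. *)
pose av n (a s : R) : R[i] := (2 ^+ n)^-1 * \sum_(0 <= i < 2 ^ n) k (r%:C%C * cis (a + s * (i%:R / 2 ^+ n))).
have avS n a s : av n.+1 a s = (av n a (s / 2) + av n (a + s / 2) (s / 2)) / 2.
  have e2 : 2 ^+ n != 0 :> R by rewrite expf_neq0.
  have e2' : 2 ^+ n != 0 :> R[i] by rewrite expf_neq0.
  rewrite /av expnS mul2n -addnn (big_cat_nat (n := (2 ^ n)%N)) ?leq_addr//=.
  rewrite -{2}(add0n (2 ^ n)%N) big_addn addnK -mulrDr mulrAC exprS invfM (mulrC 2^-1).
  congr (_ * _ * _); congr (_ + _); apply: eq_bigr => i _; congr (k (_ * cis _)); rewrite exprS.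
    by field.
  by rewrite natrD natrX; field.
have avP n m a s : 0 <= a -> 0 <= s -> a + s <= 1 -> s / 2 ^+ n < d ->
    normc (av (n + m)%N a s - av n a s) <= e.
  elim: n a s => [|n IH] a s a0 s0 as1 sd.
    rewrite add0n {2}/av expr0 invr1 mul1r big_nat1 mul0r mulr0 addr0.
    have e2 : 2 ^+ m != 0 :> R[i] by rewrite expf_neq0.
    rewrite -[k _]mul1r -(mulVf e2) -mulrA -mulrBr normcM normcV normcX normc_nat ler_pdivrMl ?exprn_gt0//.
    rewrite -!sum_pow2_const -sumrB; apply: le_trans (le_normc_sum _ _ _) _.
    rewrite big_nat_cond [leRHS]big_nat_cond; apply: ler_sum => i /andP[/andP[_ im] _].
    have iI := @dyadic_in R m i (ltnW im).
    have h : 0 <= s * (i%:R / 2 ^+ m) <= s.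
      by move/andP: iI => [i0 i1]; rewrite mulr_ge0//= ler_piMr.
    rewrite normc_distC; apply: dP; [lra| |by rewrite subrr normr0].
    by rewrite expr0 divr1 in sd; rewrite ltr_norml; lra.
  rewrite addSn !avS -mulrBl normcM normcV normc_nat ler_pdivrMr//.
  rewrite opprD addrACA; apply: le_trans (le_normcD _ _) _.
  have sd' : s / 2 / 2 ^+ n < d by rewrite -mulrA -invfM -exprS.
  have -> : e * 2 = e + e by ring.
  by apply: lerD; apply: IH => //; lra.
have [n nP] := half_exp_lt d0; exists n => m.
have avE j : circle_avg j k r = av j 0 1.
  by rewrite /circle_avg /av big_mkord; congr (_ * _); apply: eq_bigr => i _; rewrite add0r mul1r.
by rewrite !avE; apply: avP; rewrite ?add0r ?mul1r ?nP.
Qed.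

Lemma circle_avg_inv n m : (0 < m < 2 ^ n)%N -> circle_avg n (fun t => (t^-1) ^+ m) 1 = 0 :> R[i].
Proof.
move=> mn; rewrite /circle_avg.
have -> : \sum_(i < 2 ^ n) ((1 : R)%:C%C * cis (i%:R / 2 ^+ n))^-1 ^+ m =
    \sum_(i < 2 ^ n) cis (m%:R / (2 ^ n)%:R) ^- i :> R[i].
  apply: eq_bigr => i _; have -> : (1 : R)%:C%C = 1 :> R[i] by [].
  rewrite mul1r -(cisN (i%:R / 2 ^+ n)) -!cisMn natrX -cisN.
  by apply: (congr1 (@cis R)); ring.
rewrite (_ : \sum_(i < _) _ = (\sum_(i < 2 ^ n) cis (m%:R / (2 ^ n)%:R) ^+ i)^*%C).
  by rewrite sum_cis// conjc0 mulr0.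
rewrite rmorph_sum; apply: eq_bigr => i _.
by rewrite -cisMn -[RHS]/((cis _)^*)%C conj_cis.
Qed.

Section CauchyFormula.
Variables (g : R[i] -> R[i]) (M : R).
Hypothesis gd : forall t, normc t <= 1 -> exists d, cdiff g t d.
Hypothesis gM : forall t, normc t <= 1 -> normc (g t) <= M.

Let M0 : 0 <= M.
Proof. by apply: le_trans (gM (t := 0) _); rewrite ?normc_ge0 ?normc0. Qed.

(* The quotient [(g t - g a) / (t - a)] is only continuous at [a], so the averages are
   carried across the circle [|t| = |a|] by uniform continuity. *)
Lemma circle_avg_quotient a : 0 < normc a < 1 ->
  ccvg (fun n => circle_avg n (fun t => (g t - g a) / (t - a) * t) 1) 0.
Proof.
move=> /andP[a0 a1].
have [da daP] := gd (ltW a1).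
pose l t := if t == a then da else (g t - g a) / (t - a).
pose k t := l t * t.
have lE t : t != a -> l t = (g t - g a) / (t - a) by rewrite /l => /negbTE ->.
have ld t : normc t <= 1 -> t != a -> exists d, cdiff l t d.
  move=> t1 ta; have [d dP] := gd t1; have [d' d'P] := @cdiff_divB g a (g a) t d ta dP.
  exists d'; apply: (cdiff_local (r := normc (t - a)) _ _ d'P); first by rewrite (normc_gt0 (t - a)) subr_eq0.
  move=> h hh; rewrite lE//; apply/eqP => e; move: hh; rewrite -e.
  by rewrite opprD addrA subrr add0r normcN ltxx.
have lc t : normc t <= 1 -> ccont l t.
  have [->|ta] := eqVneq t a; last by move=> t1; have [d dP] := ld t t1 ta; exact: cdiff_ccont dP.
  move=> _ e e0; have [r r0 rP] := daP e e0; exists r => // h hr.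
  rewrite {2}/l eqxx; have [->|h0] := eqVneq h 0.
    by rewrite addr0 /l eqxx subrr normc0 ltW.
  rewrite lE; last by rewrite -subr_eq0 addrAC subrr add0r.
  rewrite addrAC subrr add0r.
  have -> : (g (a + h) - g a) / h - da = (g (a + h) - g a - da * h) / h by field.
  by rewrite normcM normcV ler_pdivrMr ?normc_gt0//; exact: rP.
have kc t : normc t <= 1 -> ccont k t.
  by move=> t1; exact: (ccontM (lc _ t1) (ccont_id t)).
move=> e e0; set A := normc a.
have [d d0 dP] := @circle_uniform R k A (fun t ht => kc t ltac:(by rewrite ht ger0_norm ?normc_ge0 ?ltW)) (e / 8) ltac:(lra).
have [s s0 sP] := kc 0 ltac:(by rewrite normc0 ler01) (e / 4) ltac:(lra).
(* Four circles are compared: radius 1, radii [A + m] and [A - m] on either side of [a], and [r0],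
   where [k] is at most [e / 4]. Goursat's theorem covers the outer and the inner annulus, uniform
   continuity the thin one that contains [a]. *)
pose m := Num.min (d / 2) (Num.min (A / 2) ((1 - A) / 2)).
have m0 : 0 < m by rewrite !lt_min !divr_gt0 ?subr_gt0.
have [md [mA m1]] : m <= d / 2 /\ m <= A / 2 /\ m <= (1 - A) / 2.
  by rewrite !ge_min !lexx !orbT.
pose r0 := Num.min (s / 2) (A / 4).
have r00 : 0 < r0 by rewrite lt_min !divr_gt0.
have [r0s r0A] : r0 <= s / 2 /\ r0 <= A / 4 by rewrite !ge_min !lexx !orbT.
have [n1 h1] := @circle_avg_goursat R l r0 (A - m) ltac:(by apply/andP; split; lra)
  (fun t ht => ld t ltac:(lra) ltac:(by apply/eqP => ta; move: ht; rewrite ta -/A; lra)) (e / 4) ltac:(lra).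
have [n2 h2] := @circle_avg_goursat R l (A + m) 1 ltac:(by apply/andP; split; lra)
  (fun t ht => ld t ltac:(lra) ltac:(by apply/eqP => ta; move: ht; rewrite ta -/A; lra)) (e / 4) ltac:(lra).
exists (maxn n1 n2) => n; rewrite geq_max => /andP[/h1 {}h1 /h2 {}h2].
have ncr y (r : R) : 0 <= r -> normc (r%:C%C * cis y) = r.
  by move=> r_0; rewrite normcM normc_cis mulr1 normc_real ger0_norm.
have -> : circle_avg n (fun t => (g t - g a) / (t - a) * t) 1 = circle_avg n k 1.
  apply: eq_circle_avg => y; rewrite /k lE//; apply/eqP => ya.
  by move: a1; rewrite -ya ncr ?ltxx.
have h3 : normc (circle_avg n k r0) <= e / 4.
  apply: circle_avg_le => y; have := sP (r0%:C%C * cis y); rewrite add0r {2}/k mulr0 subr0.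
  by apply; rewrite ncr; lra.
have h4 : normc (circle_avg n k (A + m) - circle_avg n k (A - m)) <= e / 4.
  rewrite /circle_avg -mulrBr -sumrB normcM normcV normcX normc_nat ler_pdivrMl ?exprn_gt0//.
  apply: le_trans (le_normc_sum _ _ _) _.
  apply: (@le_trans _ _ (\sum_(i < 2 ^ n) (e / 4))); last first.
    by rewrite sumr_const card_ord -[leLHS]mulr_natl natrX.
  apply: ler_sum => i _; have iI := @dyadic_in R n i (ltnW (ltn_ord i)).
  apply: le_trans (le_normc_dist _ (k (A%:C%C * cis (i%:R / 2 ^+ n))) _) _.
  rewrite normc_distC.
  have := dP _ (i%:R / 2 ^+ n) (A + m) iI ltac:(by rewrite subrr normr0) ltac:(by rewrite ltr_norml; lra).
  have := dP _ (i%:R / 2 ^+ n) (A - m) iI ltac:(by rewrite subrr normr0) ltac:(by rewrite ltr_norml; lra).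
  lra.
rewrite subr0; have -> : circle_avg n k 1 = (circle_avg n k 1 - circle_avg n k (A + m)) +
  (circle_avg n k (A + m) - circle_avg n k (A - m)) + (circle_avg n k (A - m) - circle_avg n k r0) + circle_avg n k r0 by ring.
have -> : e = e / 4 + e / 4 + e / 4 + e / 4 by field.
by do 3!(apply: le_trans (le_normcD _ _) _; apply: lerD => //).
Qed.

(** In [circle_avg_quotient] the kernel [t / (t - a)] is expanded into [n] terms of a geometric
    series, with a remainder of modulus at most [normc a ^+ n / (1 - normc a)]. The [c i] are the
    limits of the averages of [g t / t ^+ i] over the unit circle; the factor 2 appears because the
    remainder meets both [g t] and [g a]. *)
Lemma taylor : exists2 c : nat -> R[i], (forall n, normc (c n) <= M) &
  forall a n, normc a < 1 ->
    normc (g a - \sum_(i < n) c i * a ^+ i) <= 2 * M * normc a ^+ n / (1 - normc a).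
Proof.
have un y : normc ((1 : R)%:C%C * cis y) = 1 by rewrite normcM normc_cis mulr1 normc1.
have un0 y : (1 : R)%:C%C * cis y != 0 by rewrite -normc_gt0 un.
have gc t : normc t <= 1 -> ccont g t by move=> /gd[d]; exact: cdiff_ccont.
have cex m : exists c, ccvg (fun n => circle_avg n (fun t => g t * (t^-1) ^+ m) 1) c.
  apply: circle_avg_cauchy => t; rewrite normr1 => t1; apply: ccontM; first by apply: gc; rewrite t1.
  have t0 : t != 0 by rewrite -normc_gt0 t1.
  elim: m => [|m IH].
    by move=> e e0; exists 1 => // h _; rewrite !expr0 subrr normc0 ltW.
  move=> e e0; have [r r0 rP] := ccontM (ccontV t0) IH e0.
  by exists r => // h /rP; rewrite -!exprS.
have [c cP] := choice cex.
have cM n : normc (c n) <= M.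
  apply/ler_addgt0Pr => e e0; have [N NP] := cP n e e0.
  have := NP N (leqnn _); set A := circle_avg _ _ _ => h.
  have : normc A <= M.
    by apply: circle_avg_le => y; rewrite normcM normcX normcV un invr1 expr1n mulr1; apply: gM; rewrite un.
  have := le_normcB A (A - c n); rewrite subKr; lra.
have main a n : 0 < normc a < 1 ->
    normc (g a - \sum_(i < n) c i * a ^+ i) <= 2 * M * normc a ^+ n / (1 - normc a).
  move=> aI; have /andP[a0 a1] := aI; have q := circle_avg_quotient aI.
  set B := M * normc a ^+ n / (1 - normc a).
  have geo t : t != 0 -> t != a -> t / (t - a) = \sum_(i < n) a ^+ i * (t^-1) ^+ i +
      a ^+ n * (t^-1) ^+ n * (t / (t - a)).
    move=> t0 ta; have ta' : t - a != 0 by rewrite subr_eq0.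
    elim: n {B} => [|n IH]; first by rewrite big_ord0 add0r !expr0 !mul1r.
    rewrite big_ord_recr/= {1}IH -addrA; congr (_ + _).
    rewrite !exprS; set v := t^-1 ^+ n; set w := a ^+ n; field; by rewrite t0 ta'.
  pose T t := a ^+ n * (t^-1) ^+ n * (t / (t - a)).
  have Tn y : normc (T ((1 : R)%:C%C * cis y)) <= normc a ^+ n / (1 - normc a).
    have := un y; set t := _ * cis y => nt.
    clearbody t; rewrite /T !normcM !normcX !normcV nt invr1 expr1n mulr1 mul1r.
    rewrite ler_wpM2l ?exprn_ge0 ?normc_ge0// lef_pV2 ?posrE ?subr_gt0//; last first.
      by rewrite normc_gt0 subr_eq0; apply/eqP => e; move: a1; rewrite -e nt ltxx.
    by have := le_normcB (t - a) (- a); rewrite opprK subrK nt normcN; lra.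
  (* The averages of [t^-1 ^+ i] are 1 for [i = 0] and vanish for [0 < i < 2 ^ m], so the truncated
     series has mean 1, or 0 if [n = 0]; the last term corrects for that case. *)
  have key m : (n <= 2 ^ m)%N -> (0 < m)%N ->
      normc (g a - \sum_(i < n) a ^+ i * circle_avg m (fun t => g t * (t^-1) ^+ i) 1 +
        circle_avg m (fun t => (g t - g a) / (t - a) * t) 1 - (n == 0%N)%:R * g a) <= 2 * B.
    move=> nm m0.
    have -> : circle_avg m (fun t => (g t - g a) / (t - a) * t) 1 =
       \sum_(i < n) a ^+ i * circle_avg m (fun t => g t * (t^-1) ^+ i) 1 + circle_avg m (fun t => g t * T t) 1
       - g a * (\sum_(i < n) a ^+ i * circle_avg m (fun t => (t^-1) ^+ i) 1 + circle_avg m T 1).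
      under [X in _ = X + _ - _]eq_bigr do rewrite -circle_avgZ.
      under [X in _ = _ - _ * (X + _)]eq_bigr do rewrite -circle_avgZ.
      rewrite -!circle_avg_sum -!circle_avgD -[X in _ - X]circle_avgZ -mulN1r -circle_avgZ -circle_avgD.
      apply: eq_circle_avg => y; set t := _ * cis y.
      have ta : t != a by apply/eqP => e; move: a1; rewrite -e un ltxx.
      rewrite mulrAC -mulrA (geo t (un0 y) ta) -/(T t).
      have -> : \sum_(i < n) a ^+ i * (g t * t^-1 ^+ i) = g t * \sum_(i < n) a ^+ i * t^-1 ^+ i.
        by rewrite mulr_sumr; apply: eq_bigr => i _; rewrite mulrCA.
      by ring.
    have -> : \sum_(i < n) a ^+ i * circle_avg m (fun t => (t^-1) ^+ i) 1 = (n != 0%N)%:R.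
      case: n nm {B geo T Tn} => [|n] nm; first by rewrite big_ord0.
      rewrite big_ord_recl /= expr0 mul1r big1 ?addr0.
        rewrite /circle_avg; under eq_bigr do rewrite expr0.
        by rewrite sumr_const card_ord natrX mulVf// expf_neq0.
      move=> i _; rewrite circle_avg_inv ?mulr0// /bump/= add1n.
      exact: leq_trans (ltn_ord i : (i.+1 < n.+1)%N) nm.
    have -> : (n == 0%N)%:R = 1 - (n != 0%N)%:R :> R[i] by case: eqP; rewrite ?subr0 ?subrr.
    set S1 := \sum_(i < n) _; set b := (n != 0%N)%:R.
    rewrite (_ : _ - _ = circle_avg m (fun t => g t * T t) 1 - g a * circle_avg m T 1); last by ring.
    have -> : 2 * B = M * (normc a ^+ n / (1 - normc a)) + M * (normc a ^+ n / (1 - normc a)).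
      by rewrite /B; ring.
    apply: le_trans (le_normcB _ _) _; apply: lerD.
      by apply: circle_avg_le => y; rewrite normcM; apply: ler_pM; rewrite ?normc_ge0// gM// un.
    rewrite normcM; apply: ler_pM; rewrite ?normc_ge0//; first by apply: gM; exact: ltW.
    exact: circle_avg_le.
  have [->|n0] := eqVneq n 0%N.
    rewrite big_ord0 subr0 expr0 mulr1; apply: le_trans (gM (ltW a1)) _.
    rewrite ler_pdivlMr ?subr_gt0//; have := normc_ge0 a; have := M0; nra.
  move: key; rewrite (negbTE n0) /= => key.
  have -> : 2 * M * normc a ^+ n / (1 - normc a) = 2 * B by rewrite /B; ring.
  apply/ler_addgt0Pr => e e0.
  have [N0 hN0] := q (e / 2) ltac:(lra).
  have en0 : 0 < e / 2 / n%:R by rewrite !divr_gt0// ltr0n lt0n.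
  have [N hN] := choice (fun i : 'I_n => cP i (e / 2 / n%:R) en0).
  pose m := maxn (maxn N0 n) (maxn 1 (\max_i N i)).
  have mN0 : (N0 <= m)%N by rewrite /m !leq_max leqnn.
  have mn : (n <= 2 ^ m)%N by apply: (@leq_trans m); [rewrite /m !leq_max leqnn orbT|exact: ltnW (ltn_expl _ _)].
  have m1 : (0 < m)%N by rewrite /m !leq_max ltnSn !orbT.
  have mN i : (N i <= m)%N by rewrite /m leq_max; apply/orP; right; rewrite leq_max leq_bigmax orbT.
  have := key m mn m1; rewrite mul0r subr0; have := hN0 _ mN0; rewrite subr0.
  set Q := circle_avg _ _ _ => hQ; set S := \sum_(i < n) _ => hS.
  have hd : normc (S - \sum_(i < n) c i * a ^+ i) <= e / 2.
    rewrite -sumrB; apply: le_trans (le_normc_sum _ _ _) _.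
    have -> : e / 2 = \sum_(i < n) (e / 2 / n%:R).
      by rewrite sumr_const card_ord -[RHS]mulr_natr divfK// pnatr_eq0.
    apply: ler_sum => i _; rewrite (mulrC (c i)) -mulrBr normcM normcX.
    rewrite -[leRHS]mul1r; apply: ler_pM; rewrite ?exprn_ge0 ?normc_ge0//.
      by rewrite exprn_ile1 ?normc_ge0// ltW.
    by apply: hN.
  have -> : g a - \sum_(i < n) c i * a ^+ i = (g a - S + Q) - Q + (S - \sum_(i < n) c i * a ^+ i) by ring.
  by apply: le_trans (le_normcD _ _) _; have := le_normcB (g a - S + Q) Q; lra.
exists c => // a n a1; have [a0|] := eqVneq a 0; last by rewrite -normc_gt0 => a0; apply: main; rewrite a0.
case: n => [|n].
  rewrite big_ord0 subr0 expr0 mulr1 a0 normc0 subr0 divr1.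
  by apply: le_trans (gM _) _; rewrite ?normc0// mulr2n mulrDl mul1r lerDl; exact: M0.
(* At [a = 0] the right side is 0 and [g 0 = c 0] has to be shown: the case [n = 1] at small real
   [x], together with the continuity of [g] at 0. *)
have -> : 2 * M * normc a ^+ n.+1 / (1 - normc a) = 0 by rewrite a0 normc0 expr0n mulr0 mul0r.
rewrite a0 big_ord_recl expr0 mulr1 big1 ?addr0; last first.
  by move=> i _; rewrite lift0 /= expr0n mulr0.
apply/ler_addgt0Pr => e e0; rewrite add0r.
have [r r0 rP] := gc 0 ltac:(by rewrite normc0) (e / 2) ltac:(lra).
pose K := 4 * M + 1; have K0 : 0 < K by rewrite /K; have := M0; lra.
pose x := Num.min (r / 2) (Num.min (1 / 2) (e / 2 / K)).
have x0 : 0 < x by rewrite !lt_min !divr_gt0.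
have [xr [x1 xe]] : x <= r / 2 /\ x <= 1 / 2 /\ x <= e / 2 / K by rewrite !ge_min !lexx !orbT.
have nx : normc (x%:C%C) = x by rewrite normc_real ger0_norm// ltW.
have := main x%:C%C 1%N ltac:(by rewrite nx x0/=; lra).
rewrite big_ord_recl big_ord0 expr0 addr0 mulr1 nx expr1 => h.
have := rP x%:C%C ltac:(by rewrite nx; lra); rewrite add0r => h'.
apply: le_trans (le_normc_dist _ (g x%:C%C) _) _; rewrite normc_distC.
suff : 2 * M * x / (1 - x) <= e / 2 by lra.
rewrite ler_pdivrMr; last lra.
move: xe; rewrite ler_pdivlMr// /K; have := M0; nra.
Qed.

End CauchyFormula.

End Taylor.

Lemma subACA3 (V : zmodType) (a b c d e f : V) :
  a - b - c - (d - e - f) = (a - d) - (b - e) - (c - f).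
Proof. by rewrite !opprD !opprK (addrACA (a - b)) (addrACA a). Qed.

Lemma subBB (V : zmodType) (a b c : V) : a - b - (c - b) = a - c.
Proof. by rewrite opprB addrA subrK. Qed.

Lemma normc_scale (R : realType) (a : R[i]) (x : R[i]^o) : normc (a *: x) = normc a * normc x.
Proof. exact: normcM. Qed.

(** * Holomorphic functions on the ball *)

Section Bridge.
Variable R : realType.
Local Notation E := (linfty R).
Local Notation C := (R[i]^o).
Local Notation N := (@linfty_norm R).
Implicit Types (f g : E -> C) (z v h : E).

Lemma linfty_norm0 : N 0 = 0.
Proof.
by apply/le_anti; rewrite linfty_norm_ge0 andbT; apply: linfty_norm_le => n; rewrite normc0.
Qed.

Lemma linfty_norm_gt0 z : z != 0 -> 0 < N z.
Proof.
move=> z0; rewrite lt_def linfty_norm_ge0 andbT; apply: contra z0.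
by move=> /eqP /linfty_norm_eq0 ->.
Qed.

Lemma normr_linfty z : `|z| = (N z)%:C%C.
Proof. by []. Qed.

Lemma ballE z (r : R) v : ball z r%:C%C v <-> N (v - z) < r.
Proof. by rewrite -ball_normE /ball_/= -opprB normrN normr_linfty ltcR. Qed.

Lemma ball01E v : ball (0 : E) 1 v <-> N v < 1.
Proof. by rewrite -[v in N v]subr0; exact: (ballE 0 1 v). Qed.

Lemma nbhsP (z : E) (P : set E) :
  nbhs z P <-> exists2 r : R, 0 < r & forall v, N (v - z) < r -> P v.
Proof.
split=> [/nbhs_ballP[e /= e0 eP]|[r r0 rP]].
  have er : e = (complex.Re e)%:C%C by case: e e0 {eP} => a b; rewrite ltcE/= => /andP[/eqP-> _].
  exists (complex.Re e); first by move: e0; rewrite er ltcR.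
  by move=> v vr; apply: eP; rewrite er; apply/ballE.
by apply/nbhs_ballP; exists r%:C%C; [rewrite /= ltcR|move=> v /ballE; exact: rP].
Qed.

Lemma nbhsCP (z : C) (P : set C) :
  nbhs z P <-> exists2 r : R, 0 < r & forall v : R[i], normc (v - z) < r -> P v.
Proof.
split=> [/nbhs_ballP[e /= e0 eP]|[r r0 rP]].
  have er : e = (complex.Re e)%:C%C by case: e e0 {eP} => a b; rewrite ltcE/= => /andP[/eqP-> _].
  exists (complex.Re e); first by move: e0; rewrite er ltcR.
  move=> v vr; apply: eP; rewrite er -ball_normE /ball_/=.
  by rewrite -opprB normrN normr_normc ltcR.
apply/nbhs_ballP; exists r%:C%C; first by rewrite /= ltcR.
by move=> v; rewrite -ball_normE /ball_/= -opprB normrN normr_normc ltcR; exact: rP.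
Qed.

Lemma derivable_cdiff f z v : derivable f z v -> cdiff (fun t => f (t *: v + z)) 0 ('D_v f z).
Proof.
move=> fd e e0; have := fd => /cvg_ex[/= l fl].
have -> : 'D_v f z = l by exact: cvg_lim fl.
have /cvgrPdist_lt/(_ e%:C%C ltac:(by rewrite ltcR)) := fl.
rewrite near_withinE => /nbhsCP[r r0 rP]; exists r => // h hr.
have [->|h0] := eqVneq h 0; first by rewrite !add0r subrr mulr0 subr0 normc0 mulr0.
rewrite add0r scale0r add0r.
have := rP h ltac:(by rewrite subr0) h0; rewrite normr_normc ltcR normc_distC /= => hh.
have -> : f (h *: v + z) - f z - l * h = (h^-1 *: (f (h *: v + z) - f z) - l) * h.
  by rewrite /GRing.scale/=; field.
by rewrite normcM ler_wpM2r ?normc_ge0// ltW.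
Qed.

Lemma cdiff_derive f z v d : cdiff (fun t => f (t *: v + z)) 0 d ->
  derivable f z v /\ 'D_v f z = d.
Proof.
move=> fd; suff fl : (fun h : C => (h : R[i])^-1 *: ((f \o shift z) ((h : R[i]) *: v) - f z)) @ (0 : C)^' --> (d : C).
  by split; [apply/cvg_ex; exists d|exact: cvg_lim fl].
apply/cvgrPdist_le => e e0.
have er : e = (complex.Re e)%:C%C by case: e e0 => a b; rewrite ltcE/= => /andP[/eqP-> _].
have e0' : 0 < complex.Re e by move: e0; rewrite er ltcR.
have [r r0 rP] := fd _ e0'.
rewrite near_withinE; apply/nbhsCP; exists r => // h; rewrite subr0 => hr h0.
rewrite er normr_normc lecR normc_distC /=.
have := rP h hr; rewrite add0r scale0r add0r => hh.
have -> : h^-1 *: (f (h *: v + z) - f z) - d = (f (h *: v + z) - f z - d * h) / h.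
  by rewrite /GRing.scale/=; field.
by rewrite normcM normcV ler_pdivrMr ?normc_gt0.
Qed.

Lemma diff_line f z v (t : R[i]) : differentiable f (z + t *: v) ->
  cdiff (fun t => f (z + t *: v)) t ('D_v f (z + t *: v)).
Proof.
move=> /diff_derivable fd; have := derivable_cdiff (fd v) => h e e0.
have [r r0 rP] := h e e0; exists r => // s sr; have := rP s sr.
by rewrite !add0r scale0r add0r scalerDl (addrC (s *: v)) !addrA.
Qed.

Lemma differentiable_bound f z (L : {linear E -> C}) (K : R) :
  (forall v, normc (L v) <= K * N v) ->
  (forall e : R, 0 < e -> exists2 r : R, 0 < r & forall h, N h < r ->
     normc (f (z + h) - f z - L h) <= e * N h) ->
  differentiable f z /\ forall v, 'D_v f z = L v.
Proof.
move=> LK fL.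
have Lc : continuous L.
  apply: bounded_linear_continuous; apply/linear_boundedP.
  exists (`|K|%:C%C); split; first by rewrite complex_real.
  move=> r Kr x; rewrite normr_normc normr_linfty.
  have rr : r = (complex.Re r)%:C%C by case: r Kr => a b; rewrite ltcE/= => /andP[/eqP-> _].
  rewrite rr -rmorphM lecR; apply: le_trans (LK x) _; rewrite ler_wpM2r ?linfty_norm_ge0//.
  by apply: le_trans (ler_norm _) _; move: Kr; rewrite rr ltcR => /ltW.
have fo : f \o shift z = cst (f z) + L +o_ (0 : E) id.
  apply/eqaddoP => e e0.
  have er : e = (complex.Re e)%:C%C by case: e e0 => a b; rewrite ltcE/= => /andP[/eqP-> _].
  have e0' : 0 < complex.Re e by move: e0; rewrite er ltcR.
  have [r r0 rP] := fL _ e0'.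
  apply/nbhsP; exists r => // h; rewrite subr0 => hr /=.
  rewrite er normr_normc normr_linfty -rmorphM lecR.
  rewrite -[X in normc X]/(f (h + z) - (f z + L h)) opprD addrA (addrC h).
  exact: rP.
have dE := diff_unique Lc fo.
have fd : differentiable f z by apply/diff_locallyP; rewrite dE.
by split=> // v; rewrite deriveE// dE.
Qed.

Lemma differentiable_o f z : differentiable f z -> forall e : R, 0 < e ->
  exists2 r : R, 0 < r & forall h, N h < r ->
    normc (f (z + h) - f z - 'd f z h) <= e * N h.
Proof.
move=> /diff_locallyP[_ /eqaddoP fo] e e0.
have /nbhsP[r r0 rP] := fo e%:C%C ltac:(by rewrite ltcR).
exists r => // h hr; have := rP h ltac:(by rewrite subr0).
rewrite normr_normc normr_linfty -rmorphM lecR /=.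
by rewrite -[X in normc X <= _ -> _]/(f (h + z) - (f z + 'd f z h)) opprD addrA (addrC h).
Qed.

Lemma derive_linear f z : differentiable f z -> linear (fun v => 'D_v f z).
Proof. by move=> fd a u v; rewrite !deriveE// linearP. Qed.

(** Cauchy's estimates on a single complex line. As they involve nothing but a bound of [f], they
    are uniform in the direction and pass to uniform limits. *)
Lemma cauchy_line f z v M : (forall t, normc t <= 1 -> differentiable f (z + t *: v)) ->
  (forall t, normc t <= 1 -> normc (f (z + t *: v)) <= M) ->
  [/\ normc ('D_v f z) <= M &
   forall t, normc t <= 2^-1 -> normc (f (z + t *: v) - f z - t * 'D_v f z) <= 4 * M * normc t ^+ 2].
Proof.
move=> fd fM; pose g t := f (z + t *: v).
have [c cM cP] := @taylor R g M (fun t ht => ex_intro _ _ (diff_line (fd t ht))) fM.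
have M0 : 0 <= M by apply: le_trans (cM 0%N); exact: normc_ge0.
have c0 : f z = c 0%N.
  have := cP 0 1%N; rewrite big_ord1 expr0 mulr1 normc0 expr1 mulr0 mul0r /g scale0r addr0.
  by move=> /(_ ltr01) h; apply/eqP; rewrite -subr_eq0 -normc_eq0 -(inj_eq (@complexI R)) eq_complex/= eqxx andbT; apply/eqP/le_anti; rewrite h normc_ge0.
have key t : normc t <= 2^-1 -> normc (f (z + t *: v) - f z - t * c 1%N) <= 4 * M * normc t ^+ 2.
  move=> t2; have t1 : normc t < 1 by apply: le_lt_trans t2 _; lra.
  have := cP t 2%N t1; rewrite big_ord_recl big_ord1 /= expr0 mulr1 -c0 expr1 (mulrC (c _)).
  rewrite opprD addrA => h; apply: le_trans h _.
  rewrite ler_pdivrMr ?subr_gt0//.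
  have : 0 <= M * normc t ^+ 2 by rewrite mulr_ge0// exprn_ge0// normc_ge0.
  nra.
have c1 : 'D_v f z = c 1%N.
  suff : cdiff (fun t => f (t *: v + z)) 0 (c 1%N) by move=> /cdiff_derive[].
  move=> e e0; pose K := 4 * M + 1; have K0 : 0 < K by rewrite /K; lra.
  exists (Num.min 2^-1 (e / K)); first by rewrite lt_min invr_gt0 ltr0n divr_gt0.
  move=> h; rewrite lt_min => /andP[h1]; rewrite ltr_pdivlMr// => h2.
  rewrite add0r scale0r add0r (mulrC (c _)) (addrC (h *: v)); apply: le_trans (key _ (ltW h1)) _.
  rewrite expr2 mulrA ler_wpM2r ?normc_ge0//; have := normc_ge0 h; rewrite /K in h2; nra.
by rewrite c1; split.
Qed.

(** Cauchy's estimates applied to [F i - F j] bound the difference of the derivatives, and that of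
    the first-order remainders, by a multiple of the supremum of [F i - F j] times [N h]. So the
    derivatives converge to a linear [L], and the remainder of [g] inherits smallness from that of
    one [F j]. *)
Lemma weierstrass (F : nat -> E -> C) g z0 (rho : R) : 0 < rho ->
  (forall j z, N (z - z0) < rho -> differentiable (F j) z) ->
  (forall e : R, 0 < e -> exists j0, forall j z, (j0 <= j)%N -> N (z - z0) < rho ->
      normc (F j z - g z) <= e) ->
  differentiable g z0 /\ forall v, ccvg (fun j => 'D_v (F j) z0) ('D_v g z0).
Proof.
move=> rho0 Fd Fg.
have z0in j : differentiable (F j) z0 by apply: Fd; rewrite subrr linfty_norm0.
(* Scales [h] to length [rho / 2], so that the unit disc in its direction stays inside the ball of
   radius [rho]. *)
pose c h := rho / 2 / N h.
have line i j (e : R) : (forall z, N (z - z0) < rho -> normc (F i z - F j z) <= e) ->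
    (forall h, normc ('D_h (F i) z0 - 'D_h (F j) z0) <= 2 * e / rho * N h) /\
    (forall h, N h <= rho / 4 -> normc ((F i (z0 + h) - F i z0 - 'D_h (F i) z0) -
       (F j (z0 + h) - F j z0 - 'D_h (F j) z0)) <= 8 * e / rho * N h).
  move=> Fij.
  have e0 : 0 <= e by apply: le_trans (Fij z0 _); rewrite ?normc_ge0// subrr linfty_norm0.
  have H h : h != 0 -> let v := (c h)%:C%C *: h in
      normc ('D_v (F i \- F j) z0) <= e /\
      (forall t, normc t <= 2^-1 -> normc ((F i \- F j) (z0 + t *: v) - (F i \- F j) z0 -
         t * 'D_v (F i \- F j) z0) <= 4 * e * normc t ^+ 2).
    move=> h0 v; have h0' := linfty_norm_gt0 h0.
    have Nv : N v = rho / 2.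
      by rewrite /v linfty_normZ normc_real ger0_norm /c ?divr_ge0 ?ltW//; field; rewrite gt_eqF.
    have inn t : normc t <= 1 -> N (z0 + t *: v - z0) < rho.
      move=> t1; rewrite addrC addKr linfty_normZ Nv; have := normc_ge0 t; nra.
    have [] := @cauchy_line (F i \- F j) z0 v e.
    - by move=> t t1; apply: differentiableB; apply: Fd; exact: inn.
    - by move=> t t1; apply: Fij; exact: inn.
    - by [].
  have DB h : 'D_h (F i \- F j) z0 = 'D_h (F i) z0 - 'D_h (F j) z0.
    by rewrite deriveB//; exact: diff_derivable.
  have Dv h : h != 0 -> 'D_((c h)%:C%C *: h) (F i \- F j) z0 =
      (c h)%:C%C * ('D_h (F i) z0 - 'D_h (F j) z0).
    move=> h0; rewrite -DB; have := derive_linear (differentiableB (z0in i) (z0in j)).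
    by move=> /(_ (c h)%:C%C h 0); rewrite derive0 !addr0.
  have cgt h : h != 0 -> 0 < c h by move=> h0; rewrite !divr_gt0// linfty_norm_gt0.
  split=> h.
    have [->|h0] := eqVneq h 0; first by rewrite !derive0 subrr normc0 linfty_norm0 mulr0.
    have [+ _] := H h h0; rewrite Dv// normcM normc_real (ger0_norm (ltW (cgt _ h0))).
    rewrite -ler_pdivlMl ?cgt//; move=> hh; apply: le_trans hh _.
    rewrite le_eqVlt; apply/orP; left; apply/eqP; rewrite /c; field.
    by rewrite !gt_eqF// linfty_norm_gt0.
  move=> hr; have [->|h0] := eqVneq h 0.
    by rewrite !derive0 !addr0 !subrr normc0 linfty_norm0 mulr0.
  have h0' := linfty_norm_gt0 h0.
  have [_ /(_ ((c h)^-1)%:C%C)] := H h h0.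
  have ci0 : 0 <= (c h)^-1 by rewrite invr_ge0 ltW// cgt.
  rewrite normc_real (ger0_norm ci0) scalerA -rmorphM mulVf ?gt_eqF ?cgt// scale1r.
  rewrite Dv// mulrA -rmorphM mulVf ?gt_eqF ?cgt// mul1r => hh.
  have cE : (c h)^-1 = 2 / rho * N h by rewrite /c; field; rewrite !gt_eqF.
  have ch : (c h)^-1 <= 2^-1.
    have -> : 2^-1 = 2 / rho * (rho / 4) :> R by field; rewrite gt_eqF.
    by rewrite cE ler_wpM2l// divr_ge0// ltW.
  apply: le_trans (_ : _ <= 4 * e * (c h)^-1 ^+ 2) _.
    apply: le_trans (hh ch); rewrite le_eqVlt; apply/orP; left; apply/eqP; congr normc.
    exact: subACA3.
  have -> : 8 * e / rho * N h = 4 * e * (c h)^-1 by rewrite cE; ring.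
  rewrite expr2 mulrA ler_piMr ?mulr_ge0//.
  by apply: le_trans ch _; rewrite invf_le1 ?ler1n.
have cau (e : R) : 0 < e -> exists j0, forall i j, (j0 <= i)%N -> (j0 <= j)%N ->
    forall z, N (z - z0) < rho -> normc (F i z - F j z) <= e.
  move=> e0; have [j0 jP] := Fg (e / 2) ltac:(by rewrite divr_gt0).
  exists j0 => i j hi hj z hz; apply: le_trans (le_normc_dist _ (g z) _) _.
  by rewrite (normc_distC (g z)); have := jP i z hi hz; have := jP j z hj hz; lra.
have Dcau h : exists l, ccvg (fun j => 'D_h (F j) z0) l.
  apply: ccauchy => e e0.
  pose K := 2 / rho * N h + 1.
  have K0 : 0 < K by rewrite /K ltr_wpDl// mulr_ge0 ?linfty_norm_ge0// divr_ge0// ltW.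
  have [j0 jP] := cau (e / K) ltac:(by rewrite divr_gt0).
  exists j0 => m; have [+ _] := line _ _ _ (jP (j0 + m)%N j0 (leq_addr _ _) (leqnn _)).
  move=> /(_ h) hh; apply: le_trans hh _.
  rewrite (_ : 2 * (e / K) / rho * N h = e * (2 / rho * N h / K)); last by ring.
  by rewrite ler_piMr ?(ltW e0)// ler_pdivrMr// mul1r /K lerDl.
have [L LP] := choice Dcau.
have Llin : linear L.
  move=> a u v; apply: (ccvg_unique (LP _)) => e e0.
  pose K := normc a + 1; have K0 : 0 < K by rewrite /K ltr_wpDl ?normc_ge0.
  have [n1 h1] := LP u (e / 2 / K) ltac:(by rewrite !divr_gt0).
  have [n2 h2] := LP v (e / 2) ltac:(by rewrite !divr_gt0).
  exists (maxn n1 n2) => n; rewrite geq_max => /andP[/h1 k1 /h2 k2].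
  rewrite derive_linear//.
  rewrite opprD addrACA -scalerBr; apply: le_trans (le_normcD _ _) _; rewrite normc_scale.
  have : normc a * normc ('D_u (F n) z0 - L u) <= K * (e / 2 / K).
    by apply: ler_pM; rewrite ?normc_ge0// /K lerDl.
  by rewrite (mulrC K) divfK ?gt_eqF//; lra.
pose LM := GRing.isLinear.Build _ _ _ _ L Llin.
pose LL : {linear E -> C} := HB.pack L LM.
have le_lim (u : nat -> R[i]) l (b : R) j0 : ccvg u l ->
    (forall j, (j0 <= j)%N -> normc (u j) <= b) -> normc l <= b.
  move=> ul ub; apply/ler_addgt0Pr => e e0; have [n nP] := ul e e0.
  have := le_normcB (u (maxn n j0)) (u (maxn n j0) - l); rewrite subKr.
  have := ub _ (leq_maxr n j0); have := nP _ (leq_maxl n j0); lra.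
have [j1 jP1] := cau 1 ltr01.
have key (e : R) : 0 < e -> exists j, (forall h, normc (L h - 'D_h (F j) z0) <= e * N h) /\
    (forall h, N h <= rho / 4 -> normc ((g (z0 + h) - g z0 - L h) -
      (F j (z0 + h) - F j z0 - 'D_h (F j) z0)) <= e * N h).
  move=> e0; have [j jP] := cau (e * rho / 8) ltac:(by rewrite divr_gt0// mulr_gt0).
  exists j; split=> h.
    apply: (@le_lim (fun i => 'D_h (F i) z0 - 'D_h (F j) z0) _ _ j) => [|i ij].
      move=> e' e0'; have [n nP] := LP h e' e0'; exists n => m /nP.
      by rewrite opprB addrA subrK.
    have [+ _] := line _ _ _ (jP i j ij (leqnn _)).
    move=> /(_ h) hh; apply: le_trans hh _; rewrite ler_wpM2r ?linfty_norm_ge0//.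
    rewrite (_ : 2 * (e * rho / 8) / rho = e / 4); first lra.
    by field; rewrite gt_eqF.
  move=> hr; apply: (@le_lim (fun i => (F i (z0 + h) - F i z0 - 'D_h (F i) z0) -
      (F j (z0 + h) - F j z0 - 'D_h (F j) z0)) _ _ j) => [|i ij].
    move=> e' e0'; have [n nP] := LP h (e' / 3) ltac:(by rewrite divr_gt0).
    have [n' nP'] := Fg (e' / 3) ltac:(by rewrite divr_gt0).
    exists (maxn n n') => m; rewrite geq_max => /andP[/nP a1 mn'].
    have a2 := nP' m z0 mn' ltac:(by rewrite subrr linfty_norm0).
    have a3 := nP' m (z0 + h) mn' ltac:(by rewrite addrC addKr; lra).
    set Y := F j (z0 + h) - _ - _; set X := F m (z0 + h) - _ - _; set Z := g (z0 + h) - _ - _.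
    rewrite subBB /X /Z {X Y Z}.
    have -> : F m (z0 + h) - F m z0 - 'D_h (F m) z0 - (g (z0 + h) - g z0 - L h) =
      (F m (z0 + h) - g (z0 + h)) - (F m z0 - g z0) - ('D_h (F m) z0 - L h) by exact: subACA3.
    apply: le_trans (le_normcB _ _) _.
    by have := le_normcB (F m (z0 + h) - g (z0 + h)) (F m z0 - g z0); lra.
  have [_] := line _ _ _ (jP i j ij (leqnn _)).
  move=> /(_ h hr) hh; apply: le_trans hh _; rewrite ler_wpM2r ?linfty_norm_ge0//.
  rewrite (_ : 8 * (e * rho / 8) / rho = e)//.
  by field; rewrite gt_eqF.
have [gd DE] : differentiable g z0 /\ forall v, 'D_v g z0 = LL v.
  have [j [jP _]] := key 1 ltr01.
  have [K K0 KP] := linear_lipschitz (diff_continuous (z0in j)).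
  have Kr : K = (complex.Re K)%:C%C by case: K K0 {KP} => a b; rewrite ltcE/= => /andP[/eqP-> _].
  apply: (@differentiable_bound g z0 LL (1 + complex.Re K)).
    move=> h; rewrite -[LL h]/(L h) mulrDl -[L h](subrK ('D_h (F j) z0)).
    apply: le_trans (le_normcD _ _) _; apply: lerD; first exact: jP.
    by have := KP h; rewrite normr_normc normr_linfty Kr -rmorphM lecR deriveE.
  move=> e e0; have [i [_ iP]] := key (e / 2) ltac:(by rewrite divr_gt0).
  have [r r0 rP] := differentiable_o (z0in i) (e := e / 2) ltac:(by rewrite divr_gt0).
  exists (Num.min r (rho / 4)); first by rewrite lt_min r0 divr_gt0.
  move=> h; rewrite lt_min => /andP[/rP h1 /ltW/iP h2].
  have -> : g (z0 + h) - g z0 - LL h = (g (z0 + h) - g z0 - L h -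
      (F i (z0 + h) - F i z0 - 'D_h (F i) z0)) + (F i (z0 + h) - F i z0 - 'D_h (F i) z0) by rewrite subrK.
  apply: le_trans (le_normcD _ _) _; rewrite -deriveE// in h1; lra.
split=> // v; rewrite DE; exact: LP.
Qed.

(* Closed under directional derivatives, unlike [Hoo_ball]: derivatives are only bounded
   on smaller balls. *)
Definition holo f := (forall z, N z < 1 -> differentiable f z) /\
  (forall r : R, r < 1 -> exists M : R, forall z, N z <= r -> normc (f z) <= M).

(** Difference quotient with step [1 / (K * (n + 2))]. With [K = dqscale v r] the vector [v / K] is
    short enough to stay in the unit ball from every [z] with [N z <= r], and [n + 2] keeps the
    parameter at most [1 / 2], the range of the second-order estimate in [cauchy_line]. *)
Definition dquot (K : R) v f n z : C :=
  (K * n.+2%:R)%:C%C * (f (z + ((K * n.+2%:R)^-1)%:C%C *: v) - f z).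

Definition dqscale v (r : R) := N v / ((1 - r) / 2) + 1.

Lemma dquotP f v (r : R) : holo f -> 0 <= r < 1 ->
  let K := dqscale v r in exists M : R,
  [/\ 0 < K, forall n z, N z <= r -> N (z + ((K * n.+2%:R)^-1)%:C%C *: v) < 1 &
   forall z, N z <= r -> normc ('D_v f z) <= M /\
    forall n, normc (dquot K v f n z - 'D_v f z) <= M / n.+2%:R].
Proof.
move=> [fd fb] /andP[r0 r1] K; pose rho := (1 - r) / 2.
have rho0 : 0 < rho by rewrite /rho; lra.
have KE : K = N v / rho + 1 by [].
have K0 : 0 < K by rewrite KE ltr_wpDl// divr_ge0 ?linfty_norm_ge0// ltW.
have Kv : N ((K^-1)%:C%C *: v) <= rho.
  rewrite linfty_normZ normc_real gtr0_norm ?invr_gt0// mulrC ler_pdivrMr//.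
  by rewrite KE mulrDr mulr1 mulrC divfK ?gt_eqF// lerDl ltW.
have [M MP] := fb (r + rho) ltac:(by rewrite /rho; lra).
have inn z t : N z <= r -> normc t <= 1 -> N (z + t *: ((K^-1)%:C%C *: v)) <= r + rho.
  move=> zr t1; apply: le_trans (ler_linfty_normD _ _) _; apply: lerD => //.
  by rewrite linfty_normZ; have := linfty_norm_ge0 ((K^-1)%:C%C *: v); have := normc_ge0 t; nra.
have M0 : 0 <= M by apply: le_trans (MP 0 _); rewrite ?normc_ge0// linfty_norm0 addr_ge0// ltW.
have n0 n : 0 < n.+2%:R :> R by rewrite ltr0n.
have n00 n : n.+2%:R != 0 :> R by rewrite gt_eqF.
clearbody K; have K00 : K != 0 by rewrite gt_eqF.
have tn n : normc ((n.+2%:R^-1)%:C%C : R[i]) = n.+2%:R^-1.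
  by rewrite normc_real gtr0_norm ?invr_gt0.
have sE n z : z + ((K * n.+2%:R)^-1)%:C%C *: v = z + (n.+2%:R^-1)%:C%C *: ((K^-1)%:C%C *: v).
  by rewrite scalerA -rmorphM invfM (mulrC K^-1).
exists (4 * M * K); split=> //.
  move=> n z zr; rewrite sE; apply: le_lt_trans (inn _ _ zr _) _; last by rewrite /rho; lra.
  by rewrite tn invf_le1 ?ler1n.
move=> z zr.
have rr1 : r + rho < 1 by rewrite /rho; lra.
have [t ht|t ht|h1 h2] := @cauchy_line f z ((K^-1)%:C%C *: v) M.
- by apply: fd; apply: le_lt_trans (inn _ _ zr ht) rr1.
- by apply: MP; exact: inn.
have Dz : 'D_((K^-1)%:C%C *: v) f z = (K^-1)%:C%C * 'D_v f z.
  have fdz : differentiable f z by apply: fd; lra.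
  by have := derive_linear fdz (K^-1)%:C%C v 0; rewrite derive0 !addr0.
split.
  move: h1; rewrite Dz normcM normc_real gtr0_norm ?invr_gt0// ler_pdivrMl//.
  have := mulr_ge0 (ltW K0) M0; nra.
move=> n; have := h2 (n.+2%:R^-1)%:C%C; rewrite tn lef_pV2 ?posrE// ler_nat => /(_ isT) h.
rewrite /dquot sE; set D := f (z + _) - f z in h *.
have -> : (K * n.+2%:R)%:C%C * D - 'D_v f z =
    (K * n.+2%:R)%:C%C * (D - (n.+2%:R^-1)%:C%C * 'D_((K^-1)%:C%C *: v) f z).
  have KK : (K * n.+2%:R)%:C%C * (n.+2%:R^-1)%:C%C * (K^-1)%:C%C = 1 :> R[i].
    by rewrite -!rmorphM mulfK// divff// rmorph1.
  have EE (X Y : R[i]) : (K * n.+2%:R)%:C%C * X - Y =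
      (K * n.+2%:R)%:C%C * (X - (n.+2%:R^-1)%:C%C * ((K^-1)%:C%C * Y)).
    by rewrite mulrBr !mulrA KK mul1r.
  by rewrite Dz; exact: EE.
rewrite normcM normc_real gtr0_norm ?mulr_gt0//.
apply: le_trans (ler_wpM2l _ h) _; first by rewrite mulr_ge0 ?ltW.
by rewrite le_eqVlt; apply/orP; left; apply/eqP; field.
Qed.

Lemma cvg_inv_nat (M e : R) : 0 < e -> exists n0, forall n, (n0 <= n)%N -> M / n.+2%:R <= e.
Proof.
move=> e0; exists (Num.bound (M / e)) => n hn; rewrite ler_pdivrMr ?ltr0n//.
case: (leP 0 M) => M0; last by rewrite (le_trans (ltW M0))// mulr_ge0 ?ltW.
rewrite mulrC -ler_pdivrMr//; apply: ltW.
apply: lt_le_trans (archi_boundP (divr_ge0 M0 (ltW e0))) _; rewrite ler_nat.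
by apply: leq_trans hn _; rewrite -addn2 leq_addr.
Qed.

Lemma dquot_diff K v f n z : holo f -> N z < 1 -> N (z + ((K * n.+2%:R)^-1)%:C%C *: v) < 1 ->
  differentiable (dquot K v f n) z /\
  forall w, 'D_w (dquot K v f n) z = dquot K v ('D_w f) n z.
Proof.
move=> [fd fb] z1 zs1.
pose a : R[i] := (K * n.+2%:R)%:C%C; set b := _ *: v in zs1.
have sd : is_diff z (fun z : E => z + b) id.
  by apply: is_diff_eq; rewrite /= addr0.
have d1 : differentiable (fun z => f (z + b)) z.
  by apply: differentiable_comp; [exact: ex_diff|exact: fd].
have d2 : differentiable (fun z => f (z + b) - f z) z by apply: differentiableB => //; exact: fd.
have d3 : differentiable (dquot K v f n) z by exact: (differentiableZ a d2).
split=> // w.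
have dE : 'D_w (fun z => f (z + b)) z = 'D_w f (z + b).
  have fw : derivable f (z + b) w by apply: diff_derivable; exact: fd.
  have := derivable_cdiff fw.
  rewrite (_ : (fun t => f (t *: w + (z + b))) = fun t => (fun y => f (y + b)) (t *: w + z)).
    by move=> h; exact: (cdiff_derive (f := fun y => f (y + b)) h).2.
  by apply/funext => t; rewrite addrA.
have fw' : derivable f z w by apply: diff_derivable; exact: fd.
have d1w : derivable (fun y => f (y + b)) z w by exact: diff_derivable.
have E2 : 'D_w (fun z => f (z + b) - f z) z = 'D_w f (z + b) - 'D_w f z.
  by rewrite -dE; exact: deriveB.
have d2w : derivable (fun z => f (z + b) - f z) z w by exact: diff_derivable.
have E1 := deriveZ a d2w; rewrite E2 in E1.
exact: E1.
Qed.

Lemma holo_near f v z0 : holo f -> N z0 < 1 ->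
  let K := dqscale v ((1 + N z0) / 2) in exists rho : R, [/\ 0 < rho,
  forall n z, N (z - z0) < rho -> N z < 1 /\ N (z + ((K * n.+2%:R)^-1)%:C%C *: v) < 1 &
  forall e : R, 0 < e -> exists j0, forall j z, (j0 <= j)%N -> N (z - z0) < rho ->
      normc (dquot K v f j z - 'D_v f z) <= e].
Proof.
move=> fh z01 K; pose r := (1 + N z0) / 2.
have rI : 0 <= r < 1 by have := linfty_norm_ge0 z0; rewrite /r; lra.
have zr z : N (z - z0) < (1 - N z0) / 2 -> N z <= r.
  by move=> h; have := ler_linfty_normD (z - z0) z0; rewrite subrK /r; lra.
have [M [K0 h1 h2]] := dquotP v fh rI.
exists ((1 - N z0) / 2); split; first lra.
  by move=> n z /zr zr'; split; [lra|exact: h1].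
move=> e e0; have [n nP] := cvg_inv_nat M e0; exists n => j z nj /zr zr'.
by apply: le_trans (nP j nj); exact: (h2 z zr').2.
Qed.

(** Near every point the derivative is a uniform limit of difference quotients, which are
    holomorphic, so [weierstrass] applies; one derivative of [f] therefore yields all. *)
Lemma holo_derive f v : holo f -> holo ('D_v f).
Proof.
move=> fh; split=> [z0 z01|r r1].
  have [rho [rho0]] := holo_near v fh z01.
  set K := dqscale _ _ => h1 h2.
  have h3 j z : N (z - z0) < rho -> differentiable (dquot K v f j) z.
    by move=> /(h1 j)[a1 a2]; have [] := dquot_diff fh a1 a2.
  exact: (weierstrass rho0 h3 h2).1.
have [r0|r0] := leP 0 r.
  have [M [_ _ h]] := dquotP v fh (introT andP (conj r0 r1)).
  by exists M => z /h[].
by exists 0 => z zr; have := linfty_norm_ge0 z; lra.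
Qed.

(** Difference quotients in direction [v] commute with ['D_w]. In the limit one order is given by
    convergence of derivatives in [weierstrass], the other by the quotients of ['D_w f]. *)
Lemma derive_comm f v w z : holo f -> N z < 1 -> 'D_v ('D_w f) z = 'D_w ('D_v f) z.
Proof.
move=> fh z1; have [rho [rho0 h1 h2]] := holo_near v fh z1.
have [rho' [rho0' _ h2']] := holo_near v (holo_derive w fh) z1.
move: h1 h2 h2'; set K := dqscale _ _ => h1 h2 h2'.
have h3 j z' : N (z' - z) < rho -> differentiable (dquot K v f j) z'.
  by move=> /(h1 j)[a1 a2]; have [] := dquot_diff fh a1 a2.
have h4 := (weierstrass rho0 h3 h2).2 w.
apply/esym; apply: (ccvg_unique h4) => e e0.
have [j0 jP] := h2' e e0; exists j0 => j hj.
have zz (r : R) : 0 < r -> N (z - z) < r by rewrite subrr linfty_norm0.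
have [a1 a2] := h1 j z (zz _ rho0).
have [_ ->] := dquot_diff fh a1 a2.
exact: jP (zz _ rho0').
Qed.

End Bridge.

Section CdiffRules.
Variable R : realType.
Implicit Types (f g : R[i] -> R[i]).

Lemma cdiff_eq f t d d' : d = d' -> cdiff f t d -> cdiff f t d'.
Proof. by move=> ->. Qed.

Lemma cdiff_cst (c t : R[i]) : cdiff (fun _ => c) t 0.
Proof. by move=> e e0; exists 1 => // h _; rewrite mul0r !subrr normc0 mulr_ge0 ?normc_ge0// ltW. Qed.

Lemma cdiff_id (t : R[i]) : cdiff id t 1.
Proof. by move=> e e0; exists 1 => // h _; rewrite /= mul1r (addrC t) addrK subrr normc0 mulr_ge0 ?normc_ge0// ltW. Qed.

Lemma cdiffD f g t d d' : cdiff f t d -> cdiff g t d' -> cdiff (fun t => f t + g t) t (d + d').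
Proof.
move=> fd gd e e0; have [r r0 rP] := fd (e / 2) ltac:(lra); have [s s0 sP] := gd (e / 2) ltac:(lra).
exists (Num.min r s); first by rewrite lt_min r0.
move=> h; rewrite lt_min => /andP[/rP h1 /sP h2].
have -> : f (t + h) + g (t + h) - (f t + g t) - (d + d') * h =
  (f (t + h) - f t - d * h) + (g (t + h) - g t - d' * h) by ring.
by apply: le_trans (le_normcD _ _) _; lra.
Qed.

Lemma cdiffM f g t d d' : cdiff f t d -> cdiff g t d' ->
  cdiff (fun t => f t * g t) t (d * g t + f t * d').
Proof.
move=> fd gd e e0.
have gc := cdiff_ccont gd.
pose A := normc (f t); pose B := normc (g t); pose D := normc d.
have [A0 B0 D0] : [/\ 0 <= A, 0 <= B & 0 <= D] by split; exact: normc_ge0.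
pose K := A + B + D + 3; have K0 : 0 < K by rewrite /K; lra.
pose eta := Num.min 1 (e / K).
have eta0 : 0 < eta by rewrite lt_min ltr01 divr_gt0.
have eta1 : eta <= 1 by rewrite ge_min lexx.
have etaK : eta * K <= e by rewrite -ler_pdivlMr// ge_min lexx orbT.
have [r r0 rP] := fd _ eta0; have [s s0 sP] := gd _ eta0; have [q q0 qP] := gc _ eta0.
exists (Num.min r (Num.min s q)); first by rewrite !lt_min r0 s0.
move=> h; rewrite !lt_min => /and3P[/rP h1 /sP h2 /qP h3].
have -> : f (t + h) * g (t + h) - f t * g t - (d * g t + f t * d') * h =
  (f (t + h) - f t - d * h) * g (t + h) + d * h * (g (t + h) - g t)
  + f t * (g (t + h) - g t - d' * h) by ring.
have h4 : normc (g (t + h)) <= B + 1.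
  by have := le_normcD (g (t + h) - g t) (g t); rewrite subrK -/B; lra.
apply: le_trans (le_normcD _ _) _; apply: le_trans (lerD (le_normcD _ _) (lexx _)) _.
rewrite !normcM -/A -/D; have H0 := normc_ge0 h.
have k1 : normc (f (t + h) - f t - d * h) * normc (g (t + h)) <= eta * normc h * (B + 1).
  by apply: ler_pM; rewrite ?normc_ge0.
have k2 : D * normc h * normc (g (t + h) - g t) <= D * normc h * eta.
  by apply: ler_wpM2l => //; rewrite mulr_ge0.
have k3 : A * normc (g (t + h) - g t - d' * h) <= A * (eta * normc h) by apply: ler_wpM2l.
have k4 : eta * K * normc h <= e * normc h by apply: ler_wpM2r.
have k5 : 0 <= eta * normc h by rewrite mulr_ge0// ltW.
rewrite /K in k4; lra.
Qed.

Lemma cdiffX (t : R[i]) n : cdiff (fun t => t ^+ n) t (n%:R * t ^+ n.-1).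
Proof.
elim: n => [|n IH]; first by rewrite mul0r; exact: cdiff_cst.
have := cdiffM (cdiff_id t) IH; rewrite mul1r => h.
have -> : (fun t : R[i] => t ^+ n.+1) = (fun t => id t * t ^+ n).
  by apply/funext => s; rewrite exprS.
apply: cdiff_eq h; case: n {IH} => [|n] /=; first by rewrite mul0r mulr0 addr0 mul1r.
by rewrite -[n.+2%:R]natr1 mulrDl mul1r addrC exprS mulrCA.
Qed.

Lemma cdiff_poly (c : nat -> R[i]) (t : R[i]) m :
  cdiff (fun t => \sum_(i < m.+1) c i * t ^+ i) t (\sum_(i < m) (i.+1%:R * c i.+1) * t ^+ i).
Proof.
elim: m => [|m IH].
  rewrite big_ord0 (_ : (fun _ => _) = fun _ => c 0%N); first exact: cdiff_cst.
  by apply/funext => s; rewrite big_ord1 expr0 mulr1.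
rewrite (_ : (fun _ => _) = fun s => \sum_(i < m.+1) c i * s ^+ i + c m.+1 * s ^+ m.+1).
  rewrite big_ord_recr /=; apply: cdiffD IH _.
  apply: cdiff_eq (cdiffM (cdiff_cst (c m.+1) t) (cdiffX t m.+1)).
  by rewrite mul0r add0r mulrCA !mulrA.
by apply/funext => s; rewrite big_ord_recr.
Qed.

Lemma cauchy_disc g (d : R[i]) (M : R) : (forall t, normc t <= 1 -> exists d, cdiff g t d) ->
  (forall t, normc t <= 1 -> normc (g t) <= M) -> cdiff g 0 d -> normc d <= M.
Proof.
move=> gd gM g0; have [c cM cP] := taylor gd gM.
have M0 : 0 <= M by apply: le_trans (cM 0%N); exact: normc_ge0.
have c0 : g 0 = c 0%N.
  have := cP 0 1%N; rewrite big_ord1 expr0 mulr1 normc0 expr1 mulr0 mul0r => /(_ ltr01) h.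
  by apply/eqP; rewrite -subr_eq0 -normc_eq0; apply/eqP/le_anti; rewrite h normc_ge0.
suff -> : d = c 1%N by exact: cM.
apply/eqP; rewrite -subr_eq0 -normc_eq0; apply/eqP/le_anti; rewrite normc_ge0 andbT.
apply/ler_addgt0Pr => e e0; rewrite add0r.
have [r r0 rP] := g0 (e / 2) ltac:(lra).
pose K := 4 * M + 1; have K0 : 0 < K by rewrite /K; lra.
pose x := Num.min (r / 2) (Num.min (1 / 2) (e / 2 / K)).
have x0 : 0 < x by rewrite !lt_min !divr_gt0.
have [xr [x1 xe]] : x <= r / 2 /\ x <= 1 / 2 /\ x <= e / 2 / K by rewrite !ge_min !lexx !orbT.
have nx : normc (x%:C%C) = x by rewrite normc_real ger0_norm// ltW.
have := rP x%:C%C ltac:(by rewrite nx; lra).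
have := cP x%:C%C 2%N ltac:(by rewrite nx; lra).
have -> : \sum_(i < 2) c i * x%:C%C ^+ i = g 0 + c 1%N * x%:C%C.
  by rewrite big_ord_recl big_ord1 expr0 mulr1 -c0 expr1.
rewrite add0r nx => h1 h2.
have : normc ((d - c 1%N) * x%:C%C) <= e / 2 * x + 2 * M * x ^+ 2 / (1 - x).
  have -> : (d - c 1%N) * x%:C%C = (g x%:C%C - (g 0 + c 1%N * x%:C%C)) - (g x%:C%C - g 0 - d * x%:C%C) by ring.
  by apply: le_trans (le_normcB _ _) _; lra.
rewrite normcM nx => h3; rewrite -(ler_pM2r x0); apply: le_trans h3 _.
suff : 2 * M * x ^+ 2 / (1 - x) <= e / 2 * x by lra.
rewrite ler_pdivrMr; last lra.
move: xe; rewrite ler_pdivlMr// /K => xe.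
have : 0 <= M * x * x by rewrite !mulr_ge0// ltW.
have : 0 <= e * x by rewrite mulr_ge0// ltW.
rewrite expr2 => a b.
have : x * (4 * M + 1) * x <= e / 2 * x by apply: ler_wpM2r => //; rewrite ltW.
nra.
Qed.

End CdiffRules.

(** * Taylor jets along complex lines *)

Section Jets.
Variable R : realType.
Local Notation E := (linfty R).
Local Notation C := (R[i]^o).
Local Notation N := (@linfty_norm R).
Implicit Types (f g : E -> C) (z v : E).

(** Taylor polynomial of the restriction to the line through [z], given by an estimate rather than
    by derivatives, so that it can be read off any good enough approximation. *)
Definition jet f z (c : nat -> R[i]) m := exists K r : R, [/\ 0 < r, r <= 1 &
  forall t, 0 < normc t <= r -> normc (f (t *: z) - \sum_(i < m) c i * t ^+ i) <= K * normc t ^+ m].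

Lemma scale_in z (t : R[i]) : N z < 1 -> normc t <= 1 -> N (t *: z) < 1.
Proof.
move=> z1 t1; rewrite linfty_normZ; apply: le_lt_trans z1.
by rewrite ler_piMl// linfty_norm_ge0.
Qed.

Lemma holo_line f z (t : R[i]) : holo f -> N z < 1 -> normc t <= 1 ->
  cdiff (fun t => f (t *: z)) t ('D_z f (t *: z)).
Proof.
move=> [fd _] z1 t1; have := @diff_line R f 0 z t; rewrite add0r.
rewrite (_ : (fun t => f (0 + t *: z)) = fun t => f (t *: z)).
  by apply; apply: fd; exact: scale_in.
by apply/funext => s; rewrite add0r.
Qed.

(** Cauchy's estimate for the remainder on the disc of radius [normc t] about [t], where it is at
    most [K * (2 * normc t) ^+ m.+1]; dividing by the radius loses one power of [normc t]. *)
Lemma jet_derive f z c m : holo f -> N z < 1 -> jet f z c m.+1 ->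
  jet ('D_z f) z (fun i => i.+1%:R * c i.+1) m.
Proof.
move=> fh z1 [K [r [r0 r1 rP]]].
exists (K * 2 ^+ m.+1), (r / 2); split; [lra|lra|] => t /andP[t0 tr].
pose p t := f (t *: z) - \sum_(i < m.+1) c i * t ^+ i.
have pderiv s : normc s <= 1 -> cdiff p s ('D_z f (s *: z) - \sum_(i < m) (i.+1%:R * c i.+1) * s ^+ i).
  move=> s1; apply: cdiffD; first exact: holo_line.
  have := cdiffM (cdiff_cst (-1) s) (cdiff_poly c s m).
  rewrite mul0r add0r mulN1r; congr cdiff; apply/funext => x.
  by rewrite mulN1r.
pose g s := p (t + t * s).
have K0 : 0 <= K.
  have := rP t ltac:(by rewrite t0; lra); move/(le_trans (normc_ge0 _)).
  by rewrite pmulr_lge0// exprn_gt0.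
have tt s : normc s <= 1 -> normc (t + t * s) <= 2 * normc t.
  move=> s1; apply: le_trans (le_normcD _ _) _; rewrite normcM; nra.
have gd s : normc s <= 1 -> cdiff g s (t * ('D_z f ((t + t * s) *: z) -
    \sum_(i < m) (i.+1%:R * c i.+1) * (t + t * s) ^+ i)).
  move=> s1 e e0; have T1 := tt s s1.
  have [d d0 dP] := pderiv (t + t * s) ltac:(lra) (e / normc t) ltac:(by rewrite divr_gt0).
  exists (d / normc t); first by rewrite divr_gt0.
  move=> h; rewrite ltr_pdivlMr// mulrC -normcM => /dP.
  have -> : e / normc t * normc (t * h) = e * normc h by rewrite normcM mulrA divfK ?gt_eqF.
  by rewrite /g mulrDr addrA mulrA (mulrC _ t).
have tn0 : t != 0 by rewrite -normc_gt0.
have := @cauchy_disc R g _ (K * (2 * normc t) ^+ m.+1) (fun s hs => ex_intro _ _ (gd s hs)) _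
  (gd 0 ltac:(by rewrite normc0 ler01)).
rewrite mulr0 addr0 normcM => h.
rewrite -(ler_pM2l t0); apply: le_trans (h _) _ => [s s1|].
  (* The disc reaches 0, where [jet] asserts nothing; there [f 0 = c 0] follows by continuity. *)
  rewrite /g /p; have [e0|ne0] := eqVneq (t + t * s) 0.
    rewrite e0 scale0r.
    have -> : f 0 = c 0%N.
      apply/eqP; rewrite -subr_eq0 -normc_eq0; apply/eqP/le_anti; rewrite normc_ge0 andbT.
      apply/ler_addgt0Pr => e e'0; rewrite add0r.
      have pc := cdiff_ccont (pderiv 0 ltac:(by rewrite normc0)).
      have [d d0 dP] := pc (e / 2) ltac:(lra).
      pose x := Num.min (d / 2) (Num.min r (e / 2 / (K + 1))).
      have x0 : 0 < x by rewrite !lt_min !divr_gt0//= ?r0//; lra.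
      have [xd [xr xe]] : x <= d / 2 /\ x <= r /\ x <= e / 2 / (K + 1) by rewrite !ge_min !lexx !orbT.
      have nx : normc (x%:C%C) = x by rewrite normc_real ger0_norm// ltW.
      have a1 := dP x%:C%C ltac:(by rewrite nx; lra).
      have a2 := rP x%:C%C ltac:(by rewrite nx x0).
      rewrite add0r in a1; rewrite nx in a2.
      have -> : f 0 - c 0%N = p 0.
        rewrite /p scale0r big_ord_recl expr0 mulr1 big1 ?addr0// => i _.
        by rewrite expr0n mulr0.
      have : K * x ^+ m.+1 <= e / 2.
        rewrite ler_pdivlMr in xe; last lra.
        have xm : x ^+ m <= 1 by apply: exprn_ile1; lra.
        have : K * x * x ^+ m <= K * x by rewrite ler_piMr// mulr_ge0// ltW.
        by rewrite exprS mulrA; lra.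
      have {}a2 : normc (p x%:C%C - 0) <= K * x ^+ m.+1 by rewrite subr0.
      move=> kx; rewrite -[p 0]subr0; apply: le_trans (le_normc_dist _ (p x%:C%C) _) _; rewrite normc_distC.
      by apply: le_trans (lerD a1 a2) _; lra.
    rewrite big_ord_recl expr0 mulr1 big1 ?addr0.
      by rewrite subrr normc0 mulr_ge0// exprn_ge0// mulr_ge0// normc_ge0.
    by move=> i _; rewrite expr0n mulr0.
  apply: le_trans (rP _ _) _; first by rewrite normc_gt0 ne0; have := tt _ s1; lra.
  by rewrite ler_wpM2l// ler_pXn2r ?nnegrE ?normc_ge0 ?mulr_ge0 ?normc_ge0// tt.
rewrite exprMn [normc t ^+ m.+1]exprS; rewrite le_eqVlt; apply/orP; left; apply/eqP; ring.
Qed.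

(** Turns estimates into derivatives: it serves the expansion in [taylor], and later the gliding
    hump, whose jets are visible from its construction. *)
Lemma jet_iter f z c m : holo f -> N z < 1 -> jet f z c m.+1 ->
  iter m (fun g => 'D_z g) f 0 = m`!%:R * c m.
Proof.
move=> + z1; elim: m f c => [|m IH] f c fh fj.
  rewrite fact0 mul1r /=; have [K [r [r0 r1 rP]]] := fj.
  have K0 : 0 <= K.
    have := rP r%:C%C ltac:(by rewrite normc_real gtr0_norm// r0 lexx); move/(le_trans (normc_ge0 _)).
    by rewrite pmulr_lge0// exprn_gt0// normc_real gtr0_norm.
  have pc := cdiff_ccont (holo_line fh z1 (t := 0) ltac:(by rewrite normc0)).
  apply/eqP; rewrite -subr_eq0 -normc_eq0; apply/eqP/le_anti; rewrite normc_ge0 andbT.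
  apply/ler_addgt0Pr => e e'0; rewrite add0r.
  have [d d0 dP] := pc (e / 2) ltac:(lra).
  pose x := Num.min (d / 2) (Num.min r (e / 2 / (K + 1))).
  have x0 : 0 < x by rewrite !lt_min !divr_gt0//= ?r0//; lra.
  have [xd [xr xe]] : x <= d / 2 /\ x <= r /\ x <= e / 2 / (K + 1) by rewrite !ge_min !lexx !orbT.
  have nx : normc (x%:C%C) = x by rewrite normc_real ger0_norm// ltW.
  have a1 := dP x%:C%C ltac:(by rewrite nx; lra).
  have a2 := rP x%:C%C ltac:(by rewrite nx x0).
  rewrite add0r scale0r in a1; rewrite nx big_ord1 expr0 mulr1 expr1 in a2.
  rewrite ler_pdivlMr in xe; last lra.
  have {}a2 : normc (f (x%:C%C *: z) - c 0%N) <= K * x by exact: a2.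
  apply: le_trans (le_normc_dist _ (f (x%:C%C *: z)) _) _; rewrite normc_distC.
  by apply: le_trans (lerD a1 a2) _; lra.
rewrite iterSr (IH _ (fun i => i.+1%:R * c i.+1)).
- by rewrite factS natrM mulrA (mulrC m.+1%:R).
- exact: holo_derive.
- exact: jet_derive.
Qed.

Lemma taylor_line f z M : holo f -> N z < 1 ->
  (forall t, normc t <= 1 -> normc (f (t *: z)) <= M) ->
  let c m := iter m (fun g => 'D_z g) f 0 / m`!%:R in
  (forall m, normc (c m) <= M) /\ forall a n, normc a < 1 ->
    normc (f (a *: z) - \sum_(i < n) c i * a ^+ i) <= 2 * M * normc a ^+ n / (1 - normc a).
Proof.
move=> fh z1 fM c.
have [c' cM cP] := taylor (fun t ht => ex_intro _ _ (holo_line fh z1 ht)) fM.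
have M0 : 0 <= M by apply: le_trans (cM 0%N); exact: normc_ge0.
suff cE : c = c' by rewrite cE.
apply/funext => m; rewrite /c (@jet_iter f z c')//; first by rewrite mulrC mulKf// pnatr_eq0 -lt0n fact_gt0.
exists (4 * M), (1 / 2); split; [lra|lra|] => t /andP[_ t2].
apply: le_trans (cP t m.+1 ltac:(lra)) _.
have t1 : 0 < 1 - normc t by lra.
rewrite ler_pdivrMr// -2!mulrA; have h : 0 <= M * normc t ^+ m.+1 by rewrite mulr_ge0// exprn_ge0// normc_ge0.
nra.
Qed.

End Jets.

(** * Partial derivatives along words of letters *)

Section Words.
Variable R : realType.
Local Notation E := (linfty R).
Local Notation C := (R[i]^o).
Local Notation N := (@linfty_norm R).
Local Notation delta := (@linfty_delta R).
Implicit Types (f g : E -> C) (z : E) (s : seq nat).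

Definition Dw s f : E -> C := foldr (fun k g => 'D_(delta k) g) f s.

(** Values outside the ball are arbitrary, so identities between iterated derivatives hold inside it
    only. *)
Definition eqB f g := forall z, N z < 1 -> f z = g z.

Lemma Dw_cat s1 s2 f : Dw (s1 ++ s2) f = Dw s1 (Dw s2 f).
Proof. exact: foldr_cat. Qed.

Lemma holo_Dw s f : holo f -> holo (Dw s f).
Proof. by move=> fh; elim: s => //= k s IH; exact: holo_derive. Qed.

Lemma eqB_derive f g (v : E) : holo f -> eqB f g -> eqB ('D_v f) ('D_v g).
Proof.
move=> fh fg z z1.
have fd : derivable f z v by apply: diff_derivable; exact: fh.1.
have := derivable_cdiff fd => fc.
pose r := (1 - N z) / (N v + 1).
have v1 : 0 < N v + 1 by rewrite ltr_wpDl ?linfty_norm_ge0.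
have r0 : 0 < r by rewrite divr_gt0// subr_gt0.
have gc : cdiff (fun t => g (t *: v + z)) 0 ('D_v f z).
  apply: (cdiff_local r0 _ fc) => t tr; apply: fg.
  apply: le_lt_trans (ler_linfty_normD _ _) _; rewrite linfty_normZ add0r.
  have := linfty_norm_ge0 v; have := normc_ge0 t.
  rewrite /r ltr_pdivlMr// in tr; lra.
by have [_ ->] := cdiff_derive gc.
Qed.

Lemma eqB_trans f g h : eqB f g -> eqB g h -> eqB f h.
Proof. by move=> fg gh z z1; rewrite fg// gh. Qed.

Lemma Dw_derive s f (v : E) : holo f -> eqB ('D_v (Dw s f)) (Dw s ('D_v f)).
Proof.
move=> fh; elim: s => [|k s IH]; first by move=> z z1.
apply: (eqB_trans (g := 'D_(delta k) ('D_v (Dw s f)))).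
  by move=> z z1; exact: (derive_comm v (delta k) (holo_Dw s fh) z1).
exact: (eqB_derive (delta k) (holo_derive v (holo_Dw s fh)) IH).
Qed.

Lemma Dw_perm s s' f : holo f -> perm_eq s s' -> eqB (Dw s f) (Dw s' f).
Proof.
move=> fh; elim: s s' => [|k s IH] s' ss'.
  by move: ss'; rewrite perm_sym => /perm_nilP ->.
have ks' : k \in s' by rewrite -(perm_mem ss') mem_head.
case/path.splitPr: ks' ss' => s1 s2 ss'.
have ss : perm_eq s (s1 ++ s2).
  by rewrite -(perm_cons k) (perm_trans ss')// perm_sym -cat1s perm_catCA.
apply: (eqB_trans (g := 'D_(delta k) (Dw (s1 ++ s2) f))).
  exact: (eqB_derive (delta k) (holo_Dw s fh) (IH _ ss)).
rewrite !Dw_cat; exact: (Dw_derive s1 (delta k) (holo_Dw s2 fh)).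
Qed.

Section Letters.
Variables (n : nat) (sg : 'I_n -> nat).
Implicit Types (v : 'I_n -> R[i]) (a : 'I_n -> nat).

Definition emb v : E := \sum_i v i *: delta (sg i).

Definition wordof a : seq nat := flatten [seq nseq (a i) (sg i) | i <- enum 'I_n].

Definition gcoef f a : R[i] := Dw (wordof a) f 0 / (\prod_i (a i)`!)%:R.

Definition mono v a : R[i] := \prod_i v i ^+ a i.

Lemma count_wordof P a : count P (wordof a) = (\sum_i a i * P (sg i))%N.
Proof.
rewrite count_flatten -map_comp sumnE big_map big_enum /=; apply: eq_bigr => i _ /=.
by rewrite count_nseq mulnC.
Qed.

Lemma perm_wordof_cons a a' i : a' i = (a i).+1 -> (forall j, j != i -> a' j = a j) ->
  perm_eq (sg i :: wordof a) (wordof a').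
Proof.
move=> ai aj; apply/permP => P /=; rewrite !count_wordof (bigD1 i)//= [RHS](bigD1 i)//= ai.
by rewrite mulSn addnA; congr (_ + _)%N; apply: eq_bigr => j /aj ->.
Qed.

Lemma derive_emb f v z : holo f -> N z < 1 ->
  'D_(emb v) f z = \sum_i v i * 'D_(delta (sg i)) f z.
Proof.
move=> [fd _] z1; have fl := derive_linear (fd z z1).
rewrite /emb; elim/big_rec2: _ => [|i x y _ <-]; first by rewrite derive0.
by rewrite fl.
Qed.

Local Notation ex a := (fun i => nat_of_ord (a i)).

Definition deg (d : nat) (a : {ffun 'I_n -> 'I_d}) := (\sum_i a i)%N.

(** Exponents live in a finite type, and [inord] returns 0 on overflow; [deg a < d] excludes this in
    [addiE]. *)
Definition addi d (a : {ffun 'I_n -> 'I_d.+1}) (i : 'I_n) : {ffun 'I_n -> 'I_d.+1} :=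
  [ffun j => inord (a j + (j == i))].
Definition subi d (a : {ffun 'I_n -> 'I_d.+1}) (i : 'I_n) : {ffun 'I_n -> 'I_d.+1} :=
  [ffun j => inord (a j - (j == i))].

Lemma deg_ge d (a : {ffun 'I_n -> 'I_d}) i : (a i <= deg a)%N.
Proof. by rewrite /deg (bigD1 i)//= leq_addr. Qed.

Lemma addiE d (a : {ffun 'I_n -> 'I_d.+1}) i j : (deg a < d)%N ->
  addi a i j = (a j + (j == i))%N :> nat.
Proof.
move=> ad; rewrite ffunE inordK// ltnS.
by apply: leq_trans ad; rewrite -[X in (_ <= X)%N]addn1; apply: leq_add; [exact: deg_ge|case: eqP].
Qed.

Lemma subiE d (a : {ffun 'I_n -> 'I_d.+1}) i j : subi a i j = (a j - (j == i))%N :> nat.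
Proof. by rewrite ffunE inordK// (leq_ltn_trans (leq_subr _ _)). Qed.

Lemma deg_addi d (a : {ffun 'I_n -> 'I_d.+1}) i : (deg a < d)%N -> deg (addi a i) = (deg a).+1.
Proof.
move=> ad; rewrite /deg; under eq_bigr do rewrite addiE//.
rewrite big_split/= -[RHS]addn1; congr addn.
by rewrite (bigD1 i)//= eqxx big1// => j /negbTE ->.
Qed.

Lemma addiK d (a : {ffun 'I_n -> 'I_d.+1}) i : (deg a < d)%N -> subi (addi a i) i = a.
Proof.
by move=> ad; apply/ffunP => j; apply: val_inj; rewrite /= subiE addiE// addnK.
Qed.

Lemma subiK d (a : {ffun 'I_n -> 'I_d.+1}) i : (0 < a i)%N -> addi (subi a i) i = a.
Proof.
move=> a0; apply/ffunP => j; apply: val_inj; rewrite /= ffunE subiE subnK ?inordK//.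
by case: eqP => // ->.
Qed.

Lemma deg_subi d (a : {ffun 'I_n -> 'I_d.+1}) i : (0 < a i)%N -> (deg (subi a i)).+1 = deg a.
Proof.
move=> a0; rewrite /deg (bigD1 i)//= [RHS](bigD1 i)//= subiE eqxx subn1 -addSn prednK//.
by congr addn; apply: eq_bigr => j /negbTE ji; rewrite subiE ji subn0.
Qed.

Definition homog d f v m := \sum_(a : {ffun 'I_n -> 'I_d.+1} | deg a == m) gcoef f (ex a) * mono v (ex a).

(** Multinomial formula by induction: an exponent [b] of degree [m + 1] arises from lowering [b] at
    [i] with weight [b i], and these weights add up to [m + 1]. *)
Lemma iter_derive_emb d f v m : holo f -> (m <= d)%N ->
  iter m (fun g => 'D_(emb v) g) f 0 = m`!%:R * homog d f v m.
Proof.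
have N01 : N 0 < 1 by rewrite linfty_norm0.
move=> + + ; elim: m f => [|m IH] f fh md.
  rewrite fact0 mul1r /= /homog (big_pred1 [ffun=> ord0]).
    have -> : mono v (ex ([ffun=> ord0] : {ffun 'I_n -> 'I_d.+1})) = 1.
      by rewrite /mono big1// => i _; rewrite ffunE expr0.
    rewrite mulr1 /gcoef (_ : wordof _ = [::]).
      by rewrite big1 ?divr1// => i _; rewrite ffunE.
    apply/eqP; rewrite -size_eq0 -count_predT count_wordof big1// => i _.
    by rewrite ffunE mul0n.
  move=> a; rewrite /deg; apply/eqP/eqP => [/eqP|->]; last by rewrite big1// => i _; rewrite ffunE.
  rewrite sum_nat_eq0 => /forallP a0; apply/ffunP => i; apply: val_inj; rewrite ffunE /=.
  exact/eqP/a0.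
rewrite iterSr IH; [|exact: holo_derive|exact: ltnW].
rewrite factS natrM -mulrA [RHS]mulrCA; congr (_ * _).
transitivity (\sum_(a : {ffun 'I_n -> 'I_d.+1} | deg a == m) \sum_i
    v i * mono v (ex a) * Dw (wordof (ex (addi a i))) f 0 / (\prod_i (a i)`!)%:R).
  apply: eq_bigr => a /eqP am; rewrite /gcoef -(Dw_derive (wordof (ex a)) (emb v) fh N01).
  rewrite derive_emb//; last exact: holo_Dw.
  rewrite mulrAC mulr_suml mulr_suml; apply: eq_bigr => i _.
  rewrite [X in X / _ = _]mulrAC; congr (_ * _ / _).
  have := @Dw_perm (sg i :: wordof (ex a)) (wordof (ex (addi a i))) f fh.
  move=> h; apply: (h _ 0 N01); apply: perm_wordof_cons => [|j /negbTE ji].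
    by rewrite addiE ?am// eqxx addn1.
  by rewrite addiE ?am// ji addn0.
rewrite exchange_big/=.
transitivity (\sum_i \sum_(b : {ffun 'I_n -> 'I_d.+1} | deg b == m.+1)
    (b i)%:R * (gcoef f (ex b) * mono v (ex b))).
  apply: eq_bigr => i _.
  rewrite [RHS](bigID (fun b : {ffun 'I_n -> 'I_d.+1} => (0 < b i)%N))/= [X in _ + X]big1 ?addr0; last first.
    by move=> b /andP[_]; rewrite lt0n negbK => /eqP ->; rewrite mul0r.
  rewrite [RHS](reindex_onto (fun b : {ffun 'I_n -> 'I_d.+1} => addi b i) (fun b => subi b i))/=; last first.
    by move=> b /andP[_ b0]; rewrite subiK.
  apply: eq_big => a.
    apply/idP/idP => [/eqP am|/andP[/andP[/eqP h1 h2] /eqP h3]].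
      by rewrite deg_addi ?am// eqxx addiK ?am// eqxx addiE ?am// eqxx addn1.
    by have := deg_subi h2; rewrite h3 h1 => -[->].
  move=> /eqP am; rewrite addiE ?am// eqxx addn1 /gcoef /mono.
  have -> : \prod_j v j ^+ addi a i j = v i * \prod_j v j ^+ a j.
    rewrite (bigD1 i)//= [in RHS](bigD1 i)//= addiE ?am// eqxx addn1 exprS -mulrA; congr (_ * (_ * _)).
    by apply: eq_bigr => j /negbTE ji; rewrite addiE ?am// ji addn0.
  have -> : (\prod_j (addi a i j)`! = (a i).+1 * \prod_j (a j)`!)%N.
    rewrite (bigD1 i)//= [in RHS](bigD1 i)//= addiE ?am// eqxx addn1 factS -mulnA; congr (_ * (_ * _))%N.
    by apply: eq_bigr => j /negbTE ji; rewrite addiE ?am// ji addn0.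
  have q0 : (\prod_j (a j)`!)%:R != 0 :> R[i].
    by rewrite pnatr_eq0 -lt0n prodn_gt0// => j; rewrite fact_gt0.
  have a1 : (a i).+1%:R != 0 :> R[i] by rewrite pnatr_eq0.
  move: (Dw _ f 0 : R[i]) (\prod_j _) => D p; rewrite natrM.
  by move: q0 a1; set x := _%:R; set y := _%:R => *; field; apply/andP; split.
rewrite exchange_big/= mulr_sumr; apply: eq_bigr => b /eqP bm.
by rewrite -mulr_suml -natr_sum -/(deg b) bm.
Qed.

Lemma homog_taylor f v M d : holo f -> N (emb v) < 1 ->
  (forall z, N z < 1 -> normc (f z) <= M) ->
  (forall m, (m <= d)%N -> normc (homog d f v m) <= M) /\
  forall t k, normc t < 1 -> (k <= d.+1)%N ->
    normc (f (t *: emb v) - \sum_(i < k) homog d f v i * t ^+ i) <= 2 * M * normc t ^+ k / (1 - normc t).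
Proof.
move=> fh v1 fM.
have [h1 h2] := taylor_line fh v1 (fun t ht => fM _ (scale_in v1 ht)).
have e m : (m <= d)%N -> iter m (fun g => 'D_(emb v) g) f 0 / m`!%:R = homog d f v m.
  by move=> md; rewrite (iter_derive_emb v fh md) mulrC mulKf// pnatr_eq0 -lt0n fact_gt0.
split=> [m md|t k t1 kd]; first by rewrite -e.
apply: le_trans (h2 t k t1); rewrite le_eqVlt; apply/orP; left; apply/eqP.
congr (normc (_ - _)); apply: eq_bigr => i _; congr (_ * _); rewrite -e//.
by rewrite -ltnS (leq_trans (ltn_ord i)).
Qed.

End Letters.
End Words.

(** * Hypercontractivity and the Bohnenblust-Hille inequality *)

Section FiniteInequalities.
Variable R : realType.

Lemma young_powR (a b s : R) : 0 <= a -> 0 <= b -> 0 < s < 1 ->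
  a `^ s * b `^ (1 - s) <= s * a + (1 - s) * b.
Proof.
move=> a0 b0 /andP[s0 s1]; have t0 : 0 < 1 - s by rewrite subr_gt0.
have := @conjugate_powR R (a `^ s) (b `^ (1 - s)) s^-1 (1 - s)^-1 (powR_ge0 _ _) (powR_ge0 _ _).
rewrite !invr_gt0 !invrK => /(_ s0 t0) h; apply: le_trans (h _) _; first by rewrite addrC subrK.
by rewrite -!powRrM !mulfV ?gt_eqF// !powRr1// (mulrC a) (mulrC b).
Qed.

Lemma hoelder_sum (I : Type) (r : seq I) (f g : I -> R) (s : R) :
  (forall i, 0 <= f i) -> (forall i, 0 <= g i) -> 0 < s < 1 ->
  \sum_(i <- r) f i `^ s * g i `^ (1 - s) <=
  (\sum_(i <- r) f i) `^ s * (\sum_(i <- r) g i) `^ (1 - s).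
Proof.
move=> f0 g0 sI; have /andP[s0 s1] := sI; have t0 : 0 < 1 - s by rewrite subr_gt0.
set F := \sum_(i <- r) f i; set G := \sum_(i <- r) g i.
have F0 : 0 <= F by exact: sumr_ge0.
have G0 : 0 <= G by exact: sumr_ge0.
have zero (h : I -> R) : (forall i, 0 <= h i) -> \sum_(i <- r) h i = 0 ->
    forall k : I -> R, \sum_(i <- r) h i `^ s * k i = 0 /\ \sum_(i <- r) k i * h i `^ (1 - s) = 0.
  move=> h0; elim: r {F G F0 G0} => [|x r IH]; first by move=> _ k; rewrite !big_nil.
  rewrite big_cons => /eqP; rewrite paddr_eq0 ?sumr_ge0// => /andP[/eqP hx /eqP /IH k] l.
  have [k1 k2] := k l; rewrite !big_cons hx k1 k2 !powR0 ?gt_eqF//; split; ring.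
have [F00|Fn0] := eqVneq F 0.
  by rewrite (zero _ f0 F00 _).1 mulr_ge0 ?powR_ge0.
have [G00|Gn0] := eqVneq G 0.
  by rewrite (zero _ g0 G00 (fun i => f i `^ s)).2 mulr_ge0 ?powR_ge0.
have Fp : 0 < F by rewrite lt_def Fn0.
have Gp : 0 < G by rewrite lt_def Gn0.
have e1 : \sum_(i <- r) (s * (f i / F) + (1 - s) * (g i / G)) = 1.
  by rewrite big_split/= -!mulr_sumr -!mulr_suml !divff// !mulr1 addrC subrK.
rewrite -[leRHS]mul1r -[X in X * _]e1 mulr_suml; apply: ler_sum => i _.
have h := @young_powR (f i / F) (g i / G) s (divr_ge0 (f0 i) F0) (divr_ge0 (g0 i) G0) sI.
apply: le_trans (ler_wpM2r _ h); last by rewrite mulr_ge0 ?powR_ge0.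
by rewrite mulrACA -!powRM ?divr_ge0// !divfK.
Qed.

Lemma cauchy_sum (I : Type) (r : seq I) (a b : I -> R) :
  (forall i, 0 <= a i) -> (forall i, 0 <= b i) ->
  (\sum_(i <- r) a i * b i) ^+ 2 <= (\sum_(i <- r) a i ^+ 2) * (\sum_(i <- r) b i ^+ 2).
Proof.
move=> a0 b0.
have := @hoelder_sum I r (fun i => a i ^+ 2) (fun i => b i ^+ 2) 2^-1
  (fun i => sqr_ge0 _) (fun i => sqr_ge0 _).
have -> : 1 - 2^-1 = 2^-1 :> R by field.
have q (x : R) : 0 <= x -> (x ^+ 2) `^ 2^-1 = x by move=> x0; rewrite powR12_sqrt ?sqr_ge0// sqrtr_sqr ger0_norm.
under eq_bigr do rewrite !q//.
move=> /(_ _)/wrap[]; first lra.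
move=> h; rewrite -ler_sqrt ?mulr_ge0 ?sumr_ge0// => [|i _|i _]; rewrite ?sqr_ge0//.
rewrite sqrtr_sqr ger0_norm ?sumr_ge0// => [|i _]; last by rewrite mulr_ge0.
apply: le_trans h _; rewrite sqrtrM ?sumr_ge0// => [|i _]; last exact: sqr_ge0.
by rewrite !powR12_sqrt// sumr_ge0// => i _; exact: sqr_ge0.
Qed.

(** The triangle inequality in [l^(1/k)] for the vectors with entries [b x y]^ k[, proved as usual
    by Hölder after one factor]S x[is split off]S x [^ k^-1]. *)
Lemma minkowski_sum (I J : finType) (b : I -> J -> R) (k : R) : 0 < k < 1 ->
  (forall x y, 0 <= b x y) ->
  (\sum_x (\sum_y b x y `^ k) `^ k^-1) `^ k <= \sum_y (\sum_x b x y) `^ k.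
Proof.
move=> kI b0; have /andP[k0 k1] := kI.
pose S x := \sum_y b x y `^ k; have S0 x : 0 <= S x by apply: sumr_ge0 => y _; exact: powR_ge0.
set T := \sum_x S x `^ k^-1; have T0 : 0 <= T by apply: sumr_ge0 => y _; exact: powR_ge0.
rewrite -/T; have [TE|Tn0] := eqVneq T 0.
  by rewrite TE powR0 ?gt_eqF//; apply: sumr_ge0 => y _; exact: powR_ge0.
have Tp : 0 < T by rewrite lt_def Tn0.
rewrite -(ler_pM2r (powR_gt0 (1 - k) Tp)) -powRD; last by rewrite Tn0 implybT.
rewrite addrC subrK powRr1//.
have {1}-> : T = \sum_y \sum_x b x y `^ k * (S x `^ k^-1) `^ (1 - k).
  rewrite exchange_big/=; apply: eq_bigr => x _; rewrite -mulr_suml -/(S x).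
  have [->|Sn0] := eqVneq (S x) 0; first by rewrite mul0r powR0// invr_eq0 gt_eqF.
  rewrite -{2}[S x]powRr1// -powRrM -powRD ?Sn0 ?implybT//; congr (_ `^ _).
  by field; rewrite gt_eqF.
rewrite mulr_suml; apply: ler_sum => y _.
apply: hoelder_sum => // x; exact: powR_ge0.
Qed.

(* With [k = m / (m + 1)] the left exponent [2k / (1 + k)] is [2m / (2m + 1)]: this is the
   step of Blei's inequality that doubles the number of indices. *)
Lemma two_block (I J : finType) (b : I -> J -> R) (k s : R) : 0 < k < 1 ->
  (forall x y, 0 <= b x y) -> s = k / (1 + k) ->
  \sum_x \sum_y b x y `^ (2 * s) <=
  (\sum_x (\sum_y b x y) `^ k) `^ (1 - s) * (\sum_y (\sum_x b x y) `^ k) `^ (1 - s).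
Proof.
move=> kI b0 sE; have /andP[k0 k1] := kI.
have k10 : 1 + k != 0 by rewrite gt_eqF// addr_gt0.
have s0 : 0 < s by rewrite sE divr_gt0// addr_gt0.
have s1 : s < 1 by rewrite sE ltr_pdivrMr ?addr_gt0// mul1r ltrDr.
have sk : k * (1 - s) = s by rewrite sE; field.
have sk' : s / k = 1 - s by rewrite sE; field; rewrite k10 gt_eqF.
have sI : 0 < s < 1 by rewrite s0.
(* As [2 * s = s + k * (1 - s)], Hölder over [y] interpolates between the exponents 1 and [k]. A
   second Hölder over [x] follows, and Minkowski exchanges the order of summation in one factor. *)
apply: (@le_trans _ _ (\sum_x (\sum_y b x y) `^ s * (\sum_y b x y `^ k) `^ (1 - s))).
  apply: ler_sum => x _.
  apply: le_trans (@hoelder_sum J (index_enum J) (b x) (fun y => b x y `^ k) s (b0 x)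
    (fun y => powR_ge0 _ _) sI).
  apply: ler_sum => y _; rewrite -powRrM sk.
  have [->|bn0] := eqVneq (b x y) 0; first by rewrite !powR0 ?gt_eqF ?mulr_gt0// mul0r.
  by rewrite -powRD ?bn0 ?implybT// mulr_natl mulr2n.
have -> : \sum_x (\sum_y b x y) `^ s * (\sum_y b x y `^ k) `^ (1 - s) =
    \sum_x ((\sum_y b x y `^ k) `^ k^-1) `^ s * ((\sum_y b x y) `^ k) `^ (1 - s).
  by apply: eq_bigr => x _; rewrite -!powRrM sk [k^-1 * s]mulrC sk' mulrC.
apply: le_trans (@hoelder_sum I (index_enum I) (fun x => (\sum_y b x y `^ k) `^ k^-1)
  (fun x => (\sum_y b x y) `^ k) s (fun x => powR_ge0 _ _) (fun y => powR_ge0 _ _) sI) _.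
rewrite [leRHS]mulrC; apply: ler_wpM2r; first exact: powR_ge0.
have sX (X : R) : X `^ s = (X `^ k) `^ (1 - s) by rewrite -powRrM sk.
rewrite [leLHS]sX.
apply: ge0_ler_powR.
- by rewrite subr_ge0 ltW.
- by rewrite nnegrE powR_ge0.
- by rewrite nnegrE sumr_ge0// => y _; exact: powR_ge0.
- exact: minkowski_sum.
Qed.

End FiniteInequalities.

(** * Hypercontractive systems and their products *)

Section Hypercontractivity.
Variable R : realType.
Local Notation C := R[i].

Definition mean (W : finType) (F : W -> R) : R := #|W|%:R^-1 * \sum_w F w.

Lemma mean_ge0 (W : finType) (F : W -> R) : (forall w, 0 <= F w) -> 0 <= mean F.
Proof. by move=> F0; rewrite mulr_ge0 ?sumr_ge0. Qed.

Lemma eq_mean (W : finType) (F G : W -> R) : F =1 G -> mean F = mean G.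
Proof. by move=> FG; rewrite /mean; congr (_ * _); apply: eq_bigr => w _. Qed.

Lemma le_mean (W : finType) (F G : W -> R) : (forall w, F w <= G w) -> mean F <= mean G.
Proof. by move=> FG; rewrite ler_wpM2l// ler_sum. Qed.

Lemma mean_sum (W I : finType) (F : I -> W -> R) :
  mean (fun w => \sum_i F i w) = \sum_i mean (F i).
Proof. by rewrite /mean exchange_big/= mulr_sumr. Qed.

Lemma mean_prod (W W' : finType) (F : W * W' -> R) :
  mean F = mean (fun w' => mean (fun w => F (w, w'))).
Proof.
rewrite /mean card_prod natrM invfM [in RHS]mulr_sumr mulr_sumr.
under [RHS]eq_bigr do rewrite mulr_sumr mulr_sumr.
rewrite exchange_big pair_big/=; apply: eq_bigr => -[w w'] _ /=.
by rewrite mulrA [X in X * _ = _]mulrC.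
Qed.

Lemma mean_cauchy (W : finType) (a b : W -> R) :
  (forall i, 0 <= a i) -> (forall i, 0 <= b i) ->
  mean (fun w => a w * b w) ^+ 2 <= mean (fun w => a w ^+ 2) * mean (fun w => b w ^+ 2).
Proof.
move=> a0 b0; rewrite /mean; set c := _^-1.
have -> (x y : R) : c * x * (c * y) = c ^+ 2 * (x * y) by ring.
by rewrite exprMn; apply: ler_wpM2l; [exact: sqr_ge0|exact: cauchy_sum].
Qed.

Lemma mean_le (W : finType) (F : W -> R) (B : R) : 0 <= B -> (forall w, F w <= B) -> mean F <= B.
Proof.
move=> B0 FB; rewrite /mean; have [->|W0] := posnP #|W|; first by rewrite invr0 mul0r.
rewrite ler_pdivrMl ?ltr0n//; apply: le_trans (ler_sum _ (fun w _ => FB w)) _.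
by rewrite sumr_const -[leLHS]mulr_natl.
Qed.

(** The system is orthonormal in [L^2], and on its span the [L^4] norm is at most [K ^ (1/4)] times
    the [L^2] norm. Fourth moments can be expanded algebraically and behave well under products. *)
Definition hyper (W Y : finType) (x : W -> Y -> C) (K : R) := forall c : Y -> C,
  mean (fun w => normc (\sum_y c y * x w y) ^+ 2) = \sum_y normc (c y) ^+ 2 /\
  mean (fun w => (normc (\sum_y c y * x w y) ^+ 2) ^+ 2) <= K * (\sum_y normc (c y) ^+ 2) ^+ 2.

Lemma mean_hoelder (W : finType) (f g : W -> R) (s : R) : (forall i, 0 <= f i) ->
  (forall i, 0 <= g i) -> 0 < s < 1 ->
  mean (fun w => f w `^ s * g w `^ (1 - s)) <= mean f `^ s * mean g `^ (1 - s).
Proof.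
move=> f0 g0 sI; rewrite /mean; set c := _^-1; have c0 : 0 <= c by rewrite invr_ge0.
have [->|cn0] := eqVneq c 0; first by rewrite !mul0r mulr_ge0 ?powR_ge0.
have cE : c = c `^ s * c `^ (1 - s) by rewrite -powRD ?cn0 ?implybT// addrC subrK powRr1.
rewrite !powRM ?sumr_ge0// mulrACA -cE ler_wpM2l//.
exact: hoelder_sum.
Qed.

(* Log-convexity of [p |-> ||F||_p^p] between [2k], [2] and [4]. *)
Lemma mean_low (W : finType) (u : W -> R) (K k V : R) : 0 < k < 1 -> 0 <= K ->
  (forall w, 0 <= u w) -> mean u = V -> mean (fun w => u w ^+ 2) <= K * V ^+ 2 ->
  V `^ k <= K `^ (1 - k) * mean (fun w => u w `^ k).
Proof.
move=> /andP[k0 k1] K0 u0 uV uK.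
have m0 : 0 <= mean (fun w => u w `^ k) by apply: mean_ge0 => w; exact: powR_ge0.
have V0 : 0 <= V by rewrite -uV; exact: mean_ge0.
have [VE|Vn0] := eqVneq V 0.
  by rewrite VE powR0 ?gt_eqF// mulr_ge0 ?powR_ge0.
(* [s] solves [k * s + 2 * (1 - s) = 1], which places the first moment between those of order [k]
   and 2. *)
pose s := (2 - k)^-1; have k2 : 0 < 2 - k by lra.
have s0 : 0 < s by rewrite invr_gt0.
have s1 : s < 1 by rewrite invf_lt1; lra.
have sI : 0 < s < 1 by rewrite s0.
have h := @mean_hoelder W (fun w => u w `^ k) (fun w => u w ^+ 2) s
  (fun w => powR_ge0 _ _) (fun w => sqr_ge0 _) sI.
have e1 : k * s + 2 * (1 - s) = 1 by rewrite /s; field; rewrite gt_eqF.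
have hV : V <= mean (fun w => u w `^ k) `^ s * (K * V ^+ 2) `^ (1 - s).
  rewrite -{1}uV.
  have -> : mean u = mean (fun w => (u w `^ k) `^ s * (u w ^+ 2) `^ (1 - s)).
    apply: eq_mean => w; have [->|un0] := eqVneq (u w) 0.
      by rewrite powR0 ?gt_eqF// powR0 ?gt_eqF// mul0r.
    rewrite -powRrM -powR_mulrn// -powRrM -powRD ?un0 ?implybT//.
    by rewrite e1 powRr1.
  apply: le_trans h _; apply: ler_wpM2l; first exact: powR_ge0.
  apply: ge0_ler_powR => //; rewrite ?nnegrE ?subr_ge0 ?(ltW s1)//.
    by apply: mean_ge0 => w; exact: sqr_ge0.
  by rewrite mulr_ge0// sqr_ge0.
have Vp : 0 < V by rewrite lt_def Vn0.
have : V `^ (2 * s - 1) <= mean (fun w => u w `^ k) `^ s * K `^ (1 - s).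
  rewrite -(ler_pM2r (powR_gt0 (2 * (1 - s)) Vp)) -powRD ?Vn0 ?implybT//.
  rewrite (_ : 2 * s - 1 + 2 * (1 - s) = 1); last by ring.
  rewrite powRr1//; apply: le_trans hV _; rewrite powRM ?sqr_ge0//.
  by rewrite -powR_mulrn// -powRrM mulrA.
have r2 : 0 <= 2 * s - 1.
  by rewrite subr_ge0 /s ler_pdivlMr// mul1r; lra.
move=> /(@ge0_ler_powR _ s^-1); rewrite invr_ge0 (ltW s0) !nnegrE powR_ge0 mulr_ge0 ?powR_ge0//.
move=> /(_ isT isT isT); rewrite powRM ?powR_ge0// -!powRrM mulfV ?gt_eqF// powRr1//.
rewrite mulrC (_ : (1 - s) / s = 1 - k); last by rewrite /s; field; rewrite gt_eqF.
rewrite (_ : s^-1 * (2 * s - 1) = k); last by rewrite /s; field; rewrite gt_eqF.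
by rewrite mulrC.
Qed.

Lemma hyper_low (W Y : finType) (x : W -> Y -> C) (K k : R) (c : Y -> C) :
  hyper x K -> 0 < k < 1 -> 0 <= K ->
  (\sum_y normc (c y) ^+ 2) `^ k <=
    K `^ (1 - k) * mean (fun w => (normc (\sum_y c y * x w y) ^+ 2) `^ k).
Proof.
move=> xK kI K0; have [h1 h2] := xK c.
by apply: mean_low => // w; exact: sqr_ge0.
Qed.

(** For fixed [w'] the bound for [x] applies with coefficients [g y w']. The resulting square is
    expanded, and Cauchy-Schwarz in [w'] separates its products into fourth moments for [x']. *)
Lemma hyper_prod (W Y W' Y' : finType) (x : W -> Y -> C) (x' : W' -> Y' -> C) (K K' : R) :
  0 <= K -> 0 <= K' -> hyper x K -> hyper x' K' ->
  hyper (fun w : W * W' => fun y : Y * Y' => x w.1 y.1 * x' w.2 y.2) (K * K').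
Proof.
move=> K0 K'0 xK xK' c.
pose g y w' := \sum_y' c (y, y') * x' w' y'.
have gE w w' : \sum_y c y * (x w y.1 * x' w' y.2) = \sum_y g y w' * x w y.
  rewrite [RHS](eq_bigr (fun y => \sum_y' c (y, y') * (x w y * x' w' y'))).
    by rewrite pair_big/=; apply: eq_bigr => -[].
  by move=> y _; rewrite /g mulr_suml; apply: eq_bigr => y' _; ring.
pose S y := \sum_y' normc (c (y, y')) ^+ 2.
have S0 y : 0 <= S y by apply: sumr_ge0 => y' _; exact: sqr_ge0.
have SE : \sum_y normc (c y) ^+ 2 = \sum_y S y by rewrite pair_big/=; apply: eq_bigr => -[].
rewrite !mean_prod SE; split.
  rewrite (eq_mean (G := fun w' => \sum_y normc (g y w') ^+ 2)); last first.
    move=> w'; rewrite -(xK (g^~ w')).1; apply: eq_mean => w /=; by rewrite gE.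
  by rewrite mean_sum; apply: eq_bigr => y _; rewrite (xK' (fun y' => c (y, y'))).1.
apply: (@le_trans _ _ (mean (fun w' => K * (\sum_y normc (g y w') ^+ 2) ^+ 2))).
  apply: le_mean => w'; apply: le_trans (xK (g^~ w')).2.
  by rewrite le_eqVlt; apply/orP; left; apply/eqP; apply: eq_mean => w /=; rewrite gE.
have -> : mean (fun w' => K * (\sum_y normc (g y w') ^+ 2) ^+ 2) =
    K * \sum_y \sum_z mean (fun w' => normc (g y w') ^+ 2 * normc (g z w') ^+ 2).
  rewrite {1}/mean -mulr_sumr mulrCA -/(mean _); congr (_ * _).
  under eq_bigr do rewrite -mean_sum; rewrite -mean_sum; apply: eq_mean => w'.
  by rewrite expr2 mulr_suml; apply: eq_bigr => y _; rewrite mulr_sumr.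
rewrite -mulrA ler_wpM2l// expr2 mulr_suml mulr_sumr; apply: ler_sum => y _.
rewrite mulr_sumr mulr_sumr; apply: ler_sum => z _.
have p0 : 0 <= mean (fun w' => normc (g y w') ^+ 2 * normc (g z w') ^+ 2).
  by apply: mean_ge0 => w; rewrite mulr_ge0// sqr_ge0.
rewrite -ler_sqr ?nnegrE ?p0// ?(mulr_ge0 K'0 (mulr_ge0 (S0 y) (S0 z)))//.
apply: le_trans (mean_cauchy (fun w => sqr_ge0 _) (fun w => sqr_ge0 _)) _.
have -> : (K' * (S y * S z)) ^+ 2 = (K' * S y ^+ 2) * (K' * S z ^+ 2) by ring.
apply: ler_pM; try (by apply: mean_ge0 => w; exact: sqr_ge0).
  exact: (xK' (fun y' => c (y, y'))).2.
exact: (xK' (fun y' => c (z, y'))).2.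
Qed.

End Hypercontractivity.

(** * Moments of polynomials on roots of unity *)

Section Grid.
Variables (R : realType) (V : finType) (M : nat).
Hypothesis M0 : (0 < M)%N.
Local Notation C := R[i].
Local Notation W := {ffun V -> 'I_M}.

(** Roots of unity stand for the torus: monomials with exponents below [M] are exactly orthogonal on
    them, so a fine enough grid gives the exact second and fourth moments. *)
Definition gridpt (j : 'I_M) : C := cis (j%:R / M%:R).
Definition gmono (u : W) D (a : {ffun V -> 'I_D}) : C := \prod_v gridpt (u v) ^+ a v.

Lemma gridpt_orth (a b : nat) : (a < M)%N -> (b < M)%N ->
  \sum_j gridpt j ^+ a * ((gridpt j ^+ b)^*)%C = (M * (a == b))%:R.
Proof.
wlog ab : a b / (b <= a)%N.
  move=> h aM bM; case: (leqP b a) => [/h|/ltnW/h]; first exact.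
  move=> /(_ bM aM) /(congr1 (@conjc R)); rewrite rmorph_sum conjc_nat eq_sym => <-.
  by apply: eq_bigr => j _; rewrite rmorphM/= conjcK mulrC.
move=> aM bM.
have E j : gridpt j ^+ a * ((gridpt j ^+ b)^*)%C = cis ((a - b)%:R / M%:R) ^+ j.
  rewrite /gridpt -!cisMn conj_cis -cisN -cisD; congr cis; rewrite natrB//; ring.
under eq_bigr do rewrite E.
have [->|nab] := eqVneq a b.
  by rewrite subnn mul0r cis0 muln1; under eq_bigr do rewrite expr1n; rewrite sumr_const card_ord.
rewrite muln0 sum_cis// subn_gt0 ltn_neqAle eq_sym nab ab /=.
exact: leq_ltn_trans (leq_subr _ _) aM.
Qed.

Lemma gmono_orth D (a b : {ffun V -> 'I_D}) : (D <= M)%N ->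
  \sum_u gmono u a * ((gmono u b)^*)%C = (#|W| * (a == b))%:R.
Proof.
move=> DM.
have -> : \sum_u gmono u a * ((gmono u b)^*)%C =
    \sum_(u : W) \prod_v (gridpt (u v) ^+ a v * ((gridpt (u v) ^+ b v)^*)%C).
  by apply: eq_bigr => u _; rewrite /gmono rmorph_prod -big_split.
rewrite -(bigA_distr_bigA (fun v j => gridpt j ^+ a v * ((gridpt j ^+ b v)^*)%C)).
under eq_bigr do rewrite gridpt_orth ?(leq_trans (ltn_ord _))//.
rewrite -natr_prod; congr _%:R.
rewrite big_split/= prod_nat_const card_ffun card_ord; congr (_ * _)%N.
have [->|nab] := eqVneq a b; first by rewrite big1// => v _; rewrite eqxx.
have [v av] : exists v, a v != b v.
  by apply/existsP; rewrite -negb_forall; apply: contra nab => /forallP h; apply/eqP/ffunP => v; apply/eqP.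
by rewrite (bigD1 v)//= -val_eqE in av *; rewrite (negbTE av).
Qed.

Lemma card_W_gt0 : (0 < #|{ffun V -> 'I_M}|)%N.
Proof. by rewrite card_ffun card_ord expn_gt0 M0. Qed.

Lemma grid_L2 D (c : {ffun V -> 'I_D} -> C) : (D <= M)%N ->
  mean (fun u => normc (\sum_a c a * gmono u a) ^+ 2) = \sum_a normc (c a) ^+ 2.
Proof.
move=> DM; apply: (@complexI R); rewrite /mean rmorphM fmorphV rmorph_nat rmorph_sum/=.
under eq_bigr do rewrite -mul_conjc rmorph_sum mulr_suml.
rewrite exchange_big/= rmorph_sum.
have W0 : #|W|%:R != 0 :> C by rewrite pnatr_eq0 -lt0n card_W_gt0.
apply: (mulfI W0); rewrite mulVKf// mulr_sumr; apply: eq_bigr => a _.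
transitivity (\sum_b (c a * ((c b)^*)%C) * \sum_u gmono u a * ((gmono u b)^*)%C).
  under eq_bigr do rewrite mulr_sumr; rewrite exchange_big/=; apply: eq_bigr => b _.
  by rewrite mulr_sumr; apply: eq_bigr => u _; rewrite rmorphM/=; ring.
rewrite (bigD1 a)//= gmono_orth// eqxx muln1 big1 ?addr0; last first.
  by move=> b ba; rewrite gmono_orth// eq_sym (negbTE ba) muln0 mulr0.
by rewrite mul_conjc mulrC.
Qed.

Definition mult_weight D (a : {ffun V -> 'I_D}) : nat := \prod_v (a v).+1.

(** The fourth moment is the sum of the squared coefficients of the squared polynomial.
    Cauchy-Schwarz over the decompositions [g = a + b] costs their number, at most the product of
    the [(g v).+1], which is at most [mult_weight a * mult_weight b]. *)
Lemma grid_L4 D (c : {ffun V -> 'I_D} -> C) : (0 < D)%N -> (D + D <= M)%N ->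
  mean (fun u => (normc (\sum_a c a * gmono u a) ^+ 2) ^+ 2) <=
    (\sum_a (mult_weight a)%:R * normc (c a) ^+ 2) ^+ 2.
Proof.
move=> D0 DM.
pose A := {ffun V -> 'I_D}; pose G := {ffun V -> 'I_(D + D)}.
have lt_add (i j : 'I_D) : (i + j < D + D)%N by rewrite -addSn leq_add// ltnW.
pose add (p : A * A) : G := [ffun v => Ordinal (lt_add (p.1 v) (p.2 v))].
pose d (g : G) := \sum_(p : A * A | add p == g) c p.1 * c p.2.
have sq u : (\sum_a c a * gmono u a) ^+ 2 = \sum_g d g * gmono u g.
  rewrite expr2 mulr_suml; transitivity (\sum_(p : A * A) c p.1 * c p.2 * gmono u (add p)).
    rewrite -(pair_bigA _ (fun a b => c a * c b * gmono u (add (a, b))))/=.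
    apply: eq_bigr => a _; rewrite mulr_sumr; apply: eq_bigr => b _.
    rewrite mulrACA; congr (_ * _); rewrite /gmono -big_split/=.
    by apply: eq_bigr => v _; rewrite ffunE /= exprD.
  rewrite (partition_big add xpredT)//=; apply: eq_bigr => g _.
  by rewrite mulr_suml; apply: eq_bigr => p /eqP ->.
have -> : mean (fun u => (normc (\sum_a c a * gmono u a) ^+ 2) ^+ 2) = \sum_g normc (d g) ^+ 2.
  by rewrite -grid_L2//; apply: eq_mean => u; rewrite -normcX sq.
pose q (p : A * A) := normc (c p.1) ^+ 2 * normc (c p.2) ^+ 2.
apply: (@le_trans _ _ (\sum_g (#|[pred p | add p == g]|)%:R * \sum_(p | add p == g) q p)).
  apply: ler_sum => g _.
  apply: (@le_trans _ _ ((\sum_(p | add p == g) normc (c p.1 * c p.2)) ^+ 2)).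
    by rewrite ler_sqr ?nnegrE ?normc_ge0 ?sumr_ge0// => [|p _]; [exact: le_normc_sum|exact: normc_ge0].
  rewrite -big_filter; have := @cauchy_sum R _ [seq p <- index_enum _ | add p == g]
    (fun=> 1) (fun p => normc (c p.1 * c p.2)) (fun=> ler01) (fun p => normc_ge0 _).
  rewrite (eq_bigr (fun p => normc (c p.1 * c p.2))); last by move=> p _; rewrite mul1r.
  move=> h; apply: le_trans h _.
  rewrite !big_filter (eq_bigr (fun=> 1)); last by move=> p _; rewrite expr1n.
  rewrite sumr_const le_eqVlt; apply/orP; left; apply/eqP; congr (_ * _).
  by apply: eq_bigr => p _; rewrite /q normcM exprMn.
have -> : (\sum_a (mult_weight a)%:R * normc (c a) ^+ 2) ^+ 2 =
    \sum_(p : A * A) (mult_weight p.1 * mult_weight p.2)%:R * q p.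
  rewrite expr2 mulr_suml -(pair_bigA _ (fun a b => (mult_weight a * mult_weight b)%:R * q (a, b)))/=.
  by apply: eq_bigr => a _; rewrite mulr_sumr; apply: eq_bigr => b _; rewrite natrM mulrACA.
rewrite [leRHS](partition_big add xpredT)//=; apply: ler_sum => g _.
rewrite mulr_sumr; apply: ler_sum => p /eqP pg.
apply: ler_wpM2r; first by rewrite mulr_ge0// sqr_ge0.
rewrite ler_nat.
apply: (@leq_trans (\prod_v (g v).+1)%N); last first.
  rewrite /mult_weight -big_split/=; apply: leq_prod => v _; rewrite -pg ffunE /=.
  by rewrite mulSn mulnS addSn addnCA addnA leq_addr.
pose F v : pred 'I_D := fun i => (i <= g v)%N.
apply: (@leq_trans #|family F|).
  have inj : {in [pred p | add p == g] &, injective (fun p : A * A => p.1)}.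
    move=> [a b] [a' b'] /eqP h /eqP h' /= aa; rewrite {}aa in h *; congr (_, _).
    apply/ffunP => v; apply: val_inj => /=.
    by have := congr1 (fun g : G => val (g v)) (etrans h (esym h')); rewrite !ffunE /= => /addnI.
  rewrite -(card_in_image inj); apply: subset_leq_card; apply/fintype.subsetP => a; case/mapP => p'; rewrite mem_enum => /eqP pE ->.
  by apply/familyP => v; rewrite unfold_in -pE ffunE /= leq_addr.
rewrite card_family foldrE big_map big_enum/=; apply: leq_prod => v _.
have inj : {in F v &, injective (fun i : 'I_D => inord i : 'I_(g v).+1)}.
  move=> i j ii jj /(congr1 val); rewrite /= !inordK ?ltnS//.
  exact: val_inj.
by rewrite -(card_in_image inj) (leq_trans (max_card _))// card_ord.
Qed.

Lemma mult_weight_le D (a : {ffun V -> 'I_D}) : (mult_weight a <= 2 ^ \sum_v a v)%N.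
Proof.
rewrite expn_sum /mult_weight; apply: leq_prod => v _.
exact: ltn_expl.
Qed.

(** In degree at most [m] the weights are at most [2 ^ m]; this is the origin of the factor 4 per
    degree. *)
Lemma grid_hyper D m (c : {ffun V -> 'I_D} -> C) : (0 < D)%N -> (D + D <= M)%N ->
  (forall a : {ffun V -> 'I_D}, (m < \sum_v a v)%N -> c a = 0) ->
  mean (fun u => (normc (\sum_a c a * gmono u a) ^+ 2) ^+ 2) <=
    4 ^+ m * (\sum_a normc (c a) ^+ 2) ^+ 2.
Proof.
move=> D0 DM cm; apply: le_trans (grid_L4 _ D0 DM) _.
have -> : 4 ^+ m = (2 ^+ m) ^+ 2 :> R by rewrite exprAC; congr (_ ^+ m); ring.
rewrite -exprMn ler_sqr ?nnegrE ?mulr_ge0 ?sumr_ge0// => [|a _|a _]; last 2 first.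
- by rewrite mulr_ge0// sqr_ge0.
- exact: sqr_ge0.
rewrite mulr_sumr; apply: ler_sum => a _.
have [/cm ->|am] := ltnP m (\sum_v a v); first by rewrite normc0 expr0n /= !mulr0.
rewrite ler_wpM2r ?sqr_ge0// -natrX ler_nat.
by apply: leq_trans (mult_weight_le a) _; rewrite leq_exp2l.
Qed.

End Grid.

(** * The Bohnenblust-Hille inequality *)

Section BohnenblustHille.
Variables (R : realType) (n : nat).
Local Notation C := R[i].

(** Order 4 because linear forms have exponents below [D = 2] and fourth moments on the grid require
    [D + D <= M]. *)
Definition char4 (u : {ffun 'I_n -> 'I_4}) (i : 'I_n) : C := gridpt R (u i).

Lemma normc_gridpt M (j : 'I_M) : normc (gridpt R j) = 1.
Proof. exact: normc_cis. Qed.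

Lemma normc_char4 u i : normc (char4 u i) = 1.
Proof. exact: normc_gridpt. Qed.

Lemma char4_hyper : hyper char4 4.
Proof.
move=> c.
pose e (i : 'I_n) : {ffun 'I_n -> 'I_2} := [ffun j => inord (j == i)].
have eE i j : e i j = (j == i) :> nat by rewrite ffunE inordK//; case: eqP.
have e_inj : injective e.
  move=> i j /ffunP /(_ i) /(congr1 val) /=; rewrite !eE eqxx.
  by case: eqP.
pose c' (a : {ffun 'I_n -> 'I_2}) := \sum_(i | e i == a) c i.
have c'E i : c' (e i) = c i.
  by rewrite /c' (big_pred1 i)// => i'; rewrite /= (inj_eq e_inj).
have re (T : nmodType) (F : {ffun 'I_n -> 'I_2} -> T) : (forall a, c' a = 0 -> F a = 0) ->
    \sum_a F a = \sum_i F (e i).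
  move=> F0; rewrite (bigID (fun a => a \in [set e i | i in [set: 'I_n]]%SET))/= [X in _ + X]big1 ?addr0.
    rewrite big_imset/=; first by apply: eq_bigl => i; rewrite inE.
    by move=> i i' _ _ /e_inj.
  move=> a /imsetP ha; apply: F0; rewrite /c' big1// => i /eqP ea.
  by case: ha; exists i; rewrite ?inE.
have gE u i : gmono R u (e i) = char4 u i.
  rewrite /gmono (bigD1 i)//= eE eqxx expr1 big1 ?mulr1// => j /negbTE ji.
  by rewrite eE ji expr0.
have s u : \sum_a c' a * gmono R u a = \sum_i c i * char4 u i.
  rewrite re => [|a ->]; last by rewrite mul0r.
  by apply: eq_bigr => i _; rewrite gE c'E.
have -> : \sum_y normc (c y) ^+ 2 = \sum_a normc (c' a) ^+ 2.
  rewrite re => [|a ->]; last by rewrite normc0 expr0n.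
  by apply: eq_bigr => i _; rewrite c'E.
split.
  by rewrite -(@grid_L2 R _ 4)//; apply: eq_mean => u; rewrite s.
have := @grid_hyper R 'I_n 4 isT 2 1 c' isT isT; rewrite expr1 => h.
apply: le_trans (h _).
  by rewrite le_eqVlt; apply/orP; left; apply/eqP; apply: eq_mean => u; rewrite s.
move=> a a1; rewrite /c' big_pred0// => i; apply/negbTE/eqP => ea.
move: a1; rewrite -ea (bigD1 i)//= eE eqxx big1// => j /negbTE ji.
by rewrite eE ji.
Qed.

(* Words of length [2 ^ j] as balanced binary trees, so that Bohnenblust-Hille is an
   induction that doubles the degree. *)
Fixpoint word_index (j : nat) : finType := if j is j'.+1 then (word_index j' * word_index j')%type else 'I_n.
Fixpoint word_signs (j : nat) : finType :=
  if j is j'.+1 then (word_signs j' * word_signs j')%type else {ffun 'I_n -> 'I_4}.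
Fixpoint sign_char (j : nat) : word_signs j -> word_index j -> C :=
  if j is j'.+1 then fun u i => sign_char u.1 i.1 * sign_char u.2 i.2 else char4.

Definition hyper_const (j : nat) : R := 4 ^+ (2 ^ j).

Lemma hyper_const_ge0 j : 0 <= hyper_const j. Proof. by rewrite exprn_ge0. Qed.

Lemma sign_char_hyper j : hyper (@sign_char j) (hyper_const j).
Proof.
elim: j => [|j IH]; first exact: char4_hyper.
rewrite /hyper_const expnS mul2n -addnn exprD.
exact: (hyper_prod (hyper_const_ge0 j) (hyper_const_ge0 j) IH IH).
Qed.

(** Half of the Bohnenblust-Hille exponent [2k / (k + 1)] for [k = 2 ^ j], because it is applied to
    squared moduli. *)
Definition bh_exp (j : nat) : R := (2 ^ j)%:R / (2 ^ j).+1%:R.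

Lemma bh_exp_in j : 0 < bh_exp j < 1.
Proof.
rewrite /bh_exp divr_gt0 ?ltr0n ?expn_gt0//=.
by rewrite ltr_pdivrMr ?ltr0n// mul1r ltr_nat.
Qed.

Lemma bh_expS j : bh_exp j.+1 = 2 * (bh_exp j / (1 + bh_exp j)).
Proof.
rewrite /bh_exp expnS -[(2 * _).+1]addn1 natrD natrM -[(2 ^ j).+1]addn1 natrD.
have : 0 < (2 ^ j)%:R :> R by rewrite ltr0n expn_gt0.
move: (2 ^ j)%:R => x x0; field.
by apply/andP; split; rewrite gt_eqF//; lra.
Qed.

(** The initial 2 comes from treating real and imaginary parts separately; the recursion is the cost
    of one doubling. *)
Fixpoint bh_const (j : nat) : R :=
  if j is j'.+1 then ((hyper_const j' `^ (1 - bh_exp j') * bh_const j') `^ (1 - bh_exp j' / (1 + bh_exp j'))) ^+ 2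
  else 2.

Lemma bh_const_ge0 j : 0 <= bh_const j.
Proof. by case: j => [|j]//=; exact: sqr_ge0. Qed.

Lemma bohnenblust_hille0 (a : 'I_n -> C) (B : R) :
  (forall u, normc (\sum_i a i * char4 u i) <= B) ->
  \sum_i normc (a i) <= 2 * B.
Proof.
move=> aB.
(* Number 2 of the fourth roots of unity is -1, so every choice of signs is available. *)
pose sg (P : 'I_n -> bool) : {ffun 'I_n -> 'I_4} := [ffun i => if P i then inord 2 else inord 0].
have sgE P i : char4 (sg P) i = (-1) ^+ P i.
  rewrite /char4 /sg /gridpt ffunE; case: (P i).
    rewrite inordK// expr1 (_ : 2 / 4 = 2^-1 :> R); last by field.
    exact: cis_half.
  by rewrite inordK// mul0r cis0.
have key (f : C -> R) : (forall x y, f (x + y) = f x + f y) -> f 0 = 0 -> (forall x, f (- x) = - f x) ->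
   (forall x, f x <= normc x) -> \sum_i `|f (a i)| <= B.
  move=> fD f0 fN fle; apply: le_trans (aB (sg (fun i => f (a i) < 0))); apply: le_trans (fle _).
  rewrite (big_morph f fD f0) le_eqVlt; apply/orP; left; apply/eqP; apply: eq_bigr => i _.
  rewrite sgE; case: ltrP => r0 /=; first by rewrite expr1 mulrN1 fN ltr0_norm.
  by rewrite expr0 mulr1 ger0_norm.
have kR : \sum_i `|complex.Re (a i)| <= B.
  apply: (key (@complex.Re R)) => [[? ?] [? ?]||[? ?]|x] //.
  exact: le_trans (ler_norm _) (norm_Re_le x).
have kI : \sum_i `|complex.Im (a i)| <= B.
  apply: (key (@complex.Im R)) => [[? ?] [? ?]||[? ?]|x] //.
  exact: le_trans (ler_norm _) (norm_Im_le x).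
rewrite mulr_natl mulr2n; apply: le_trans (lerD kR kI).
by rewrite -big_split/=; apply: ler_sum => i _; exact: normc_le_ReIm.
Qed.

(** Doubling: for an index [(x, y)] the [l^2] norm over [y] is replaced, by [hyper_low], with a mean
    over characters of linear forms in the entries; for each character the induction hypothesis
    applies to the sum over [x]. The same holds with the roles exchanged, and [two_block] combines
    the two mixed norms. *)
Lemma bohnenblust_hille j (a : word_index j -> C) (B : R) : 0 <= B ->
  (forall u, normc (\sum_i a i * sign_char u i) <= B) ->
  \sum_i (normc (a i) ^+ 2) `^ bh_exp j <= bh_const j * (B ^+ 2) `^ bh_exp j.
Proof.
move=> B0; elim: j a => [|j IH] a aB.
  have k0 : bh_exp 0 = 2^-1 by rewrite /bh_exp expn0 div1r.
  rewrite k0 powR12_sqrt ?sqr_ge0// sqrtr_sqr ger0_norm//.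
  rewrite (eq_bigr (fun i => normc (a i))); first exact: bohnenblust_hille0.
  by move=> i _; rewrite powR12_sqrt ?sqr_ge0// sqrtr_sqr ger0_norm ?normc_ge0.
have /andP[k0 k1] := bh_exp_in j; set k := bh_exp j in IH k0 k1 *.
pose s := k / (1 + k); pose K := hyper_const j `^ (1 - k) * bh_const j.
have K0 : 0 <= K by rewrite mulr_ge0 ?powR_ge0 ?bh_const_ge0.
have half (a' : word_index j -> word_index j -> C) : (forall u u', normc (\sum_x \sum_y a' x y * (sign_char u x * sign_char u' y)) <= B) ->
    \sum_x (\sum_y normc (a' x y) ^+ 2) `^ k <= K * (B ^+ 2) `^ k.
  move=> aB'; apply: (@le_trans _ _ (\sum_x hyper_const j `^ (1 - k) *
      mean (fun u => (normc (\sum_y a' x y * sign_char u y) ^+ 2) `^ k))).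
    apply: ler_sum => x _.
    exact: (hyper_low (a' x) (@sign_char_hyper j) (bh_exp_in j) (hyper_const_ge0 j)).
  rewrite -mulr_sumr -mean_sum /K -mulrA ler_wpM2l ?powR_ge0//.
  apply: mean_le => [|u']; first by rewrite mulr_ge0 ?bh_const_ge0 ?powR_ge0.
  apply: IH => u; apply: le_trans (aB' u u'); rewrite le_eqVlt; apply/orP; left; apply/eqP.
  congr normc; apply: eq_bigr => x _; rewrite mulr_suml; apply: eq_bigr => y _; ring.
have h1 := half (fun x y => a (x, y)); have h2 := half (fun y x => a (x, y)).
rewrite (_ : \sum_i _ = \sum_x \sum_y (normc (a (x, y)) ^+ 2) `^ (2 * s)); last first.
  by rewrite pair_big/= bh_expS; apply: eq_bigr => -[].
apply: le_trans (@two_block R _ _ (fun x y => normc (a (x, y)) ^+ 2) k s _ (fun x y => sqr_ge0 _) _) _ => //.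
  exact: bh_exp_in.
have s1 : 0 <= 1 - s.
  by rewrite subr_ge0 /s ler_pdivrMr ?addr_gt0// mul1r lerDr.
rewrite /= -/k -/s -/K.
have -> : (K `^ (1 - s)) ^+ 2 * (B ^+ 2) `^ bh_exp j.+1 = (K * (B ^+ 2) `^ k) `^ (1 - s) * (K * (B ^+ 2) `^ k) `^ (1 - s).
  rewrite -expr2 powRM ?powR_ge0// exprMn -[in RHS]powRrM -[((B ^+ 2) `^ _) ^+ 2]powR_mulrn ?powR_ge0//.
  rewrite -powRrM bh_expS; congr (_ * _ `^ _); rewrite -/k /s; field; rewrite gt_eqF//; lra.
apply: ler_pM; try exact: powR_ge0.
  apply: ge0_ler_powR; rewrite ?nnegrE ?mulr_ge0 ?powR_ge0 ?bh_const_ge0//.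
    by rewrite sumr_ge0// => x _; exact: powR_ge0.
  apply: h1 => u u'; apply: le_trans (aB (u, u')); rewrite le_eqVlt; apply/orP; left; apply/eqP.
  by congr normc; rewrite pair_big/=; apply: eq_bigr => -[].
apply: ge0_ler_powR; rewrite ?nnegrE ?mulr_ge0 ?powR_ge0 ?bh_const_ge0//.
  by rewrite sumr_ge0// => x _; exact: powR_ge0.
apply: h2 => u u'; apply: le_trans (aB (u', u)); rewrite le_eqVlt; apply/orP; left; apply/eqP.
congr normc; rewrite exchange_big pair_big/=; apply: eq_bigr => -[x y] _ /=; ring.
Qed.

End BohnenblustHille.

(** * Weighted sums of coefficients *)

Section Polynomials.
Variables (R : realType) (n d : nat).
Local Notation C := R[i].
Local Notation A := {ffun 'I_n -> 'I_d.+1}.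
Local Notation ex a := (fun i => nat_of_ord (a i)).
Implicit Types (c : A -> C) (v w : 'I_n -> C).

Definition peval c v : C := \sum_(a : A) c a * mono v (ex a).

Definition homogeneous (m : nat) c := forall a : A, deg a != m -> c a = 0.

(** Coefficients of a partial derivative; beyond the guard [addi b i] would overflow. *)
Definition pderiv (i : 'I_n) c : A -> C :=
  fun b => if (deg b < d)%N then (b i).+1%:R * c (addi b i) else 0.

Lemma pderiv_homog m i c : homogeneous m.+1 c -> homogeneous m (pderiv i c).
Proof.
move=> ch a am; rewrite /pderiv; case: ifP => // ad.
by rewrite ch ?mulr0// deg_addi// eqSS.
Qed.

Lemma pevalZ m c v (t : C) : homogeneous m c -> peval c (fun i => t * v i) = t ^+ m * peval c v.
Proof.
move=> ch; rewrite /peval mulr_sumr; apply: eq_bigr => a _.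
have [<-|/ch ->] := eqVneq (deg a) m; last by rewrite !mul0r mulr0.
by rewrite mulrCA /mono; under eq_bigr do rewrite exprMn; rewrite big_split/= -expr_sum.
Qed.

Lemma deriv_bigprod (r : seq 'I_n) (F : 'I_n -> {poly C}) : uniq r ->
  (\prod_(i <- r) F i)^`() = \sum_(i <- r) (F i)^`() * \prod_(j <- r | j != i) F j.
Proof.
elim: r => [|x r IH] /=; first by rewrite !big_nil -[1]/(1%:P) derivC.
move=> /andP[xr ur]; rewrite !big_cons derivM IH// eqxx; congr (_ * _ + _).
  rewrite [RHS]big_seq_cond [LHS]big_seq; apply: eq_bigl => j.
  by case jr: (j \in r) => //=; apply/esym/eqP => jx; rewrite -jx jr in xr.
rewrite mulr_sumr !big_seq; apply: eq_bigr => i ir; rewrite big_cons.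
by case: eqP => [xi|_]; [rewrite xi ir in xr|rewrite mulrCA].
Qed.

Definition line c v w : {poly C} :=
  \sum_(a : A) c a *: \prod_l ((v l)%:P + w l *: 'X) ^+ a l.

Lemma horner_line c v w t : (line c v w).[t] = peval c (fun l => v l + t * w l).
Proof.
rewrite /line horner_sum; apply: eq_bigr => a _.
rewrite hornerZ horner_prod; congr (_ * _); apply: eq_bigr => l _.
by rewrite horner_exp !hornerE mulrC.
Qed.

Lemma deriv_line c v w m : homogeneous m c -> (m <= d)%N ->
  (line c v w)^`().[0] = \sum_l w l * peval (pderiv l c) v.
Proof.
move=> ch md.
transitivity (\sum_l \sum_(a : A) (a l)%:R * (w l * (c a * mono v (ex (subi a l))))).
  rewrite exchange_big/= /line raddf_sum horner_sum; apply: eq_bigr => a _.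
  rewrite /= derivZ hornerZ deriv_bigprod ?index_enum_uniq// horner_sum mulr_sumr.
  apply: eq_bigr => l _; rewrite hornerM deriv_exp derivD derivC derivZ derivX add0r alg_polyC hornerMn hornerM hornerC.
  rewrite !(hornerE, horner_exp) horner_prod /=.
  have [->|a0] := posnP (a l); first by rewrite mulr0n mulr0 !mul0r.
  have -> : mono v (ex (subi a l)) = v l ^+ (a l).-1 * \prod_(j | j != l) v j ^+ a j.
    rewrite /mono (bigD1 l)//= subiE eqxx subn1; congr (_ * _).
    by apply: eq_bigr => j /negbTE jl; rewrite subiE jl subn0.
  rewrite -mulr_natl; set x := \prod_(_ | _) _; set y := \prod_(_ | _) _.
  have -> : x = y by apply: eq_bigr => j _; rewrite horner_exp !hornerE.
  by ring.
apply: eq_bigr => l _; rewrite /peval mulr_sumr.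
rewrite [LHS](bigID (fun b : A => (0 < b l)%N))/= [X in _ + X]big1 ?addr0; last first.
  by move=> b; rewrite lt0n negbK => /eqP ->; rewrite mul0r.
rewrite [RHS](bigID (fun b : A => (deg b < d)%N))/= [X in _ = _ + X]big1 ?addr0; last first.
  by move=> b /negbTE bd; rewrite /pderiv bd mul0r mulr0.
rewrite [LHS](bigID (fun b : A => (deg b <= d)%N))/= [X in _ + X]big1 ?addr0; last first.
  move=> b /andP[_]; rewrite -ltnNge => bd; rewrite ch ?mul0r ?mulr0//.
  by rewrite gtn_eqF// (leq_ltn_trans md).
rewrite (reindex_onto (fun b : A => addi b l) (fun b => subi b l))/=; last first.
  by move=> b /andP[b0 _]; rewrite subiK.
apply: eq_big => [a|a].
  apply/idP/idP => [/andP[/andP[a0 ad] /eqP aa]|ad].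
    by have := deg_subi a0; rewrite aa => ->.
  by rewrite addiK// eqxx addiE// eqxx addn1 deg_addi// ad.
move=> /andP[/andP[a0 ad] /eqP aa].
have ad' : (deg a < d)%N by have := deg_subi a0; rewrite aa => ->.
by rewrite /pderiv ad' aa addiE// eqxx addn1; ring.
Qed.

Lemma deriv_poly_bound (p : {poly C}) (M : R) :
  (forall t, normc t <= 1 -> normc p.[t] <= M) -> normc p^`().[0] <= M.
Proof.
move=> pM; pose m := size p.
have pE t : p.[t] = \sum_(i < m.+2) p`_i * t ^+ i.
  by rewrite (@horner_coef_wide _ m.+2)// ltnW.
have dE : p^`().[0] = \sum_(i < m.+1) (i.+1%:R * p`_i.+1) * 0 ^+ i.
  rewrite (@horner_coef_wide _ m.+1); last by rewrite (leq_trans (size_poly _ _))// ltnW// ltnS leq_pred.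
  by apply: eq_bigr => i _; rewrite coef_deriv mulr_natl.
have fE : (fun t => p.[t]) = (fun t => \sum_(i < m.+2) p`_i * t ^+ i) by apply/funext => t.
have cd t : cdiff (fun t => p.[t]) t (\sum_(i < m.+1) (i.+1%:R * p`_i.+1) * t ^+ i).
  by rewrite fE; exact: (@cdiff_poly R (fun i => p`_i)).
apply: (@cauchy_disc R (fun t => p.[t])) => //.
  by move=> t _; eexists; exact: cd.
by rewrite dE; exact: cd.
Qed.

Lemma pow1V_le_e m : (1 + m.+1%:R^-1) ^+ m.+1 <= expR 1 :> R.
Proof.
have : (1 + m.+1%:R^-1) ^+ m.+1 <= expR (m.+1%:R^-1) ^+ m.+1 :> R.
  by rewrite lerXn2r ?nnegrE ?expR_ge0 ?addr_ge0 ?invr_ge0 ?expR_ge1Dx.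
by rewrite -expRM_natl mulfV.
Qed.

(** Cauchy's estimate on a disc of radius [r = 1 / (m + 1)]. By homogeneity, leaving the unit
    polydisc by the factor [1 + r] costs at most [(1 + r) ^ (m + 1) <= e], and [1 / r <= d]. *)
Lemma pderiv_bound m c (B : R) : homogeneous m.+1 c -> (m < d)%N ->
  (forall v, (forall l, normc (v l) <= 1) -> normc (peval c v) <= B) ->
  forall v w, (forall l, normc (v l) <= 1) -> (forall l, normc (w l) <= 1) ->
  normc (\sum_l w l * peval (pderiv l c) v) <= expR 1 * d%:R * B.
Proof.
move=> ch md cB v w v1 w1; pose r : R := m.+1%:R^-1.
have r0 : 0 < r by rewrite invr_gt0 ltr0n.
have B0 : 0 <= B by apply: le_trans (cB (fun=> 0) _); [exact: normc_ge0|move=> l; rewrite normc0].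
have := @deriv_poly_bound (line c v (fun l => r%:C%C * w l)) (expR 1 * B).
rewrite (deriv_line _ _ ch md) => h.
have {h} : normc (r%:C%C * \sum_l w l * peval (pderiv l c) v) <= expR 1 * B.
  rewrite mulr_sumr; under eq_bigr do rewrite mulrA; apply: h => t t1.
  rewrite horner_line.
  have -> : (fun l => v l + t * (r%:C%C * w l)) =
      (fun l => (1 + r)%:C%C * ((1 + r)^-1%:C%C * (v l + t * (r%:C%C * w l)))).
    apply/funext => l; rewrite mulrA -rmorphM mulfV ?mul1r// gt_eqF//; lra.
  rewrite (pevalZ _ _ ch) normcM normcX normc_real ger0_norm; last lra.
  apply: ler_pM; rewrite ?exprn_ge0 ?normc_ge0//; first lra.
    exact: pow1V_le_e.
  apply: cB => l; rewrite normcM normc_real ger0_norm ?invr_ge0; last lra.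
  rewrite ler_pdivrMl ?mulr1; last lra.
  apply: le_trans (le_normcD _ _) _; apply: lerD; first exact: v1.
  rewrite !normcM normc_real gtr0_norm// mulrCA -[leRHS]mulr1 ler_pM2l//.
  by rewrite mulr_ile1 ?normc_ge0.
rewrite normcM normc_real gtr0_norm// ler_pdivrMl ?ltr0n// mulrA => h; apply: le_trans h _.
by rewrite ler_wpM2r// mulrC ler_wpM2l ?expR_ge0// ler_nat.
Qed.

Fixpoint iter_pderiv (j : nat) : word_index n j -> (A -> C) -> A -> C :=
  if j is j'.+1 then fun i c => iter_pderiv i.1 (iter_pderiv i.2 c) else pderiv.

Definition signed_pderiv (j : nat) (u : word_signs n j) c : A -> C := fun b => \sum_i sign_char R u i * iter_pderiv i c b.

Lemma iter_pderiv_sum j (i : word_index n j) (T : finType) (l : T -> C) (c : T -> A -> C) b :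
  iter_pderiv i (fun b => \sum_k l k * c k b) b = \sum_k l k * iter_pderiv i (c k) b.
Proof.
elim: j i c b => [|j IH] /= i c b.
  rewrite /pderiv; case: ifP => _; last by rewrite big1// => k _; rewrite mulr0.
  by rewrite mulr_sumr; apply: eq_bigr => k _; rewrite mulrCA.
rewrite -IH; congr (iter_pderiv i.1 _ b); apply/funext => b'; exact: IH.
Qed.

(** Characters of a word are products over its letters, so the signed sum over all words is an
    iterated directional derivative, to which [pderiv_bound] applies letter by letter. *)
Lemma signed_pderivS j (u : word_signs n j.+1) c : signed_pderiv u c = signed_pderiv u.1 (signed_pderiv u.2 c).
Proof.
apply/funext => b; rewrite /signed_pderiv.
transitivity (\sum_x \sum_y sign_char R u.1 x * (sign_char R u.2 y * iter_pderiv x (iter_pderiv y c) b)).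
  by rewrite pair_big/=; apply: eq_bigr => -[x y] _ /=; rewrite mulrA.
by apply: eq_bigr => x _; rewrite iter_pderiv_sum mulr_sumr.
Qed.

Lemma iter_pderiv_homog j (i : word_index n j) m c : homogeneous (m + 2 ^ j)%N c -> homogeneous m (iter_pderiv i c).
Proof.
elim: j i m c => [|j IH] i m c /=; first by rewrite expn0 addn1; exact: pderiv_homog.
by rewrite expnS mul2n -addnn addnA => ch; exact: (IH _ _ _ (IH _ _ _ ch)).
Qed.

Lemma signed_pderiv_homog j (u : word_signs n j) m c : homogeneous (m + 2 ^ j)%N c -> homogeneous m (signed_pderiv u c).
Proof.
by move=> ch a am; rewrite /signed_pderiv big1// => i _; rewrite (iter_pderiv_homog _ ch)// mulr0.
Qed.

Lemma signed_pderiv_bound j (u : word_signs n j) m c (B : R) : homogeneous (m + 2 ^ j)%N c -> (m + 2 ^ j <= d)%N ->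
  (forall v, (forall l, normc (v l) <= 1) -> normc (peval c v) <= B) ->
  forall v, (forall l, normc (v l) <= 1) -> normc (peval (signed_pderiv u c) v) <= (expR 1 * d%:R) ^+ (2 ^ j) * B.
Proof.
elim: j u m c B => [|j IH] u m c B /=.
  rewrite expn0 addn1 => ch md cB v v1.
  rewrite (_ : peval _ v = \sum_l char4 R u l * peval (pderiv l c) v).
    by apply: (pderiv_bound ch md cB v1) => l; rewrite normc_char4.
  rewrite /peval /signed_pderiv /=; under eq_bigr do rewrite mulr_suml; rewrite exchange_big/=.
  by apply: eq_bigr => l _; rewrite mulr_sumr; apply: eq_bigr => a _; rewrite mulrA.
rewrite expnS mul2n -addnn => ch md cB v v1; rewrite signed_pderivS exprD -mulrA.
rewrite addnA in ch md; apply: (IH _ _ _ _ _ _ _ v v1); [exact: (signed_pderiv_homog _ ch)| |].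
  by apply: leq_trans md; rewrite leq_addr.
exact: (IH _ _ _ _ ch md cB).
Qed.

Definition roots_of_unity_point (u : {ffun 'I_n -> 'I_(d.+1 + d.+1)}) : 'I_n -> C := fun l => gridpt R (u l).

Lemma mixed_bound j m c (B : R) : homogeneous (m + 2 ^ j)%N c -> (m + 2 ^ j <= d)%N ->
  (forall v, (forall l, normc (v l) <= 1) -> normc (peval c v) <= B) ->
  \sum_(i : word_index n j) (\sum_b normc (iter_pderiv i c b) ^+ 2) `^ bh_exp R j <=
    (4 ^+ m) `^ (1 - bh_exp R j) * (bh_const R j * (((expR 1 * d%:R) ^+ (2 ^ j) * B) ^+ 2) `^ bh_exp R j).
Proof.
move=> ch md cB.
have B0 : 0 <= B by apply: le_trans (cB (fun=> 0) _); [exact: normc_ge0|move=> l; rewrite normc0].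
apply: (@le_trans _ _ (\sum_(i : word_index n j) (4 ^+ m) `^ (1 - bh_exp R j) *
    mean (fun u => (normc (peval (iter_pderiv i c) (roots_of_unity_point u)) ^+ 2) `^ bh_exp R j))).
  apply: ler_sum => i _; apply: mean_low; rewrite ?exprn_ge0 ?bh_exp_in//.
  - by move=> w; exact: sqr_ge0.
  - by apply: grid_L2; rewrite ?leq_addr.
  - apply: grid_hyper; rewrite ?addn_gt0// => a am.
    by apply: (iter_pderiv_homog _ ch); rewrite gtn_eqF.
rewrite -mulr_sumr ler_wpM2l ?powR_ge0// -mean_sum.
apply: mean_le => [|w]; first by rewrite mulr_ge0 ?bh_const_ge0 ?powR_ge0.
apply: bohnenblust_hille => [|u]; first by rewrite mulr_ge0// exprn_ge0// mulr_ge0 ?expR_ge0.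
rewrite (_ : \sum_i _ = peval (signed_pderiv u c) (roots_of_unity_point w)).
  by apply: (signed_pderiv_bound _ ch md cB) => l; rewrite normc_gridpt.
rewrite /peval /signed_pderiv; under [RHS]eq_bigr do rewrite mulr_suml; rewrite exchange_big/=.
by apply: eq_bigr => i _; rewrite mulr_suml; apply: eq_bigr => a _; rewrite mulrC mulrA.
Qed.

End Polynomials.

(** * Splitting words off monomials *)

Section Decomposition.
Variables (R : realType) (n d : nat).
Local Notation C := R[i].
Local Notation A := {ffun 'I_n -> 'I_d.+1}.
Local Notation ex a := (fun i => nat_of_ord (a i)).

(** The halves are swapped because [iter_pderiv i.1 (iter_pderiv i.2 c)], evaluated at [b], adds the
    letters of [i.1] first, and [add_word] folds from the right. *)
Fixpoint letters_of (j : nat) : word_index n j -> seq 'I_n :=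
  if j is j'.+1 then fun i => letters_of i.2 ++ letters_of i.1 else fun i => [:: i].

Definition add_word (b : A) (s : seq 'I_n) : A := foldr (fun l a => addi a l) b s.

Lemma size_letters_of j (i : word_index n j) : size (letters_of i) = (2 ^ j)%N.
Proof. by elim: j i => [|j IH] i //=; rewrite size_cat !IH expnS mul2n addnn. Qed.

Lemma deg_add_word b s : (deg b + size s <= d)%N -> deg (add_word b s) = (deg b + size s)%N.
Proof.
elim: s => [|l s IH] /= h; first by rewrite addn0.
rewrite addnS in h; rewrite deg_addi IH ?addnS// 1?ltnW//.
Qed.

(** Differentiation multiplies coefficients by positive integers, so passing to derivatives loses
    nothing and brings in no polarization factor. *)
Lemma iter_pderiv_ge j (i : word_index n j) (c : A -> C) b : (deg b + 2 ^ j <= d)%N ->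
  normc (c (add_word b (letters_of i))) <= normc (iter_pderiv i c b).
Proof.
elim: j i c b => [|j IH] i c b /=.
  rewrite expn0 addn1 => bd; rewrite /pderiv bd normcM normc_nat ler_peMl ?normc_ge0//.
  by rewrite ler1n.
rewrite expnS mul2n -addnn addnA => bd.
rewrite /add_word foldr_cat -/(add_word b _) -/(add_word _ _).
have bd' : (deg b + 2 ^ j <= d)%N by apply: leq_trans bd; rewrite leq_addr.
apply: le_trans (IH i.1 (iter_pderiv i.2 c) b bd'); apply: IH.
by rewrite deg_add_word size_letters_of.
Qed.

Lemma letters_of_onto j (s : seq 'I_n) : size s = (2 ^ j)%N -> exists i : word_index n j, letters_of i = s.
Proof.
elim: j s => [|j IH] s; first by case: s => [|l []]//= _; exists l.
rewrite expnS mul2n -addnn => ss.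
have [i1 h1] := IH (take (2 ^ j) s) ltac:(by rewrite size_takel// ss leq_addr).
have [i2 h2] := IH (drop (2 ^ j) s) ltac:(by rewrite size_drop ss addnK).
by exists (i2, i1); rewrite /= h1 h2 cat_take_drop.
Qed.

Definition below_word (b : A) (s : seq 'I_n) := all (fun l : 'I_n => [forall v : 'I_n, (0 < b v)%N ==> (v <= l)%N]) s.

Lemma decomposition (a : A) k : (k <= deg a)%N -> (deg a <= d)%N -> exists s b,
  [/\ size s = k, (deg b + k)%N = deg a, add_word b s = a & below_word b s].
Proof.
move=> + ad; elim: k => [|k IH] ka; first by exists [::], a; rewrite addn0.
have [s [b [sk bk ba bl]]] := IH (ltnW ka).
have b0 : (0 < deg b)%N by rewrite lt0n; apply/eqP => b0; rewrite -bk b0 ltnn in ka.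
have [l0 l00] : exists l, (0 < b l)%N.
  apply/existsP; apply: contraTT b0; rewrite negb_exists => /forallP h.
  by rewrite /deg big1// => i _; apply/eqP; rewrite -leqn0 leqNgt.
pose l := [arg max_(l > l0 | (0 < b l)%N) (l : nat)].
have [bl0 lmax] : (0 < b l)%N /\ forall v, (0 < b v)%N -> (v <= l)%N.
  by rewrite /l; case: arg_maxnP.
have dl := deg_subi bl0.
exists (rcons s l), (subi b l); split.
- by rewrite size_rcons sk.
- by rewrite addnS -addSn dl.
- by rewrite /add_word foldr_rcons subiK.
- have sub v : (0 < subi b l v)%N -> (0 < b v)%N by rewrite subiE subn_gt0; apply: leq_ltn_trans.
  rewrite /below_word all_rcons; apply/andP; split.
    by apply/forallP => v; apply/implyP => /sub; exact: lmax.
  apply: sub_all bl => l' /forallP h; apply/forallP => v; apply/implyP => /sub bv.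
  exact: (implyP (h v)).
Qed.

Variable x : nat -> R.
Hypothesis x0 : forall l, 0 <= x l.

Definition xmonomial (a : A) : R := \prod_(v : 'I_n) x v ^+ a v.

Lemma xmonomial_ge0 a : 0 <= xmonomial a.
Proof. by apply: prodr_ge0 => v _; rewrite exprn_ge0. Qed.

Lemma xmonomial_add_word b s : (deg b + size s <= d)%N -> xmonomial (add_word b s) = \prod_(l <- s) x l * xmonomial b.
Proof.
elim: s => [|l s IH] /= h; first by rewrite big_nil mul1r.
rewrite addnS in h; rewrite big_cons -mulrA -IH; last exact: ltnW.
have h' : (deg (add_word b s) < d)%N by rewrite deg_add_word// ltnW.
rewrite /xmonomial (bigD1 l)//= [in RHS](bigD1 l)//= addiE// eqxx addn1 exprS -mulrA; congr (_ * (_ * _)).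
by apply: eq_bigr => j /negbTE ji; rewrite addiE// ji addn0.
Qed.

Lemma sum_decomposition j m (F : A -> R) : (m + 2 ^ j)%N = d -> (forall a, 0 <= F a) ->
  \sum_(a : A | deg a == d) F a <=
  \sum_(i : word_index n j) \sum_(b : A | (deg b == m) && below_word b (letters_of i)) F (add_word b (letters_of i)).
Proof.
move=> md F0.
rewrite [leRHS](eq_bigr (fun i => \sum_(a : A | deg a == d) \sum_(b : A | ((deg b == m) && below_word b (letters_of i)) && (add_word b (letters_of i) == a)) F a)); last first.
  move=> i _; rewrite (partition_big (fun b => add_word b (letters_of i)) (fun a => deg a == d)).
    by apply: eq_bigr => a _; apply: eq_bigr => b /andP[_ /eqP ->].
  by move=> b /andP[/eqP bm _]; rewrite deg_add_word bm size_letters_of md// eqxx.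
rewrite exchange_big/=; apply: ler_sum => a /eqP ad.
have [s [b [sk bk ba bl]]] := @decomposition a (2 ^ j) ltac:(by rewrite ad -md leq_addl) ltac:(by rewrite ad).
have [i si] := letters_of_onto sk.
rewrite (bigD1 i)//= (bigD1 b)/=; last first.
  by rewrite si bl ba eqxx andbT andbT -(eqn_add2r (2 ^ j)) bk ad md.
rewrite -addrA lerDl addr_ge0// sumr_ge0// => i' _; exact: sumr_ge0.
Qed.

Variables (t K e : R).
Hypothesis t0 : 0 < t.
Hypothesis tx : forall l, t * x l ^+ 2 < 1.
Hypothesis prod_le : forall l : nat, \prod_(v < l.+1) (1 - t * x v ^+ 2)^-1 <= K * l.+1%:R `^ e.

Lemma geo_le (y : R) m : 0 <= y < 1 -> \sum_(i < m) y ^+ i <= (1 - y)^-1.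
Proof.
move=> /andP[y0 y1]; have y10 : 0 < 1 - y by rewrite subr_gt0.
rewrite -[leRHS]div1r ler_pdivlMr// -(big_mkord xpredT (fun i => y ^+ i)) mulr_suml.
rewrite (eq_bigr (fun i => - (y ^+ i.+1 - y ^+ i))); last by move=> i _; rewrite exprS; ring.
by rewrite sumrN telescope_sumr// expr0 opprB lerBlDr lerDl exprn_ge0.
Qed.

(** After insertion of [t ^+ m] the sum over degree [m] is enlarged to all exponents on the letters
    up to [l], where it factors into geometric series. Fixing the degree first is what produces the
    gain or loss [t ^- m]. *)
Lemma below_word_sum m s (l : 'I_n) : l \in s ->
  \sum_(b : A | (deg b == m) && below_word b s) xmonomial b ^+ 2 <= t ^- m * (K * l.+1%:R `^ e).
Proof.
move=> ls; have tm : 0 < t ^+ m by rewrite exprn_gt0.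
rewrite -[t ^- m]/((t ^+ m)^-1) -(ler_pM2l tm) mulVKf ?gt_eqF// mulr_sumr.
apply: le_trans (prod_le l).
have tx0 v : 0 <= t * x v ^+ 2 by rewrite mulr_ge0 ?sqr_ge0// ltW.
pose F (v : 'I_n) (i : 'I_d.+1) : R := if (v <= l)%N then (t * x v ^+ 2) ^+ i else (i == ord0)%:R.
have F0 v i : 0 <= F v i by rewrite /F; case: ifP => _; rewrite ?exprn_ge0 ?ler0n.
apply: (@le_trans _ _ (\sum_(b : A) \prod_v F v (b v))).
  rewrite [leRHS](bigID (fun b : A => (deg b == m) && below_word b s))/= -[leLHS]addr0; apply: lerD; last first.
    by apply: sumr_ge0 => b _; exact: prodr_ge0.
  apply: ler_sum => b /andP[/eqP bm /allP /(_ _ ls) /forallP bl].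
  rewrite -bm /deg expr_sum /xmonomial -prodrXl -big_split/=.
  rewrite le_eqVlt; apply/orP; left; apply/eqP; apply: eq_bigr => v _; rewrite /F.
  rewrite -exprM mulnC exprM -exprMn; case: ifP => [//|vl].
  have := bl v; rewrite vl implybF -eqn0Ngt => /eqP b0.
  by rewrite b0 expr0 (_ : b v = ord0) ?eqxx//; apply: val_inj.
rewrite -bigA_distr_bigA/=.
rewrite (big_ord_widen n (fun v => (1 - t * x v ^+ 2)^-1)) ?ltn_ord// [leRHS]big_mkcond/=.
apply: ler_prod => v _; rewrite sumr_ge0//= ltnS; case: ifP => vl.
  under eq_bigr do rewrite /F vl; apply: geo_le; rewrite tx0; exact: tx.
rewrite (bigD1 ord0)//= big1 /F ?vl ?eqxx ?addr0// => i /negbTE i0; by rewrite i0.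
Qed.

Lemma prod_letters_of j (y : 'I_n -> R) :
  \sum_(i : word_index n j) \prod_(l <- letters_of i) y l = (\sum_l y l) ^+ (2 ^ j).
Proof.
elim: j => [|j IH] /=; first by rewrite expr1; apply: eq_bigr => i _; rewrite big_seq1.
rewrite expnS mul2n -addnn exprD -IH mulr_suml.
rewrite -(pair_bigA _ (fun i i' => \prod_(l <- letters_of i' ++ letters_of i) y l))/=; apply: eq_bigr => i _.
by rewrite mulr_sumr; apply: eq_bigr => i' _; rewrite big_cat mulrC.
Qed.

Lemma le_geomean (T : eqType) (s : seq T) (y : R) (g : T -> R) : (0 < size s)%N -> 0 <= y ->
  (forall l, l \in s -> y <= g l) -> y <= \prod_(l <- s) g l `^ (size s)%:R^-1.
Proof.
move=> s0 y0 yg; set k := (size s)%:R.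
have -> : y = \prod_(l <- s) y `^ k^-1.
  rewrite big_const_seq count_predT -Monoid.iteropE -/(_ ^+ _) -powR_mulrn ?powR_ge0// -powRrM.
  by rewrite mulVf ?powRr1// pnatr_eq0 -lt0n.
rewrite big_seq [leRHS]big_seq; apply: ler_prod => l ls; rewrite powR_ge0/=.
by apply: ge0_ler_powR; rewrite ?invr_ge0 ?nnegrE ?yg// (le_trans y0)// yg.
Qed.

Lemma exponents (y : R) : 2 <= y ->
  [/\ (y - 1) / (2 * y) = 1 - (y + 1) / (2 * y), 0 < (y + 1) / (2 * y) < 1,
      y / (y + 1) * ((y + 1) / (2 * y)) = 2^-1 &
      (1 - y / (y + 1)) * ((y + 1) / (2 * y)) = (2 * y)^-1].
Proof.
move=> y2; have y0 : 0 < y by lra.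
have y10 : 0 < y + 1 by lra.
have yn : y != 0 by rewrite gt_eqF.
have y1n : y + 1 != 0 by rewrite gt_eqF.
split; [by field|apply/andP; split|by field; rewrite yn|by field; rewrite yn].
  by rewrite divr_gt0// mulr_gt0.
by rewrite ltr_pdivrMr ?mulr_gt0//; lra.
Qed.

Lemma powR_prod_seq (T : Type) (r : seq T) (F : T -> R) (y : R) : (forall i, 0 <= F i) ->
  (\prod_(i <- r) F i) `^ y = \prod_(i <- r) F i `^ y.
Proof.
move=> F0; elim: r => [|i r IH]; first by rewrite !big_nil powR1.
by rewrite !big_cons powRM ?IH ?prodr_ge0.
Qed.

Lemma powRXC (a y : R) m : 0 <= a -> (a ^+ m) `^ y = (a `^ y) ^+ m.
Proof.
by move=> a0; rewrite -powR_mulrn// -powRrM mulrC powRrM powR_mulrn// powR_ge0.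
Qed.

Local Notation k j := ((2 ^ j)%:R : R).

(** Cauchy-Schwarz over [b] for each word, then Hölder over the words with the exponent
    [2k / (k + 1)] and its conjugate [q]. [mixed_bound] controls the first factor, [below_word_sum]
    and the geometric mean the second. Only 4 and [t] enter with a power [m]. *)
Lemma homog_sum_bound j m (c : A -> C) (B Y : R) : (0 < j)%N -> (m + 2 ^ j)%N = d -> 0 < K ->
  homogeneous d c -> (forall v, (forall l, normc (v l) <= 1) -> normc (peval c v) <= B) ->
  \sum_(l < n) (x l * l.+1%:R `^ (e / (2 * k j))) `^ (2 * k j / (k j - 1)) <= Y ->
  \sum_(a : A | deg a == d) normc (c a) * xmonomial a <=
  bh_const R j `^ ((k j + 1) / (2 * k j)) * K `^ 2^-1 * (Y ^+ (2 ^ j)) `^ ((k j - 1) / (2 * k j)) *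
  (((expR 1 * d%:R) ^+ (2 ^ j) * B) * (4 `^ (2 * k j)^-1 * t `^ (- 2^-1)) ^+ m).
Proof.
move=> j0 md K0 ch cB Yb; set q := 2 * k j / (k j - 1).
have kj : 2 <= k j by rewrite ler_nat -{1}(expn1 2) leq_exp2l.
set kk := k j in kj q Yb *.
have B0 : 0 <= B by apply: le_trans (cB (fun=> 0) _); [exact: normc_ge0|move=> l; rewrite normc0].
set s := (kk + 1) / (2 * kk).
have [s1 sI h3 h4] := exponents kj; rewrite -/s in s1 sI h3 h4.
have kapE : bh_exp R j = kk / (kk + 1) by rewrite /bh_exp -[(2 ^ j).+1]addn1 natrD.
have kap_s : bh_exp R j * s = 2^-1 by rewrite kapE.
have kap_1 : (1 - bh_exp R j) * s = (2 * kk)^-1 by rewrite kapE.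
have qV : q^-1 = 1 - s by rewrite /q -s1 invf_div.
have /andP[s0 s1'] := sI.
have pw (r a b : R) : 0 <= r -> 0 <= a -> a <= b -> a `^ r <= b `^ r.
  by move=> r0 a0 ab; apply: ge0_ler_powR; rewrite ?nnegrE// (le_trans a0).
pose T i := \sum_b normc (iter_pderiv (j := j) i c b) ^+ 2.
have T0 i : 0 <= T i by apply: sumr_ge0 => b _; exact: sqr_ge0.
pose L i := \sum_(b : A | (deg b == m) && below_word b (letters_of (j := j) i)) xmonomial b ^+ 2.
have L0 i : 0 <= L i by apply: sumr_ge0 => b _; exact: sqr_ge0.
pose X i := \prod_(l <- letters_of (j := j) i) x l.
have X0 i : 0 <= X i by exact: prodr_ge0.
(* Normalized so that [f i]^ s[is the]l^2[norm of the derivative along the word and]g i [^ (1 - s)]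
   the weight of the word times the [l^2] norm of the weights of [b]. *)
pose f i := T i `^ bh_exp R j.
pose g i := (X i * L i `^ 2^-1) `^ q.
have step1 : \sum_(a : A | deg a == d) normc (c a) * xmonomial a <= \sum_i f i `^ s * g i `^ (1 - s).
  apply: le_trans (sum_decomposition md _) _ => [a|]; first by rewrite mulr_ge0 ?normc_ge0 ?xmonomial_ge0.
  apply: ler_sum => i _.
  rewrite /f /g -!powRrM kap_s -qV mulfV ?powRr1 ?mulr_ge0 ?powR_ge0//; last first.
    by rewrite -invr_eq0 qV gt_eqF// subr_gt0.
  apply: (@le_trans _ _ (X i * \sum_(b : A | (deg b == m) && below_word b (letters_of i)) normc (iter_pderiv i c b) * xmonomial b)).
    rewrite mulr_sumr; apply: ler_sum => b /andP[/eqP bm _].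
    have bd : (deg b + size (letters_of i) <= d)%N by rewrite bm size_letters_of md.
    rewrite xmonomial_add_word// mulrCA -/(X i) ler_wpM2l// ler_wpM2r ?xmonomial_ge0//.
    by apply: iter_pderiv_ge; rewrite bm md.
  rewrite mulrCA ler_wpM2l// !powR12_sqrt// -sqrtrM// -[leLHS]ger0_norm; last first.
    by apply: sumr_ge0 => b _; rewrite mulr_ge0 ?normc_ge0 ?xmonomial_ge0.
  rewrite -sqrtr_sqr ler_wsqrtr// -[X in X ^+ 2 <= _]big_filter.
  apply: le_trans (cauchy_sum _ _ _) _ => [b|b|]; rewrite ?normc_ge0 ?xmonomial_ge0//.
  rewrite !big_filter ler_wpM2r ?L0// /T [leRHS](bigID (fun b : A => (deg b == m) && below_word b (letters_of i)))/=.
  by rewrite lerDl sumr_ge0// => b _; exact: sqr_ge0.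
apply: le_trans step1 _.
apply: le_trans (hoelder_sum (index_enum (word_index n j)) (fun i => powR_ge0 _ _) (fun i => powR_ge0 _ _) sI) _.
pose Z := (4 ^+ m) `^ (1 - bh_exp R j) * (bh_const R j * (((expR 1 * d%:R) ^+ (2 ^ j) * B) ^+ 2) `^ bh_exp R j).
have f_le : \sum_i f i <= Z by apply: mixed_bound => //; rewrite md.
pose D := t ^- m * K.
have Dp : 0 < D by rewrite mulr_gt0// invr_gt0 exprn_gt0.
have D0 := ltW Dp.
have g_le : \sum_i g i <= D `^ (q / 2) * Y ^+ (2 ^ j).
  have q0 : 0 <= q by rewrite -invr_ge0 qV subr_ge0 ltW.
  pose y (l : 'I_n) := (x l * l.+1%:R `^ (e / (2 * kk))) `^ q.
  apply: (@le_trans _ _ (D `^ (q / 2) * (\sum_l y l) ^+ (2 ^ j))); last first.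
    rewrite ler_wpM2l ?powR_ge0// lerXn2r// nnegrE; first by apply: sumr_ge0 => l _; exact: powR_ge0.
    by apply: le_trans Yb; apply: sumr_ge0 => l _; exact: powR_ge0.
  rewrite -prod_letters_of mulr_sumr; apply: ler_sum => i _.
  have L_le : L i <= D * \prod_(l <- letters_of i) l.+1%:R `^ (e / kk).
    have sz : (size (letters_of i))%:R = kk :> R by rewrite size_letters_of.
    have sz0 : (0 < size (letters_of i))%N by rewrite size_letters_of expn_gt0.
    rewrite -ler_pdivrMl //.
    have := @le_geomean _ (letters_of i) (D^-1 * L i) (fun l : 'I_n => l.+1%:R `^ e) sz0.
    rewrite mulr_ge0 ?invr_ge0// sz => /(_ isT) h.
    rewrite (eq_bigr (fun l : 'I_n => (l.+1%:R `^ e) `^ kk^-1)); last by move=> l _; rewrite -powRrM.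
    apply: h => l ls; rewrite ler_pdivrMl // /D -mulrA.
    exact: below_word_sum.
  have -> : D `^ (q / 2) * \prod_(l <- letters_of i) y l =
      (D `^ 2^-1 * \prod_(l <- letters_of i) (x l * l.+1%:R `^ (e / (2 * kk)))) `^ q.
    rewrite powRM ?powR_ge0//; last by apply: prodr_ge0 => l _; rewrite mulr_ge0 ?powR_ge0.
    rewrite -powRrM [2^-1 * q]mulrC; congr (_ * _).
    by rewrite powR_prod_seq// => l; rewrite mulr_ge0 ?powR_ge0.
  rewrite /g; apply: (pw _) => //; first by rewrite mulr_ge0 ?powR_ge0.
  rewrite big_split/= -/(X i) mulrCA ler_wpM2l//.
  have -> : \prod_(l <- letters_of i) l.+1%:R `^ (e / (2 * kk)) = (\prod_(l <- letters_of i) (l.+1%:R `^ (e / kk))) `^ 2^-1.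
    rewrite powR_prod_seq => [|l]; last exact: powR_ge0.
    apply: eq_bigr => l _; rewrite -powRrM; congr (_ `^ _).
    by rewrite invfM mulrA mulrAC -mulrA.
  rewrite -powRM//; first by apply: (pw _) => //; rewrite invr_ge0.
  by apply: prodr_ge0 => l _; exact: powR_ge0.
apply: (@le_trans _ _ (Z `^ s * (D `^ (q / 2) * Y ^+ (2 ^ j)) `^ (1 - s))).
  apply: ler_pM; rewrite ?powR_ge0//; apply: (pw _); rewrite ?subr_ge0 ?(ltW s0) ?(ltW s1')//.
  - by apply: sumr_ge0 => i _; exact: powR_ge0.
  - by apply: sumr_ge0 => i _; exact: powR_ge0.
rewrite s1; set EB := (expR 1 * d%:R) ^+ (2 ^ j) * B.
have EB0 : 0 <= EB by rewrite mulr_ge0// exprn_ge0// mulr_ge0 ?expR_ge0.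
have Y0 : 0 <= Y by apply: le_trans Yb; apply: sumr_ge0 => l _; exact: powR_ge0.
have ZE : Z `^ s = (4 `^ (2 * kk)^-1) ^+ m * (bh_const R j `^ s * EB).
  rewrite /Z powRM ?powR_ge0 ?mulr_ge0 ?bh_const_ge0 ?powR_ge0// -powRrM kap_1 powRXC//.
  congr (_ * _); rewrite powRM ?bh_const_ge0 ?powR_ge0// -powRrM kap_s.
  by rewrite powR12_sqrt ?sqr_ge0// sqrtr_sqr ger0_norm.
have DE : (D `^ (q / 2) * Y ^+ (2 ^ j)) `^ (1 - s) = (t `^ (- 2^-1)) ^+ m * K `^ 2^-1 * (Y ^+ (2 ^ j)) `^ (1 - s).
  rewrite powRM ?powR_ge0 ?exprn_ge0// -powRrM -qV mulrAC mulfV ?mul1r; last first.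
    by rewrite -invr_eq0 qV gt_eqF// subr_gt0.
  rewrite /D powRM ?invr_ge0 ?exprn_ge0 ?(ltW t0) ?(ltW K0)//; congr (_ * _ * _).
  by rewrite -exprVn powRXC ?invr_ge0 ?(ltW t0)// -powR_inv1 ?(ltW t0)// -powRrM mulN1r.
rewrite ZE DE exprMn le_eqVlt; apply/orP; left; apply/eqP.
move: (_ `^ s) (_ ^+ m) (_ ^+ m) (K `^ _) (_ `^ (1 - s)) => a1 a2 a3 a4 a5; ring.
Qed.

End Decomposition.

Section PolynomialGeometric.
Variable R : realType.

(* [(m + k)^k] is absorbed by a geometric factor through [1 + y <= exp y]. *)
Lemma poly_geo_sum (r : R) (k : nat) : 0 <= r < 1 ->
  exists C0 : R, 0 <= C0 /\ forall D, \sum_(m < D) (m + k)%:R ^+ k * r ^+ m <= C0.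
Proof.
move=> /andP[r0 r1].
have [->|k0] := posnP k.
  exists ((1 - r)^-1); split; first by rewrite invr_ge0 subr_ge0 ltW.
  move=> D; under eq_bigr do rewrite expr0 mul1r; apply: geo_le; by rewrite r0.
(* Positive, so that its logarithm can be used; [eps] is half of [- ln r'], which leaves the ratio
   [q = sqrt r']. *)
pose r' := Num.max r 2^-1.
have r'0 : 0 < r' by rewrite lt_max invr_gt0 orbC ltr0n.
have r'1 : r' < 1 by rewrite gt_max r1 invf_lt1//= ltr1n.
have rr' : r <= r' by rewrite le_max lexx.
pose eps := - (ln r') / 2; have eps0 : 0 < eps by rewrite divr_gt0// oppr_gt0 ln_lt0// r'0.
have eE : expR eps ^+ 2 = r'^-1.
  by rewrite -expRM_natl /eps mulrC divfK// expRN lnK.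
pose q := expR eps * r'.
have q0 : 0 <= q by rewrite mulr_ge0 ?expR_ge0 ?ltW.
have q1 : q < 1.
  rewrite -(@ltr_pXn2r R 2)// ?nnegrE// expr1n /q exprMn eE expr2 mulrA mulVf ?mul1r// gt_eqF//.
have kR0 : 0 < k%:R :> R by rewrite ltr0n.
have c0 : 0 <= (k%:R / eps) ^+ k * expR (eps * k%:R).
  by rewrite mulr_ge0 ?expR_ge0// exprn_ge0// divr_ge0 ?ler0n ?ltW.
exists ((k%:R / eps) ^+ k * expR (eps * k%:R) * (1 - q)^-1); split.
  by rewrite mulr_ge0// invr_ge0 subr_ge0 ltW.
move=> D; have := @geo_le R q D; rewrite q0 q1 => /(_ isT) h.
apply: le_trans (ler_wpM2l _ h); last exact: c0.
rewrite mulr_sumr; apply: ler_sum => m _.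
have h1 : (m + k)%:R <= k%:R / eps * expR (eps * (m + k)%:R / k%:R).
  have := expR_ge1Dx (eps * (m + k)%:R / k%:R).
  move=> /(ler_wpM2l (_ : 0 <= k%:R / eps)); rewrite divr_ge0 ?ler0n ?(ltW eps0)// => /(_ isT).
  apply: le_trans; rewrite mulrDr mulr1.
  have -> : k%:R / eps * (eps * (m + k)%:R / k%:R) = (m + k)%:R.
    by field; rewrite !gt_eqF.
  by rewrite lerDr divr_ge0 ?ler0n ?ltW.
have h2 : (m + k)%:R ^+ k <= (k%:R / eps) ^+ k * expR (eps * (m + k)%:R).
  apply: (@le_trans _ _ ((k%:R / eps * expR (eps * (m + k)%:R / k%:R)) ^+ k)).
    by rewrite lerXn2r ?nnegrE ?ler0n// (le_trans _ h1)// ler0n.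
  by rewrite exprMn -expRM_natl (_ : k%:R * (eps * (m + k)%:R / k%:R) = eps * (m + k)%:R)// mulrC divfK// gt_eqF.
have h3 : r ^+ m <= r' ^+ m by rewrite lerXn2r// nnegrE ltW.
apply: le_trans (ler_pM _ _ h2 h3) _; rewrite ?exprn_ge0 ?ler0n//.
have eM : expR (eps * m%:R) = expR eps ^+ m by rewrite mulrC expRM_natl.
have qE : q ^+ m = expR eps ^+ m * r' ^+ m by rewrite exprMn.
rewrite natrD mulrDr expRD eM qE.
rewrite le_eqVlt; apply/orP; left; apply/eqP.
by move: (expR eps ^+ m) (expR _) (r' ^+ m) (_ ^+ k) => a b c z; ring.
Qed.

End PolynomialGeometric.

(** * Bounds for the homogeneous parts of a holomorphic function *)

Section HolomorphicBound.
Variables (R : realType) (n : nat) (sg : 'I_n.+1 -> nat).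
Hypothesis sg_inj : injective sg.
Local Notation C := R[i].
Local Notation N := (@linfty_norm R).
Local Notation A d := {ffun 'I_n.+1 -> 'I_d.+1}.
Local Notation ex a := (fun i => nat_of_ord (a i)).

Lemma emb_coord (v : 'I_n.+1 -> C) i : emb sg v (sg i) = v i.
Proof.
have h p : (emb sg v : linfty R) p = \sum_i v i * (p == sg i)%:R.
  rewrite /emb; elim/big_rec2: _ => [//|l a b _ <-]; by [].
rewrite h (bigD1 i)//= eqxx mulr1 big1 ?addr0// => l li.
by rewrite (inj_eq sg_inj) eq_sym (negbTE li) mulr0.
Qed.

Lemma emb_out (v : 'I_n.+1 -> C) p : (forall i, sg i != p) -> emb sg v p = 0.
Proof.
have h q : (emb sg v : linfty R) q = \sum_i v i * (q == sg i)%:R.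
  rewrite /emb; elim/big_rec2: _ => [//|l a b _ <-]; by [].
by move=> sp; rewrite h big1// => i _; rewrite eq_sym (negbTE (sp i)) mulr0.
Qed.

Lemma norm_emb (v : 'I_n.+1 -> C) (r : R) : 0 <= r -> (forall i, normc (v i) <= r) -> N (emb sg v) <= r.
Proof.
move=> r0 vr; apply: linfty_norm_le => p.
case: (boolP [exists i, sg i == p]) => [/existsP[i /eqP <-]|]; first by rewrite emb_coord.
by rewrite negb_exists => /forallP h; rewrite emb_out// normc0.
Qed.

(** [f] is bounded on the open ball only. Dividing [v] by [1 + 1 / (m + 1)] moves it inside, and
    homogeneity of degree [m] charges at most a factor [e]. *)
Lemma homog_bound (f : linfty R -> C^o) (M : R) d m v : holo f -> (m <= d)%N ->
  (forall z, N z < 1 -> normc (f z) <= M) -> (forall i, normc (v i) <= 1) ->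
  normc (homog sg d f v m) <= expR 1 * M.
Proof.
move=> fh md fM v1; pose c (a : A d) := if deg a == m then gcoef sg f (ex a) else 0.
have cE w : homog sg d f w m = peval c w.
  rewrite /homog /peval big_mkcond/=; apply: eq_bigr => a _; rewrite /c.
  by case: ifP; rewrite ?mul0r.
have ch : homogeneous m c by move=> a /negbTE am; rewrite /c am.
pose r : R := 1 + m.+1%:R^-1; have r0 : 1 < r by rewrite ltrDl invr_gt0.
have rp : 0 < r by apply: lt_trans r0.
have -> : v = (fun i => r%:C%C * (r^-1%:C%C * v i)).
  by apply/funext => i; rewrite mulrA -rmorphM mulfV ?mul1r// gt_eqF.
rewrite cE (pevalZ _ _ ch) normcM normcX normc_real (ger0_norm (ltW rp)).
apply: ler_pM; rewrite ?exprn_ge0 ?(ltW rp) ?normc_ge0//.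
  by apply: le_trans (pow1V_le_e R m); rewrite -/r ler_weXn2l// ltW.
rewrite -cE; have := @homog_taylor R n.+1 sg f (fun i => r^-1%:C%C * v i) M d fh.
move=> /(_ _ fM)[]; last by move=> h _; exact: h.
apply: (@le_lt_trans _ _ r^-1); last by rewrite invf_lt1.
apply: norm_emb => [|i]; first by rewrite invr_ge0 ltW.
by rewrite normcM normc_real ger0_norm ?invr_ge0 ?(ltW rp)// ler_piMr// invr_ge0 ltW.
Qed.

Lemma degsum_type (F : ('I_n.+1 -> nat) -> R) m d d' : (m <= d)%N -> (m <= d')%N ->
  \sum_(a : A d | deg a == m) F (ex a) = \sum_(a : A d' | deg a == m) F (ex a).
Proof.
move=> md md'.
pose to d1 d2 (a : A d1) : A d2 := [ffun i => inord (a i)].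
have toE d1 d2 (a : A d1) i : (deg a <= d2)%N -> to d1 d2 a i = a i :> nat.
  by move=> ad; rewrite ffunE inordK// ltnS (leq_trans (deg_ge a i)).
have deg_to d1 d2 (a : A d1) : (deg a <= d2)%N -> deg (to d1 d2 a) = deg a.
  by move=> ad; apply: eq_bigr => i _; rewrite toE.
have toK d1 d2 (a : A d1) : (deg a <= d2)%N -> to d2 d1 (to d1 d2 a) = a.
  move=> ad; apply/ffunP => i; apply: val_inj.
  by rewrite [LHS]/= ffunE toE// inordK.
rewrite (reindex_onto (to d' d) (to d d')) /=; last by move=> a /eqP am; rewrite toK// am.
apply: eq_big => [a|a /andP[/eqP am /eqP aa]].
  apply/idP/idP => [/andP[/eqP am /eqP aa]|/eqP am]; last by rewrite toK ?am// deg_to ?am// !eqxx.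
  by rewrite -aa deg_to am.
have {}am : deg a = m by rewrite -aa deg_to am.
by congr F; apply/funext => i; rewrite toE// am.
Qed.

Definition sub_ord0 (k : nat) (b : 'I_n.+1 -> nat) : 'I_n.+1 -> nat :=
  fun i => (b i - (if i == ord0 then k else 0))%N.

Lemma degsum_shift (T : nmodType) (F : ('I_n.+1 -> nat) -> T) m k d : d = (m + k)%N ->
  \sum_(b : A d | (deg b == (m + k)%N) && (k <= b ord0)%N) F (ex b) =
  \sum_(a : A d | deg a == m) F (fun i => a i + (if i == ord0 then k else 0))%N.
Proof.
move=> dE; pose up (a : A d) : A d := [ffun i => inord (a i + (if i == ord0 then k else 0))].
pose dn (b : A d) : A d := [ffun i => inord (b i - (if i == ord0 then k else 0))].
have dnE (b : A d) i : dn b i = (b i - (if i == ord0 then k else 0))%N :> nat.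
  by rewrite ffunE inordK// (leq_ltn_trans (leq_subr _ _)).
have upE (a : A d) i : deg a = m -> up a i = (a i + (if i == ord0 then k else 0))%N :> nat.
  move=> am; rewrite ffunE inordK// ltnS; apply: (@leq_trans (m + k)); last by rewrite -dE.
  by apply: leq_add; [rewrite -am deg_ge|case: ifP].
have dnK (b : A d) : (k <= b ord0)%N -> up (dn b) = b.
  move=> bk; apply/ffunP => i; apply: val_inj; rewrite /= ffunE dnE subnK ?inordK//.
  by case: eqP => // ->.
have upK (a : A d) : deg a = m -> dn (up a) = a.
  by move=> am; apply/ffunP => i; apply: val_inj; rewrite /= dnE upE// addnK.
have sk : (\sum_(i < n.+1) (if i == ord0 then k else 0) = k)%N.
  by rewrite (bigD1 ord0)//= big1 ?addn0// => i /negbTE ->.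
have deg_up (a : A d) : deg a = m -> deg (up a) = (m + k)%N.
  move=> am; rewrite /deg; under eq_bigr do rewrite upE//.
  by rewrite big_split/= -/(deg a) am sk.
have deg_dn (b : A d) : (k <= b ord0)%N -> (deg (dn b) + k)%N = deg b.
  move=> bk; rewrite /deg -sk -big_split/=; apply: eq_bigr => i _.
  by rewrite dnE subnK//; case: eqP => // ->.
rewrite (reindex_onto up dn)/=; last by move=> b /andP[_ bk]; rewrite dnK.
apply: eq_big => [a|a].
  apply/idP/idP => [/andP[/andP[/eqP am ak] /eqP aa]|/eqP am].
    by rewrite -(eqn_add2r k) -am -(deg_dn _ ak) aa.
  by rewrite deg_up// upK// !eqxx upE// eqxx leq_addl.
move=> /andP[/andP[/eqP am ak] /eqP aa].
have am' : deg a = m by apply/eqP; rewrite -(eqn_add2r k) -am -(deg_dn _ ak) aa.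
by congr F; apply/funext => i; rewrite upE.
Qed.

Lemma sub_ord0_add k (a : 'I_n.+1 -> nat) : sub_ord0 k (fun i => a i + (if i == ord0 then k else 0))%N = a.
Proof. by apply/funext => i; rewrite /sub_ord0 addnK. Qed.

Variables (x : nat -> R) (t K e Y : R) (j : nat).
Hypothesis x0 : forall l, 0 <= x l.
Hypothesis x00 : 0 < x 0.
Hypothesis t0 : 0 < t.
Hypothesis K0 : 0 < K.
Hypothesis j0 : (0 < j)%N.
Hypothesis tx : forall l, t * x l ^+ 2 < 1.
Hypothesis prod_le : forall l : nat, \prod_(v < l.+1) (1 - t * x v ^+ 2)^-1 <= K * l.+1%:R `^ e.
Local Notation k := (2 ^ j)%N.
Local Notation kR := (k%:R : R).
Hypothesis Yb : \sum_(l < n.+1) (x l * l.+1%:R `^ (e / (2 * kR))) `^ (2 * kR / (kR - 1)) <= Y.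

Definition degC : R :=
  bh_const R j `^ ((kR + 1) / (2 * kR)) * K `^ 2^-1 * (Y ^+ k) `^ ((kR - 1) / (2 * kR)).

Definition degrho : R := 4 `^ (2 * kR)^-1 * t `^ (- 2^-1).

(* Multiplication by [v_0 ^ k] raises the degree to at least [k], so that every monomial
   has a word of [k] letters to split off; this costs the factor [(x 0 ^+ k)^-1]. *)
Lemma degree_bound (f : linfty R -> C^o) (M : R) D m : holo f -> (m <= D)%N ->
  (forall z, N z < 1 -> normc (f z) <= M) ->
  \sum_(a : A D | deg a == m) normc (gcoef sg f (ex a)) * xmonomial x a <=
  (x 0 ^+ k)^-1 * (degC * ((expR 1 * (m + k)%:R) ^+ k * (expR 1 * M) * degrho ^+ m)).
Proof.
move=> fh mD fM; have [d dE] : exists d, d = (m + k)%N by eexists.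
pose F (b : 'I_n.+1 -> nat) := normc (gcoef sg f b) * \prod_(v < n.+1) x v ^+ b v.
rewrite (degsum_type F (d' := d) mD); last by rewrite dE leq_addr.
pose F' b := F (sub_ord0 k b).
have -> : \sum_(a : A d | deg a == m) F (ex a) =
    \sum_(a : A d | deg a == m) F' (fun i => a i + (if i == ord0 then k else 0))%N.
  by apply: eq_bigr => a _; rewrite /F' sub_ord0_add.
rewrite -(degsum_shift F' dE).
pose c (b : A d) := if (deg b == (m + k)%N) && (k <= b ord0)%N then gcoef sg f (sub_ord0 k (ex b)) else 0.
have ch : homogeneous d c by move=> a /negbTE am; rewrite /c -dE am.
have cE v : peval c v = v ord0 ^+ k * homog sg d f v m.
  pose G b := gcoef sg f (sub_ord0 k b) * mono v b.
  rewrite /peval (eq_bigr (fun b : A d => if (deg b == (m + k)%N) && (k <= b ord0)%N then G (ex b) else 0)); last first.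
    by move=> b _; rewrite /c /G; case: ifP; rewrite ?mul0r.
  rewrite -big_mkcond/= (degsum_shift G dE) /homog mulr_sumr; apply: eq_bigr => a _.
  rewrite /G sub_ord0_add mulrCA; congr (_ * _).
  rewrite /mono (bigD1 ord0)//= [in RHS](bigD1 ord0)//= exprD.
  rewrite (eq_bigr (fun i => v i ^+ a i)); last by move=> i /negbTE ->; rewrite addn0.
  by rewrite [v ord0 ^+ a ord0 * _]mulrC -mulrA.
have cB v : (forall l, normc (v l) <= 1) -> normc (peval c v) <= expR 1 * M.
  move=> v1; rewrite cE normcM normcX -[leRHS]mul1r; apply: ler_pM; rewrite ?exprn_ge0 ?normc_ge0//.
    by rewrite exprn_ile1 ?normc_ge0.
  by apply: homog_bound => //; rewrite dE leq_addr.
have h := homog_sum_bound x0 t0 tx prod_le j0 (esym dE) K0 ch cB Yb.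
rewrite -dE; apply: le_trans (ler_wpM2l _ h); last by rewrite invr_ge0 exprn_ge0// ltW.
rewrite mulr_sumr [leRHS]big_mkcond [leLHS]big_mkcond/=; apply: ler_sum => b _.
have Z0 : 0 <= (x 0 ^+ k)^-1 * (normc (c b) * xmonomial x b).
  by rewrite !mulr_ge0 ?normc_ge0 ?xmonomial_ge0// invr_ge0 exprn_ge0// ltW.
case: (boolP (deg b == d)) => //= bd; case: (boolP (k <= b ord0)%N) => // bk.
rewrite le_eqVlt; apply/orP; left; apply/eqP.
rewrite /F' /F /c -dE bd bk /= mulrCA; congr (_ * _).
rewrite /xmonomial (bigD1 ord0)//= [in RHS](bigD1 ord0)//= mulrA /sub_ord0 eqxx /=.
rewrite -[X in _ = _ * x 0 ^+ X * _](subnKC bk) exprD mulrA mulVf ?mul1r; last first.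
  by rewrite expf_neq0// gt_eqF.
by congr (_ * _); apply: eq_bigr => i /negbTE ->; rewrite subn0.
Qed.

End HolomorphicBound.

(** * Choice of the parameters *)

Section ParameterChoice.
Variable R : realType.

(** Comparison with the telescoping sum of the increments of the power [- a]. *)
Lemma pseries_bound (a : R) : 0 < a ->
  exists C : R, forall n, \sum_(l < n) l.+1%:R `^ (- (1 + a)) <= C.
Proof.
move=> a0; exists (1 + a^-1) => n.
have step (u : nat) : (u.+2%:R : R) `^ (- (1 + a)) <= a^-1 * (u.+1%:R `^ (- a) - u.+2%:R `^ (- a)).
  have u2 : 0 < u.+2%:R :> R by rewrite ltr0n.
  have u1 : 0 < u.+1%:R :> R by rewrite ltr0n.
  rewrite ler_pdivlMl//.
  rewrite opprD powRD; last by apply/implyP => _; rewrite gt_eqF.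
  rewrite powR_inv1 ?ler0n// mulrA.
  have -> : u.+1%:R `^ (- a) = (u.+2%:R `^ (- a)) * expR (- a * ln (u.+1%:R / u.+2%:R)) :> R.
    rewrite /powR !gt_eqF// -expRD -mulrDr; congr (expR (_ * _)).
    by rewrite ln_div ?posrE//; ring.
  rewrite -[X in _ * expR _ - X]mulr1 -mulrBr mulrC ler_wpM2l ?powR_ge0//.
  rewrite lerBrDr addrC; apply: le_trans (expR_ge1Dx _).
  rewrite lerD2l mulNr -mulrN ler_wpM2l ?(ltW a0)// lerNr.
  have := @le_ln1Dx R (- u.+2%:R^-1).
  rewrite ltrNl opprK invf_lt1// ltr1n => /(_ isT).
  suff -> : 1 + - u.+2%:R^-1 = u.+1%:R / u.+2%:R :> R by [].
  apply: (mulIf (_ : u.+2%:R != 0)); first by rewrite gt_eqF.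
  by rewrite mulrBl mul1r mulVf ?gt_eqF// divfK ?gt_eqF// -natr1 addrK.
case: n => [|n]; first by rewrite big_ord0 addr_ge0 ?invr_ge0 ?ltW.
rewrite big_ord_recl powR1 lerD2l.
apply: (@le_trans _ _ (\sum_(i < n) a^-1 * (i.+1%:R `^ (- a) - i.+2%:R `^ (- a)))).
  by apply: ler_sum => i _; exact: step.
rewrite -mulr_sumr -[leRHS]mulr1 ler_wpM2l ?invr_ge0 ?(ltW a0)//.
rewrite -(big_mkord xpredT (fun i => i.+1%:R `^ (- a) - i.+2%:R `^ (- a))).
rewrite (eq_bigr (fun i => - (i.+2%:R `^ (- a) - i.+1%:R `^ (- a)))); last by move=> i _; rewrite opprB.
by rewrite sumrN telescope_sumr// powR1 opprB lerBlDr lerDl powR_ge0.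
Qed.

Lemma ln_le_powR (d u : R) : 0 < d -> 0 < u -> ln u <= d^-1 * u `^ d.
Proof.
move=> d0 u0; rewrite ler_pdivlMl// /powR gt_eqF//.
by apply: le_trans (expR_ge1Dx _); rewrite lerDr.
Qed.

Variables (x : nat -> R) (A C1 : R).
Hypothesis x0 : forall l, 0 <= x l.
Hypothesis xdecr : forall l m, (l <= m)%N -> x m <= x l.
Hypothesis x1 : x 0 < 1.
Hypothesis Age0 : 0 <= A.
Hypothesis Alt1 : A < 1.
Hypothesis C10 : 0 < C1.
Hypothesis xsum : forall n, \sum_(l < n.+1) x l ^+ 2 <= A * ln n.+1%:R + C1.

Lemma sq_mean_le l : x l ^+ 2 <= (A * ln l.+1%:R + C1) / l.+1%:R.
Proof.
rewrite ler_pdivlMr ?ltr0n//; apply: le_trans (xsum l).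
rewrite -[in leLHS](card_ord l.+1) mulr_natr -sumr_const; apply: ler_sum => i _.
by rewrite lerXn2r ?nnegrE// xdecr// -ltnS.
Qed.

Lemma sq_powR_le (d : R) : 0 < d -> exists2 C, 0 < C & forall l, x l ^+ 2 <= C * l.+1%:R `^ (d - 1).
Proof.
move=> d0; exists (A / d + C1); first by rewrite ltr_wpDl// divr_ge0// ltW.
move=> l; apply: le_trans (sq_mean_le l) _.
have l0 : 0 < l.+1%:R :> R by rewrite ltr0n.
rewrite powRD; last by apply/implyP => _; rewrite gt_eqF.
rewrite powR_inv1 ?ler0n// mulrA ler_pM2r ?invr_gt0//.
rewrite mulrDl; apply: lerD.
  by rewrite -mulrA ler_wpM2l// ln_le_powR.
rewrite ler_peMr ?(ltW C10)// //; apply: (@le_trans _ _ (l.+1%:R `^ 0)); first by rewrite powRr0.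
by apply: (ler_powR _ (ltW d0)); rewrite ler1n.
Qed.

Lemma sq_small (h : R) : 0 < h -> exists v0, forall v, (v0 <= v)%N -> x v ^+ 2 <= h.
Proof.
move=> h0; have [C Cp CP] := @sq_powR_le 2^-1 ltac:(lra).
have [v0 v0P] : exists v0 : nat, (C / h) ^+ 2 <= v0%:R.
  by exists (Num.truncn ((C / h) ^+ 2)).+1; rewrite ltW// truncnS_gt.
exists v0 => v vv; apply: le_trans (CP v) _.
have v1 : 0 < v.+1%:R :> R by rewrite ltr0n.
rewrite (_ : 2^-1 - 1 = - 2^-1 :> R); last by field.
rewrite powRN ler_pdivrMr ?powR_gt0// mulrC -ler_pdivrMr//.
have Ch : 0 <= C / h by rewrite divr_ge0// ltW.
rewrite powR12_sqrt// -[leLHS](ger0_norm Ch) -sqrtr_sqr; apply: ler_wsqrtr.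
by apply: le_trans v0P _; rewrite ler_nat ltnW.
Qed.

(** From some [v0] on, [u = t * x v ^+ 2] is at most [h], and [1 / (1 - u) <= expR (u / (1 - h))].
    The product is then at most the exponential of [t / (1 - h)] times a sum that grows like [A]
    times a logarithm; the first [v0] factors go into [K]. *)
Lemma product_params : exists t K e : R, [/\ 1 < t, 0 < K, 0 <= e < 1,
  forall l, t * x l ^+ 2 < 1 &
  forall l : nat, \prod_(v < l.+1) (1 - t * x v ^+ 2)^-1 <= K * l.+1%:R `^ e].
Proof.
have a0 := Age0; have a1 := Alt1.
have xx l : x l ^+ 2 <= x 0 ^+ 2 by rewrite lerXn2r ?nnegrE// xdecr.
have X1 : x 0 ^+ 2 < 1 by rewrite expr_lt1.
have X0 : 0 <= x 0 ^+ 2 by exact: sqr_ge0.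
(* With [A = 1 - 4 * h] and [t <= 1 + h / 2] the final exponent [t * A / (1 - h)] is at most
   [(1 + A) / 2], below 1. *)
pose h : R := (1 - A) / 4; have h0 : 0 < h by rewrite divr_gt0// subr_gt0.
pose th : R := (1 + x 0 ^+ 2) / 2.
have [t [t1 tx tA]] : exists t : R, [/\ 1 < t, t * x 0 ^+ 2 <= th & t * A <= (1 + A) / 2 * (1 - h)].
  exists (Num.min 2 (Num.min (1 + (1 - x 0 ^+ 2) / 2) (1 + h / 2))).
  split; first by rewrite !lt_min; apply/and3P; split; lra.
    set t := Num.min _ _; have t2 : t <= 1 + (1 - x 0 ^+ 2) / 2 by rewrite /t !ge_min lexx !orbT.
    apply: (@le_trans _ _ ((1 + (1 - x 0 ^+ 2) / 2) * x 0 ^+ 2)); first exact: ler_wpM2r.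
    rewrite /th; move: (x 0 ^+ 2) X0 X1 => X *; nra.
  set t := Num.min _ _; have t2 : t <= 1 + h / 2 by rewrite /t !ge_min lexx !orbT.
  apply: (@le_trans _ _ ((1 + h / 2) * A)); first exact: ler_wpM2r.
  have -> : A = 1 - 4 * h by rewrite /h; field.
  have := sqr_ge0 h; move: h0; move: (h) => y y0 y2; nra.
have t0 : 0 < t by lra.
have h1 : h < 1.
  by rewrite ltr_pdivrMr//; lra.
have th1 : th < 1 by rewrite /th; lra.
have th0 : 0 <= th by rewrite /th; lra.
have [v0 v0P] := @sq_small (h / t) ltac:(by rewrite divr_gt0).
pose e : R := (1 + A) / 2; pose K := (1 - th)^-1 ^+ v0 * expR (t / (1 - h) * C1).
have thV : 1 <= (1 - th)^-1 by rewrite invf_ge1; lra.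
exists t, K, e; split=> //.
- by rewrite /K mulr_gt0 ?expR_gt0// exprn_gt0// invr_gt0; lra.
- by rewrite /e; apply/andP; split; lra.
- move=> l; apply: (@le_lt_trans _ _ th) => //; apply: le_trans tx.
  by rewrite ler_wpM2l// ltW.
move=> l; have th_h : 0 <= t / (1 - h) by rewrite divr_ge0//; lra.
have fac v : 0 <= (1 - t * x v ^+ 2)^-1 <= (if (v < v0)%N then (1 - th)^-1 else 1) * expR (t / (1 - h) * x v ^+ 2).
  have tv : t * x v ^+ 2 <= th by apply: le_trans tx; rewrite ler_wpM2l// ltW.
  have tv0 : 0 <= t * x v ^+ 2 by rewrite mulr_ge0 ?sqr_ge0// ltW.
  apply/andP; split; first by rewrite invr_ge0; lra.
  case: ltnP => vv.
    rewrite -[leLHS]mulr1; apply: ler_pM => //; first by rewrite invr_ge0; lra.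
      by rewrite lef_pV2 ?posrE; lra.
    by apply: le_trans (expR_ge1Dx _); rewrite lerDl mulr_ge0 ?sqr_ge0.
  have tvh : t * x v ^+ 2 <= h by rewrite mulrC -ler_pdivlMr// v0P.
  rewrite mul1r; set u := t * x v ^+ 2 in tv tv0 tvh *.
  apply: (@le_trans _ _ (expR (u / (1 - u)))).
    apply: le_trans (expR_ge1Dx _); rewrite le_eqVlt; apply/orP; left; apply/eqP; field.
    by rewrite gt_eqF//; lra.
  have -> : t / (1 - h) * x v ^+ 2 = u / (1 - h) by rewrite /u mulrAC.
  rewrite ler_expR; apply: ler_wpM2l => //; rewrite lef_pV2 ?posrE; lra.
apply: (@le_trans _ _ (\prod_(v < l.+1) ((if (v < v0)%N then (1 - th)^-1 else 1) * expR (t / (1 - h) * x v ^+ 2)))).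
  by apply: ler_prod => v _; exact: fac.
rewrite big_split/= -expR_sum -mulr_sumr /K -[leRHS]mulrA; apply: ler_pM.
- by apply: prodr_ge0 => v _; case: ifP => //; lra.
- exact: expR_ge0.
- have P m : \prod_(v < m) (if (v < v0)%N then (1 - th)^-1 else 1) = (1 - th)^-1 ^+ minn m v0.
    elim: m => [|m IH]; first by rewrite big_ord0 min0n.
    rewrite big_ord_recr/= IH; case: ltnP => mv.
      by rewrite -exprSr (minn_idPl mv).
    by rewrite mulr1 (minn_idPr (leqW mv)).
  by rewrite P ler_weXn2l// geq_minr.
rewrite /powR gt_eqF ?ltr0n// -expRD ler_expR.
apply: (@le_trans _ _ (t / (1 - h) * (A * ln l.+1%:R + C1))).
  by rewrite ler_wpM2l ?xsum.
rewrite mulrDr addrC lerD2l mulrA ler_wpM2r ?ln_ge0 ?ler1n//.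
rewrite mulrAC ler_pdivrMr /e; lra.
Qed.

(** The inequality is [4 < t ^+ k] raised to the power [1 / (2 * k)]; Bernoulli's inequality
    provides it for [k > 3 / (t - 1)]. *)
Lemma exists_pow2 (t : R) : 1 < t -> exists j, (0 < j)%N /\
  4 `^ (2 * (2 ^ j)%:R)^-1 * t `^ (- 2^-1) < 1.
Proof.
move=> t1; have t0 : 0 < t by lra.
pose j := (Num.truncn (3 / (t - 1))).+1; exists j; split=> //.
have k0 : 0 < (2 ^ j)%:R :> R by rewrite ltr0n expn_gt0.
have jb : 3 / (t - 1) < (2 ^ j)%:R.
  by apply: lt_trans (truncnS_gt _) _; rewrite ltr_nat ltn_expl.
have tk : 4 < t ^+ (2 ^ j).
  have h : 1 + (2 ^ j)%:R * (t - 1) <= t ^+ (2 ^ j).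
    elim: (2 ^ j)%N => [|k IH]; first by rewrite mul0r addr0.
    rewrite exprS; apply: le_trans (ler_wpM2l (ltW t0) IH).
    have : 0 <= k%:R * (t - 1) ^+ 2 by rewrite mulr_ge0 ?sqr_ge0.
    rewrite -natr1; lra.
  apply: lt_le_trans h; rewrite -ltrBlDl; move: jb; rewrite ltr_pdivrMr; lra.
have kR0 : 0 < (2 * (2 ^ j)%:R)^-1 :> R by rewrite invr_gt0 mulr_gt0.
rewrite powRN ltr_pdivrMr ?powR_gt0// mul1r.
have -> : t `^ 2^-1 = (t ^+ (2 ^ j)) `^ (2 * (2 ^ j)%:R)^-1.
  rewrite -powR_mulrn ?(ltW t0)// -powRrM; congr (_ `^ _); field; by rewrite gt_eqF.
by rewrite gt0_ltr_powR ?nnegrE// exprn_ge0// ltW.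
Qed.

(** Here [e < 1] pays off: since [x l ^+ 2] is [O(l ^ (d - 1))] for every positive [d], the choice
    [d = (1 - e) / (2 * k)] makes the summand [O(l ^ (- (1 + a)))] with
    [a = (1 - e) / (2 * (k - 1))] positive. *)
Lemma weighted_sum_bound (e k : R) : 0 <= e < 1 -> 2 <= k -> exists Y, forall n,
  \sum_(l < n) (x l * l.+1%:R `^ (e / (2 * k))) `^ (2 * k / (k - 1)) <= Y.
Proof.
move=> /andP[e0 e1] k2; pose d := (1 - e) / (2 * k).
have k0 : 0 < k by lra.
have k1 : 0 < k - 1 by lra.
have d0 : 0 < d by rewrite divr_gt0//; lra.
have [C C0 CP] := sq_powR_le d0.
pose a := (1 - e) / (2 * (k - 1)); have a0 : 0 < a by rewrite divr_gt0//; lra.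
have [C' C'P] := pseries_bound a0.
exists (C `^ (k / (k - 1)) * C') => n.
apply: le_trans (ler_wpM2l (powR_ge0 _ _) (C'P n)); rewrite mulr_sumr; apply: ler_sum => l _.
have l0 : 0 < l.+1%:R :> R by rewrite ltr0n.
rewrite (_ : 2 * k / (k - 1) = 2 * (k / (k - 1))); last by rewrite mulrA.
rewrite powRrM powR_mulrn ?mulr_ge0 ?powR_ge0// exprMn -[(_ `^ _) ^+ 2]powR_mulrn ?powR_ge0// -powRrM.
have -> : l.+1%:R `^ (- (1 + a)) = (l.+1%:R `^ (d - 1) * l.+1%:R `^ (e / (2 * k) * 2)) `^ (k / (k - 1)) :> R.
  rewrite -powRD; last by apply/implyP => _; rewrite gt_eqF.
  rewrite -powRrM; congr (_ `^ _); rewrite /a /d; field.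
  by rewrite !gt_eqF.
rewrite -powRM ?(ltW C0) ?mulr_ge0 ?powR_ge0//.
have kk : 0 <= k / (k - 1) by rewrite divr_ge0// ltW.
apply: (ge0_ler_powR kk); rewrite ?nnegrE ?mulr_ge0 ?powR_ge0 ?sqr_ge0 ?(ltW C0)//.
by rewrite mulrA ler_wpM2r ?powR_ge0.
Qed.

End ParameterChoice.

(** * The decreasing rearrangement and multi-indices *)

Section Rearrangement.
Variable R : realType.
Implicit Types z : linfty R.
Local Notation N := (@linfty_norm R).
Local Notation tail z J := [set normc (z j) | j in [set j | j \notin J]].

Lemma fresh_nat (J : {fset nat}) : exists j, j \notin J.
Proof.
exists (\max_(j <- J) j).+1; apply/negP => h.
by have := @leq_bigmax_seq _ (enum_fset J) xpredT id _ h isT; rewrite ltnn.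
Qed.

Lemma tail_has_sup z (J : {fset nat}) : has_sup (tail z J).
Proof.
split; first by have [j jJ] := fresh_nat J; exists (normc (z j)); exists j.
by exists (N z) => _ [j _ <-]; exact: le_linfty_norm.
Qed.

Lemma tail_sup_ge0 z (J : {fset nat}) : 0 <= sup (tail z J).
Proof.
have [j jJ] := fresh_nat J; apply: (le_trans (normc_ge0 (z j))).
by apply: ub_le_sup; [exact: (tail_has_sup z J).2|exists j].
Qed.

Local Notation sups z n := [set sup (tail z J) | J in [set J : {fset nat} | (#|` J| < n)%N]].

Lemma sups_has_inf z n : (0 < n)%N -> has_inf (sups z n).
Proof.
move=> n0; split; first by exists (sup (tail z fset0)); exists fset0 => //=; rewrite cardfs0.
by exists 0 => _ [J _ <-]; exact: tail_sup_ge0.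
Qed.

Lemma decr_rearr_ge0 z n : 0 <= decr_rearr z n.
Proof.
have [->|n0] := posnP n.
  by rewrite /decr_rearr (_ : sups z 0 = set0) ?inf0// -subset0 => y [J].
by apply: lb_le_inf; [exact: (sups_has_inf z n0).1|move=> _ [J _ <-]; exact: tail_sup_ge0].
Qed.

Lemma le_decr_rearr z n (c : R) : (0 < n)%N ->
  (forall J : {fset nat}, (#|` J| < n)%N -> exists2 j, j \notin J & c <= normc (z j)) -> c <= decr_rearr z n.
Proof.
move=> n0 h; apply: lb_le_inf; first exact: (sups_has_inf z n0).1.
move=> _ [J /= /h[j jJ cj] <-]; apply: (le_trans cj).
by apply: ub_le_sup; [exact: (tail_has_sup z J).2|exists j].
Qed.

Lemma decr_rearr_le z n (c : R) (J : {fset nat}) : (#|` J| < n)%N ->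
  (forall j, j \notin J -> normc (z j) <= c) -> decr_rearr z n <= c.
Proof.
move=> Jn h; apply: (@le_trans _ _ (sup (tail z J))).
  by apply: ge_inf; [exact: (sups_has_inf z (leq_ltn_trans (leq0n _) Jn)).2|exists J].
by apply: ge_sup; [exact: (tail_has_sup z J).1|move=> _ [j jJ <-]; exact: h].
Qed.

Lemma lt_decr_rearr z n (c : R) (J : {fset nat}) : (#|` J| < n)%N -> c < decr_rearr z n ->
  exists2 j, j \notin J & c < normc (z j).
Proof.
move=> Jn cz; apply: contrapT => h; move: cz; apply/negP; rewrite -leNgt.
apply: (decr_rearr_le Jn) => j jJ; rewrite leNgt; apply/negP => cj.
by apply: h; exists j.
Qed.

Lemma decr_rearr_lt z n (c : R) : (0 < n)%N -> decr_rearr z n < c ->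
  exists J : {fset nat}, forall j, j \notin J -> normc (z j) < c.
Proof.
move=> n0 zc; apply: contrapT => h.
move: zc; apply/negP; rewrite -leNgt; apply: le_decr_rearr => // J Jn.
apply: contrapT => h'; apply: h; exists J => j jJ; rewrite ltNge; apply/negP => cj.
by apply: h'; exists j.
Qed.

Lemma decr_rearr_anti z n m : (0 < n)%N -> (n <= m)%N -> decr_rearr z m <= decr_rearr z n.
Proof.
move=> n0 nm; have m0 := leq_trans n0 nm.
apply: lb_le_inf; [exact: (sups_has_inf z n0).1|move=> _ [J /= Jn <-]].
by apply: ge_inf; [exact: (sups_has_inf z m0).2|exists J => //=; exact: leq_trans nm].
Qed.

Lemma decr_rearr1 z : decr_rearr z 1 <= N z.
Proof. by apply: (@decr_rearr_le _ _ _ fset0); rewrite ?cardfs0// => j _; exact: le_linfty_norm. Qed.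

(** Initial segments of coordinates eventually contain every finite support, so these are sorted.
    Their entries are dominated by the rearrangement of the whole sequence, whose large entries may
    lie further out. *)
Lemma sorting z n : exists sg : 'I_n.+1 -> nat, [/\ injective sg,
  forall l, (sg l <= n)%N, forall p, (p <= n)%N -> exists l, sg l = p &
  forall l : 'I_n.+1, normc (z (sg l)) <= decr_rearr z l.+1].
Proof.
pose le p q := normc (z q) <= normc (z p).
have le_tr : transitive le by move=> a b c; rewrite /le => h1 h2; exact: le_trans h1.
have le_tot : total le by move=> a b; rewrite /le; exact: le_total.
pose s := sort le (iota 0 n.+1).
have ss : size s = n.+1 by rewrite size_sort size_iota.
have us : uniq s by rewrite sort_uniq iota_uniq.
have ms p : (p \in s) = (p <= n)%N by rewrite mem_sort mem_iota.
exists (fun l => nth 0%N s l); split.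
- move=> l l' /eqP; rewrite nth_uniq ?ss// => /eqP; exact: val_inj.
- by move=> l; rewrite -ms mem_nth// ss.
- move=> p; rewrite -ms => ps; have pi : (index p s < n.+1)%N by rewrite -ss index_mem.
  by exists (Ordinal pi) => /=; rewrite nth_index.
move=> l; apply: le_decr_rearr => // J Jl.
(* Pigeonhole: [J] cannot contain all of the first [l + 1] sorted positions. *)
have [i il iJ] : exists2 i, (i <= l)%N & nth 0%N s i \notin J.
  apply: contrapT => h; move: Jl; apply/negP; rewrite -leqNgt.
  have -> : l.+1 = size (take l.+1 s) by rewrite size_takel// ss.
  apply: uniq_leq_size; first exact: take_uniq.
  move=> p pt; case: (nthP 0%N pt) => i; rewrite size_takel ?ss// => il <-.
  rewrite nth_take//; apply: contrapT => /negP iJ; apply: h; exists i => //.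
exists (nth 0%N s i) => //.
have srt : sorted le s by exact: sort_sorted.
move: il; rewrite leq_eqVlt => /orP[/eqP ->//|il].
exact: (sorted_ltn_nth le_tr 0%N srt i l ltac:(by rewrite inE ss; exact: ltn_trans (ltn_ord l)) ltac:(by rewrite inE ss)).
Qed.

End Rearrangement.

(** * Multi-indices supported on finitely many letters *)

Section Indices.
Variables (R : realType) (n : nat) (sg : 'I_n -> nat).
Hypothesis sg_inj : injective sg.
Local Notation A d := {ffun 'I_n -> 'I_d.+1}.

Definition multi_index_of d (a : A d) : multi_index :=
  [fsfun k in [fset sg i | i in 'I_n]%fset => (\sum_i a i * (k == sg i))%N | 0%N].

Lemma multi_index_ofE d (a : A d) i : multi_index_of a (sg i) = a i.
Proof.
rewrite /multi_index_of fsfunE in_imfset//= (bigD1 i)//= eqxx muln1 big1 ?addn0// => j ji.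
by rewrite (inj_eq sg_inj) eq_sym (negbTE ji) muln0.
Qed.

Lemma multi_index_of_out d (a : A d) k : (forall i, sg i != k) -> multi_index_of a k = 0%N.
Proof.
move=> h; rewrite /multi_index_of fsfunE; case: ifP => // _.
by rewrite big1// => i _; rewrite eq_sym (negbTE (h i)) muln0.
Qed.

Lemma multi_index_of_injective d : injective (@multi_index_of d).
Proof.
by move=> a b ab; apply/ffunP => i; apply: val_inj; rewrite /= -!multi_index_ofE ab.
Qed.

Lemma multi_index_of_onto d (al : multi_index) : (forall k, k \in finsupp al -> exists i, sg i = k) ->
  (forall i, al (sg i) <= d)%N -> exists a : A d, multi_index_of a = al.
Proof.
move=> h1 h2; exists [ffun i => inord (al (sg i))]; apply/fsfunP => k.
case: (pselect (exists i, sg i = k)) => [[i <-]|h]; first by rewrite multi_index_ofE ffunE inordK// ltnS.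
rewrite multi_index_of_out; last by move=> i; apply/eqP => e; apply: h; exists i.
by apply/esym/eqP; rewrite -[_ == _]negbK -mem_finsupp; apply/negP => /h1.
Qed.

Lemma big_multi_index_of (T : Type) (idx : T) (op : Monoid.com_law idx) d (a : A d) (F : nat -> nat -> T) :
  (forall k, F k 0%N = idx) ->
  \big[op/idx]_(k <- finsupp (multi_index_of a)) F k (multi_index_of a k) = \big[op/idx]_i F (sg i) (a i).
Proof.
move=> F0; transitivity (\big[op/idx]_(k <- [seq sg i | i <- index_enum 'I_n]) F k (multi_index_of a k)); last first.
  by rewrite big_map; apply: eq_bigr => i _; rewrite multi_index_ofE.
rewrite [RHS](bigID (fun k => k \in finsupp (multi_index_of a)))/= [X in op _ X]big1 ?Monoid.mulm1; last first.
  by move=> k; rewrite memNfinsupp => /eqP ->.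
rewrite -[RHS]big_filter; apply: perm_big; apply: uniq_perm; first exact: fset_uniq.
  by rewrite filter_uniq// map_inj_uniq// index_enum_uniq.

move=> k; rewrite mem_filter; case kf: (k \in finsupp (multi_index_of a)) => //=.
apply/esym/mapP; apply: contrapT => h; move: kf; rewrite mem_finsupp multi_index_of_out ?eqxx// => i.
by apply/eqP => ik; apply: h; exists i => //; rewrite mem_index_enum.
Qed.

Lemma monomial_multi_index_of d (a : A d) (z : linfty R) :
  monomial (multi_index_of a) z = \prod_i z (sg i) ^+ a i.
Proof. by rewrite /monomial (big_multi_index_of *%R a (F := fun k m => z k ^+ m)). Qed.

Lemma mderive_Dw (al : multi_index) (f : linfty R -> R[i]^o) :
  mderive al f = Dw (flatten [seq nseq (al k) k | k <- finsupp al]) f.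
Proof.
rewrite /mderive; elim: (finsupp al : seq nat) => [//|k s IH] /=.
rewrite Dw_cat -IH; move: (foldr _ _ _) => g.
by elim: (al k) => [//|m IHm] /=; rewrite IHm.
Qed.

(** [mderive] differentiates in the order of the support, [wordof] in that of the letters; the two
    words are permutations of each other, and [Dw_perm] identifies the derivatives at 0. *)
Lemma mcoef_multi_index_of d (a : A d) (f : linfty R -> R[i]^o) : holo f ->
  mcoef f (multi_index_of a) = gcoef sg f (fun i => nat_of_ord (a i)).
Proof.
move=> fh; rewrite /mcoef /gcoef mderive_Dw; congr (_ / _%:R).
  apply: (Dw_perm fh _); last by rewrite linfty_norm0.
  apply/permP => P; rewrite count_wordof count_flatten -map_comp sumnE big_map.
  rewrite (eq_bigr (fun k => multi_index_of a k * P k)%N); last by move=> k _ /=; rewrite count_nseq mulnC.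
  by rewrite (big_multi_index_of addn a (F := fun k m => m * P k)%N).
by rewrite /mfact (big_multi_index_of muln a (F := fun k m => m`!)).
Qed.

End Indices.

Section Limsup.
Variables (R : realType) (u : nat -> R) (c : R).

Lemma limsup_lt : (limn_esup (fun n => (u n)%:E) < c%:E)%E ->
  exists2 A, A < c & exists n0, forall n, (n0 <= n)%N -> u n <= A.
Proof.
move=> /ereal_inf_lt[_ [V [n0 _ n0V] <-]].
have h n : (n0 <= n)%N -> ((u n)%:E <= ereal_sup [set (u n)%:E | n in V])%E.
  by move=> nn; apply: ereal_sup_ubound; exists n => //; exact: n0V.
case: ereal_sup h => [r|//|] h; last by have := h n0 (leqnn _).
rewrite lte_fin => rc; exists r => //; exists n0 => n nn.
by rewrite -lee_fin; exact: h.
Qed.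

Lemma limsup_le : (forall e, 0 < e -> exists n0, forall n, (n0 <= n)%N -> u n <= c + e) ->
  (limn_esup (fun n => (u n)%:E) <= c%:E)%E.
Proof.
move=> h; apply/lee_addgt0Pr => e e0; have [n0 n0P] := h e e0.
apply: ge_ereal_inf; exists (ereal_sup [set (u n)%:E | n in [set n | (n0 <= n)%N]]).
  by exists [set n | (n0 <= n)%N] => //; exists n0.
by apply: ge_ereal_sup => _ [n nn <-]; rewrite -EFinD lee_fin; exact: n0P.
Qed.

End Limsup.

(** * Sufficiency of the limsup condition *)

Section PartOne.
Variables (R : realType) (z : linfty R).
Local Notation N := (@linfty_norm R).
Local Notation C := R[i].
Local Notation A n d := {ffun 'I_n.+1 -> 'I_d.+1}.
Hypothesis z1 : N z < 1.
Hypothesis zlim : (limn_esup (fun n => (log_mean_sq z n)%:E) < 1%:E)%E.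

(* The value at [0] is raised to at least [1/2] because the degree bound divides by it. *)
Definition majorant (l : nat) : R := if l is 0 then Num.max (decr_rearr z 1) 2^-1 else decr_rearr z l.+1.

Lemma majorant_ge l : decr_rearr z l.+1 <= majorant l.
Proof. by case: l => [|l] //=; rewrite le_max lexx. Qed.

Lemma majorant_ge0 l : 0 <= majorant l.
Proof. exact: le_trans (decr_rearr_ge0 z _) (majorant_ge l). Qed.

Lemma majorant_anti l m : (l <= m)%N -> majorant m <= majorant l.
Proof.
case: m => [|m]; first by rewrite leqn0 => /eqP ->.
by move=> lm; apply: le_trans (majorant_ge l); exact: decr_rearr_anti.
Qed.

Lemma majorant0_gt0 : 0 < majorant 0.
Proof. by rewrite lt_max invr_gt0 ltr0n orbT. Qed.

Lemma majorant0_lt1 : majorant 0 < 1.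
Proof. by rewrite gt_max invf_lt1// ltr1n andbT (le_lt_trans (decr_rearr1 z)). Qed.

Lemma majorant_sum : exists A0 C1, [/\ 0 <= A0, A0 < 1, 0 < C1 &
  forall n, \sum_(l < n.+1) majorant l ^+ 2 <= A0 * ln n.+1%:R + C1].
Proof.
have [a a1 [n0 n0P]] := limsup_lt zlim.
exists (Num.max a 0), (n0%:R + 3); split; first by rewrite le_max lexx orbT.
- by rewrite gt_max a1 ltr01.
- by rewrite ltr_wpDl.
move=> n.
have dr1 l : decr_rearr z l.+1 ^+ 2 <= 1.
  rewrite expr_le1// ?decr_rearr_ge0//; apply: le_trans (decr_rearr_anti z _ (ltn0Sn l)) _ => //.
  by apply: le_trans (decr_rearr1 z) _; exact: ltW.
have h : \sum_(l < n.+1) majorant l ^+ 2 <= 1 + \sum_(l < n.+1) decr_rearr z l.+1 ^+ 2.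
  rewrite big_ord_recl [in leRHS]big_ord_recl /= lerD//.
    by have := ltW majorant0_lt1; rewrite -(expr_le1 (n := 2))// majorant_ge0.
  by rewrite lerDr sqr_ge0.
apply: le_trans h _; have ln0 : 0 <= Num.max a 0 * ln n.+1%:R.
  by rewrite mulr_ge0 ?ln_ge0 ?ler1n// le_max lexx orbT.
(* The logarithm has to be positive, hence an index of at least 2. For fewer terms each square is at
   most 1, which the constant [n0 + 3] covers. *)
case: (leqP (n0 + 2) n.+1) => nn; last first.
  apply: (@le_trans _ _ (1 + n.+1%:R)).
    rewrite lerD2l -[X in _ <= X%:R](card_ord n.+1) -sumr_const; apply: ler_sum => l _; exact: dr1.
  have : n.+1%:R <= (n0 + 2)%:R :> R by rewrite ler_nat ltnW.
  by rewrite natrD; lra.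
have n1 : (1 < n.+1)%N by apply: leq_trans nn; rewrite leq_addl.
have lnp : 0 < ln n.+1%:R :> R by rewrite ln_gt0// ltr1n.
have := n0P n.+1 (leq_trans (leq_addr _ _) nn).
rewrite /log_mean_sq ler_pdivrMl// big_add1 big_mkord /= mulrC => h.
have : a * ln n.+1%:R <= Num.max a 0 * ln n.+1%:R by rewrite ler_wpM2r ?(ltW lnp)// le_max lexx.
have : 0 <= n0%:R :> R by [].
move: h ln0; set s := \sum_(_ < _) _; lra.
Qed.

(** All parameters are fixed by [z] alone, before the letters, the degree and [f] are given; summing
    [degree_bound] over the degrees then gives a uniform bound. *)
Lemma coef_bound (M : R) : exists2 T : R, 0 <= T & forall n (sg : 'I_n.+1 -> nat) (f : linfty R -> C^o) d,
  injective sg -> (forall l : 'I_n.+1, normc (z (sg l)) <= decr_rearr z l.+1) -> holo f ->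
  (forall w, N w < 1 -> normc (f w) <= M) ->
  \sum_(a : A n d | (deg a <= d)%N) normc (gcoef sg f (fun i => nat_of_ord (a i)) * \prod_i z (sg i) ^+ a i) <= T.
Proof.
have [A0 [C1 [a0 a1 c1 xs]]] := majorant_sum.
have [t [K [e [t1 K0 e01 tx pl]]]] := product_params majorant_ge0 majorant_anti majorant0_lt1 a0 a1 c1 xs.
have [j [j0 rho1]] := exists_pow2 t1.
have k2 : 2 <= (2 ^ j)%:R :> R by rewrite ler_nat -{1}(expn1 2) leq_exp2l.
have [Y YP] := weighted_sum_bound majorant_ge0 majorant_anti a0 c1 xs e01 k2.
set rho := 4 `^ _ * _ in rho1.
have rho0 : 0 <= rho by rewrite mulr_ge0 ?powR_ge0.
have [C0 [C00 C0P]] := @poly_geo_sum R rho (2 ^ j) ltac:(by rewrite rho0 rho1).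
have t0 : 0 < t by apply: lt_trans t1.
pose k := (2 ^ j)%N.
pose B := (majorant 0 ^+ k)^-1 * (degC K Y j * (expR 1 ^+ k * (expR 1 * M))).
exists (`|B| * C0); first by rewrite mulr_ge0.
move=> n sg f d sgi zs fh fM.
have step (a : A n d) : normc (gcoef sg f (fun i => nat_of_ord (a i)) * \prod_i z (sg i) ^+ a i) <=
    normc (gcoef sg f (fun i => nat_of_ord (a i))) * xmonomial majorant a.
  rewrite normcM normc_prod ler_wpM2l ?normc_ge0//; apply: ler_prod => i _.
  by rewrite normc_ge0/= normcX lerXn2r ?nnegrE ?normc_ge0 ?majorant_ge0// (le_trans (zs i))// majorant_ge.
apply: le_trans (ler_sum _ (fun a _ => step a)) _.
rewrite (partition_big (fun a : A n d => inord (deg a) : 'I_d.+1) xpredT)//=.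
apply: (@le_trans _ _ (\sum_(m < d.+1) B * ((m + k)%:R ^+ k * rho ^+ m))).
  apply: ler_sum => m _.
  have md : (m <= d)%N by rewrite -ltnS.
  have := degree_bound sgi majorant_ge0 majorant0_gt0 t0 K0 j0 tx pl (YP n.+1) fh md fM.
  rewrite (eq_bigl (fun a : A n d => deg a == m)); last first.
    move=> a; apply/andP/eqP => [[ad /eqP <-]|->]; first by rewrite inordK.
    by split=> //; apply/eqP/val_inj; rewrite /= inordK.
  move=> h; apply: le_trans h _; rewrite le_eqVlt; apply/orP; left; apply/eqP.
  rewrite /B /degrho -/rho -/k exprMn.
  by move: (_ ^-1) (degC _ _ _) (expR 1 ^+ k) (rho ^+ m) => *; ring.
rewrite -mulr_sumr; apply: le_trans (ler_norm _) _; rewrite normrM ler_wpM2l//.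
rewrite ger0_norm ?C0P// sumr_ge0// => m _.
by rewrite mulr_ge0 ?exprn_ge0.
Qed.

End PartOne.

(** * Partial sums over blocks of multi-indices *)

Section Blocks.
Variable R : realType.
Local Notation N := (@linfty_norm R).
Local Notation C := R[i].
Local Notation A n d := {ffun 'I_n.+1 -> 'I_d.+1}.

Lemma Hoo_holo (f : linfty R -> C^o) : Hoo_ball f ->
  holo f /\ exists M : R, forall w, N w < 1 -> normc (f w) <= M.
Proof.
move=> [fd [M0 [M0r fb]]].
have [M MP] : exists M : R, forall w, N w < 1 -> normc (f w) <= M.
  have Mr : M0 < (complex.Re M0 + 1)%:C%C.
    case: M0 M0r {fb} => a b; rewrite complex_real /= => /eqP ->.
    by rewrite ltcR ltrDl.
  exists (complex.Re M0 + 1) => w w1; rewrite -lecR.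
  by have /= := fb _ Mr w; apply; exact/ball01E.
split; last by exists M.
split=> [w w1|r r1]; first exact/fd/ball01E.
by exists M => w wr; apply: MP; exact: le_lt_trans r1.
Qed.

Definition block n (sg : 'I_n.+1 -> nat) d : {fset multi_index} :=
  [fset multi_index_of sg a | a in [pred a : A n d | (deg a <= d)%N]]%fset.

Lemma sum_block n (sg : 'I_n.+1 -> nat) d (V : nmodType) (F : multi_index -> V) : injective sg ->
  \sum_(al <- block sg d) F al = \sum_(a : A n d | (deg a <= d)%N) F (multi_index_of sg a).
Proof.
move=> sgi; rewrite big_imfset/=; last by move=> a b _ _ /(multi_index_of_injective sgi).
by rewrite big_enum_cond/=; apply: eq_bigl => a; rewrite andbT.
Qed.

Lemma sub_block n (sg : 'I_n.+1 -> nat) d (al : multi_index) : injective sg ->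
  (forall k, k \in finsupp al -> exists i, sg i = k) -> (\sum_(k <- finsupp al) al k <= d)%N ->
  al \in block sg d.
Proof.
move=> sgi h1 h2.
have [|a aE] := @multi_index_of_onto _ sg sgi d al h1.
  move=> i; apply: leq_trans h2; case: (finsuppP al (sg i)) => [//|ki].
  by rewrite (big_fsetD1 (sg i))//= leq_addr.
apply/imfsetP; exists a => //=; move: h2; rewrite -aE.
by rewrite (big_multi_index_of sgi addn a (F := fun k m => m)).
Qed.

Lemma fset_bounds (S : {fset multi_index}) : exists n d, forall al, al \in S ->
  (forall k, k \in finsupp al -> (k <= n)%N) /\ (\sum_(k <- finsupp al) al k <= d)%N.
Proof.
exists (\max_(al <- S) \max_(k <- finsupp al) k), (\max_(al <- S) \sum_(k <- finsupp al) al k)%N => al alS.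
split=> [k kal|].
  apply: leq_trans (@leq_bigmax_seq _ (enum_fset S) xpredT (fun al : multi_index => \max_(k <- finsupp al) k) _ alS isT).
  exact: (@leq_bigmax_seq _ (enum_fset (finsupp al)) xpredT id _ kal isT).
exact: (@leq_bigmax_seq _ (enum_fset S) xpredT (fun al : multi_index => \sum_(k <- finsupp al) al k)%N _ alS isT).
Qed.

Lemma subset_block (S : {fset multi_index}) : exists n d, forall n' d' (sg : 'I_n'.+1 -> nat),
  (n <= n')%N -> (d <= d')%N -> injective sg -> (forall p, (p <= n')%N -> exists l, sg l = p) ->
  {subset S <= block sg d'}.
Proof.
have [n [d nd]] := fset_bounds S; exists n, d => n' d' sg nn dd sgi sgs al alS.
have [h1 h2] := nd _ alS; apply: sub_block => // [k kal|]; last exact: leq_trans dd.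
exact/sgs/(leq_trans (h1 _ kal)).
Qed.

(** Taylor's formula along the line through [v = w / r], which still lies in the ball, at the
    parameter [r]. The error does not depend on the number of letters. *)
Lemma block_taylor n (sg : 'I_n.+1 -> nat) (f : linfty R -> C^o) (M r : R) d (w : 'I_n.+1 -> C) :
  injective sg -> holo f -> (forall z, N z < 1 -> normc (f z) <= M) -> 0 < r < 1 -> N (emb sg w) < r ->
  normc (f (emb sg w) - \sum_(a : A n d | (deg a <= d)%N)
    gcoef sg f (fun i => nat_of_ord (a i)) * \prod_i w i ^+ a i) <= 2 * M * r ^+ d.+1 / (1 - r).
Proof.
move=> sgi fh fM /andP[r0 r1] wr.
have rn : r%:C%C != 0 :> C by rewrite -normc_eq0 normc_real gtr0_norm// gt_eqF.
pose v i := r%:C%C^-1 * w i.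
have ve : r%:C%C *: emb sg v = emb sg w.
  rewrite /emb scaler_sumr; apply: eq_bigr => i _.
  by rewrite scalerA /v mulrA mulfV// mul1r.
have v1 : N (emb sg v) < 1.
  have : r * N (emb sg v) < r by rewrite -[X in X * _](gtr0_norm r0) -normc_real -linfty_normZ ve.
  by rewrite -{2}[r]mulr1 ltr_pM2l.
have [_ h] := homog_taylor d fh v1 fM.
have := h r%:C%C d.+1; rewrite normc_real gtr0_norm// => /(_ r1 (leqnn _)).
rewrite ve; congr (_ <= _); congr (normc (_ - _)).
rewrite [RHS](partition_big (fun a : A n d => inord (deg a) : 'I_d.+1) xpredT)//=.
apply: eq_bigr => m _; rewrite /homog mulr_suml; apply: eq_big => [a|a /eqP am].
  apply/eqP/andP => [->|[ad /eqP <-]]; last by rewrite inordK.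
  by split; [rewrite -ltnS|apply/eqP/val_inj; rewrite /= inordK].
rewrite -mulrA; congr (_ * _).
rewrite -am /deg expr_sum /mono -big_split/=; apply: eq_bigr => i _.
by rewrite -exprMn /v mulrC mulrA mulfV// mul1r.
Qed.

Lemma sum_fset_diff (V : nmodType) (F : multi_index -> V) (S U : {fset multi_index}) : {subset S <= U} ->
  \sum_(al <- U) F al = \sum_(al <- S) F al + \sum_(al <- (U `\` S)%fset) F al.
Proof.
move=> SU; rewrite (big_fsetID _ (mem S) U)/=; congr (_ + _).
  by apply: eq_fbigl => al; rewrite !inE; case alS: (al \in S); rewrite ?andbF// (SU _ alS).
by apply: eq_fbigl => al; rewrite !inE andbC.
Qed.

Lemma expr_small (r e : R) : 0 < r < 1 -> 0 < e -> exists D, forall d, (D <= d)%N -> r ^+ d <= e.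
Proof.
move=> /andP[r0 r1] e0.
have /cvgrPdist_le /(_ e e0) [D _ DP] : (r ^+ n @[n --> \oo] --> (0 : R)).
  by apply: cvg_expr; rewrite gtr0_norm.
by exists D => d /DP; rewrite sub0r normrN ger0_norm// exprn_ge0// ltW.
Qed.

End Blocks.

Section Convergence.
Variables (R : realType) (z : linfty R).
Local Notation N := (@linfty_norm R).
Local Notation C := R[i].

(** The limsup condition forces the rearrangement to tend to 0, so all but finitely many coordinates
    are small and the finite sections of [z] converge to it in norm. *)
Lemma decr_rearr_small (e : R) : N z < 1 ->
  (limn_esup (fun n => (log_mean_sq z n)%:E) < 1%:E)%E -> 0 < e ->
  exists n0, forall n (sg : 'I_n.+1 -> nat), (n0 <= n)%N -> injective sg ->
    (forall p, (p <= n)%N -> exists l, sg l = p) -> N (emb sg (fun i => z (sg i)) - z) <= e.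
Proof.
move=> z1 zlim e0.
have [a [c [a0 a1 c0 xs]]] := majorant_sum z1 zlim.
have e20 : 0 < (e / 2) ^+ 2 by rewrite exprn_gt0// divr_gt0.
have [v0 v0P] := sq_small (majorant_ge0 z) (@majorant_anti _ z) a0 c0 xs e20.
have sm : decr_rearr z v0.+1 < e.
  apply: (@le_lt_trans _ _ (e / 2)); last by lra.
  have := v0P v0 (leqnn _); rewrite ler_sqr ?nnegrE ?majorant_ge0//; last by lra.
  exact: le_trans (majorant_ge z v0).
have [J JP] := decr_rearr_lt (ltn0Sn v0) sm.
exists (\max_(j <- J) j) => n sg nn sgi sgs.
have on l : normc (emb sg (fun i => z (sg i)) (sg l) - z (sg l)) <= e.
  by have /= -> := emb_coord sgi (fun i => z (sg i)) l; rewrite (_ : _ - _ = 0) ?normc0 ?ltW//; apply: subrr.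
apply: linfty_norm_le => p.
apply: (@le_trans _ _ (normc (emb sg (fun i => z (sg i)) p - z p))); first exact: lexx.
case: (leqP p n) => pn.
  by have [l <-] := sgs p pn; exact: on l.
have pJ : p \notin J.
  apply/negP => pJ; have := @leq_bigmax_seq _ (enum_fset J) xpredT id _ pJ isT.
  by rewrite /= leqNgt (leq_ltn_trans nn pn).
case: (pselect (exists l, sg l = p)) => [[l <-]|h]; first exact: on.
rewrite emb_out => [|i]; last by apply/eqP => ip; apply: h; exists i.
by rewrite sub0r normcN ltW// JP.
Qed.

(** [coef_bound] yields absolute convergence, but the sum must still be identified as [f z]. A large
    finite [S] is compared with a block through a common [S0] that exhausts almost all of the mass;
    the block sum is close to [f] at a finite section, and that value is close to [f z]. *)
Theorem mon_of_limsup_lt1 : ball (0 : linfty R) 1 z ->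
  (limn_esup (fun n => (log_mean_sq z n)%:E) < 1%:E)%E -> mon_Hoo_ball z.
Proof.
move=> zb zlim; split=> // f fH; have z1 : N z < 1 by exact/ball01E.
have [fh [M fM]] := Hoo_holo fH.
have [T T0 TP] := coef_bound z1 zlim M.
pose F (al : multi_index) : C := mcoef f al * monomial al z.
have blockE n (sg : 'I_n.+1 -> nat) d : injective sg ->
    \sum_(al <- block sg d) F al = \sum_(a : {ffun 'I_n.+1 -> 'I_d.+1} | (deg a <= d)%N)
      gcoef sg f (fun i => nat_of_ord (a i)) * \prod_i z (sg i) ^+ a i.
  move=> sgi; rewrite sum_block//; apply: eq_bigr => a _.
  by rewrite /F mcoef_multi_index_of// monomial_multi_index_of.
pose W (S : {fset multi_index}) := \sum_(al <- S) normc (F al).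
have W0 S : 0 <= W S by apply: sumr_ge0 => al _; exact: normc_ge0.
have sub_le (S S' : {fset multi_index}) : {subset S <= S'} -> W S <= W S'.
  by move=> SS; rewrite /W (sum_fset_diff _ SS) lerDl sumr_ge0// => al _; exact: normc_ge0.
have WT S : W S <= T.
  have [n [d nd]] := subset_block S.
  have [sg [sgi sgn sgs sgz]] := sorting z n.
  apply: le_trans (sub_le _ _ (nd n d sg (leqnn _) (leqnn _) sgi sgs)) _.
  rewrite /W sum_block//; apply: le_trans (TP n sg f d sgi sgz fh fM).
  apply: ler_sum => a _; by rewrite /F mcoef_multi_index_of// monomial_multi_index_of.
have Wsup : has_sup [set W S | S in setT].
  by split; [exists (W fset0); exists fset0|exists T => _ [S _ <-]].
have tailW (e : R) : 0 < e -> exists S0, forall S, {subset S0 <= S} -> W (S `\` S0)%fset <= e.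
  move=> e0; have [_ [S0 _ <-] S0P] := sup_adherent e0 Wsup.
  exists S0 => S S0S; have : W S <= sup [set W S | S in setT].
    by apply: ub_le_sup; [exact: Wsup.2|exists S].
  rewrite {1}/W (sum_fset_diff _ S0S) -/(W S0) -/(W _); lra.
move=> P /nbhsCP[r r0 rP].
(* Four errors of size [e] arise: two tails beyond [S0], the Taylor remainder and the continuity of
   [f] at [z]. *)
pose e := r / 5; have e0 : 0 < e by rewrite divr_gt0.
have [S0 S0P] := tailW e e0.
exists S0 => // S /= S0S; apply: rP.
have -> : partial_sum (fun a => mcoef f a * monomial a z : C^o) S = \sum_(al <- S) F al.
  by rewrite /partial_sum big_seq_fsetE.
have /nbhsP[dl dl0 dlP] : nbhs z (fun w => normc (f w - f z) < e).
  have fc : f @ z --> f z by exact: (differentiable_continuous (fh.1 z z1)).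
  by apply: (fc (fun y : C^o => normc (y - f z) < e)); apply/nbhsCP; exists e.
have [n [d nd]] := subset_block S0.
have [n0 n0P] := decr_rearr_small z1 zlim (divr_gt0 dl0 (ltr0n R 2)).
pose n' := maxn n n0.
have [sg [sgi sgn sgs sgz]] := sorting z n'.
pose zt := emb sg (fun i => z (sg i)).
have ztz : normc (f zt - f z) < e.
  apply: dlP; apply: le_lt_trans (n0P n' sg (leq_maxr _ _) sgi sgs) _.
  by rewrite ltr_pdivrMr//; lra.
pose q := (N z + 1) / 2.
have Nz0 := linfty_norm_ge0 z.
have qI : 0 < q < 1 by apply/andP; rewrite /q; split; lra.
have ztq : N zt < q.
  apply: (@le_lt_trans _ _ (N z)); last by rewrite /q; lra.
  by apply: norm_emb => // i; exact: le_linfty_norm.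
have [D DP] : exists D, forall d, (D <= d)%N -> 2 * M * q ^+ d.+1 / (1 - q) <= e.
  have M0 : 0 <= M by apply: le_trans (fM z z1); exact: normc_ge0.
  have q1 : 0 < 1 - q by case/andP: qI => _; rewrite subr_gt0.
  have k0 : 0 < e * (1 - q) / (2 * M + 1) by rewrite divr_gt0 ?mulr_gt0//; lra.
  have [D DP] := expr_small qI k0; exists D => d' Dd.
  rewrite ler_pdivrMr//; have := DP d'.+1 (leqW Dd).
  rewrite ler_pdivlMr; last lra.
  have : 0 <= q ^+ d'.+1 by rewrite exprn_ge0//; case/andP: qI => /ltW.
  move: (q ^+ _) => y y0; nra.
pose d' := maxn d D.
have bt := block_taylor d' sgi fh fM qI ztq.
rewrite -/zt -(blockE n' sg d' sgi) in bt.
have {}bt := le_trans bt (DP d' (leq_maxr _ _)).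
have S0B : {subset S0 <= block sg d'} by apply: nd => //; exact: leq_maxl.
have S0S' : {subset S0 <= S} by exact/fsubsetP.
have diffe : normc (\sum_(al <- S) F al - \sum_(al <- block sg d') F al) <= e + e.
  rewrite (sum_fset_diff _ S0S') (sum_fset_diff _ S0B) opprD addrACA subrr add0r.
  apply: le_trans (le_normcB _ _) _; apply: lerD; apply: le_trans (le_normc_sum _ _ _) _; exact: S0P.
set X := \sum_(al <- S) F al in diffe *; set Y := \sum_(al <- _) F al in bt diffe *.
have -> : X - f z = (X - Y) - (f zt - Y) + (f zt - f z) by rewrite subBB addrA subrK.
apply: le_lt_trans (le_normcD _ _) _; apply: le_lt_trans (lerD (le_normcB _ _) (lexx _)) _.
by rewrite (_ : r = (e + e + e) + e + e); [move: bt diffe ztz; lra|rewrite /e; field].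
Qed.

End Convergence.

(** * Random polynomials *)

Section Signs.
Variable R : realType.

(** A sub-Gaussian bound with the generous constant 2: for large [x] because [|x| <= 2 * x ^+ 2],
    for small [x] because [expR y <= 1 / (1 - y)]. *)
Lemma cosh_le (x : R) : expR x + expR (- x) <= 2 * expR (2 * x ^+ 2).
Proof.
have [x1|x1] := leP (x ^+ 2) 4^-1; last first.
  have ax : `|x| <= 2 * x ^+ 2.
    have : 2^-1 < `|x|.
      by rewrite -ltr_sqr ?nnegrE// -normrX ger0_norm ?sqr_ge0// (_ : 2^-1 ^+ 2 = 4^-1 :> R)//; field.
    rewrite -[x ^+ 2]ger0_norm ?sqr_ge0// normrX expr2 => h.
    by rewrite mulrA ler_peMl//; lra.
  rewrite mulr_natl mulr2n; apply: lerD; rewrite ler_expR; apply: le_trans ax; first exact: ler_norm.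
  by rewrite -normrN ler_norm.
have [l u] : -1 < x /\ x < 1.
  by have : `|x| < 1; [rewrite -(@ltr_pXn2r R 2)// ?nnegrE// -normrX ger0_norm ?sqr_ge0// expr1n; lra|rewrite ltr_norml => /andP[]].
have e (y : R) : -1 < y -> y < 1 -> expR y <= (1 - y)^-1.
  move=> y0 y1; rewrite -[leRHS]mul1r ler_pdivlMr; last lra.
  rewrite -[leRHS](expRxMexpNx_1 y) ler_wpM2l ?expR_ge0//.
  by have := expR_ge1Dx (- y).
apply: (@le_trans _ _ ((1 - x)^-1 + (1 + x)^-1)).
  by apply: lerD; [exact: e|rewrite -[X in _ <= (_ + X)^-1]opprK; apply: e; lra].
apply: (@le_trans _ _ (2 * (1 + 2 * x ^+ 2))); last by rewrite ler_wpM2l// expR_ge1Dx.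
have -> : (1 - x)^-1 + (1 + x)^-1 = 2 / (1 - x ^+ 2).
  have : 1 - x ^+ 2 != 0 by rewrite gt_eqF//; lra.
  by rewrite expr2 => ?; field; rewrite !gt_eqF; lra.
rewrite ler_pdivrMr; last lra.
have := sqr_ge0 x; move: (x ^+ 2) x1 => y *; nra.
Qed.

(** Chernoff's bound with a union over [Q], run as an averaging argument: some choice of signs makes
    [Phi], a sum of exponentials, at most its mean. *)
Lemma exists_signs (I Q : finType) (r : Q -> I -> R) (V : R) : 0 < V -> (0 < #|Q|)%N ->
  (forall q, \sum_a r q a ^+ 2 <= V) ->
  exists s : {ffun I -> bool}, forall q,
    `|\sum_a (-1) ^+ s a * r q a| <= 2 * Num.sqrt (2 * V * ln (2 * #|Q|%:R)).
Proof.
move=> V0 Q0 rV; set H := ln (2 * #|Q|%:R).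
have Q1 : 1 < 2 * #|Q|%:R :> R by rewrite -natrM ltr1n; case: #|Q| Q0 => // k _; rewrite mulnS.
have H0 : 0 < H by rewrite ln_gt0.
(* Chosen so that [2 * l ^+ 2 * V = H], which balances the exponential moment against the logarithm
   of the number of constraints. *)
pose l := Num.sqrt (H / (2 * V)).
have l0 : 0 < l by rewrite sqrtr_gt0 divr_gt0// mulr_gt0.
have l2 : l ^+ 2 = H / (2 * V) by rewrite sqr_sqrtr// ltW// divr_gt0// mulr_gt0.
pose S (s : {ffun I -> bool}) q := \sum_a (-1) ^+ s a * r q a.
have mgf (y : R) q : \sum_(s : {ffun I -> bool}) expR (y * S s q) <= #|{ffun I -> bool}|%:R * expR (2 * y ^+ 2 * V).
  have -> : \sum_(s : {ffun I -> bool}) expR (y * S s q) =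
      \sum_(s : {ffun I -> bool}) \prod_a expR ((-1) ^+ s a * (y * r q a)).
    apply: eq_bigr => s _; rewrite /S mulr_sumr expR_sum; apply: eq_bigr => a _.
    by rewrite mulrCA.
  rewrite -(bigA_distr_bigA (fun a (b : bool) => expR ((-1) ^+ b * (y * r q a)))).
  apply: (@le_trans _ _ (\prod_(a : I) (2 * expR (2 * y ^+ 2 * r q a ^+ 2)))).
    apply: ler_prod => a _; rewrite sumr_ge0 => [|b _]; last exact: expR_ge0.
    rewrite big_bool /= expr1 expr0 mul1r mulN1r addrC; apply: le_trans (cosh_le _) _.
    by rewrite exprMn mulrA.
  rewrite big_split/= prodr_const card_ffun card_bool natrX -expR_sum ler_wpM2l ?exprn_ge0//.
  by rewrite ler_expR -mulr_sumr ler_wpM2l// mulr_ge0 ?sqr_ge0.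
pose Phi s := \sum_q (expR (l * S s q) + expR (- l * S s q)).
have [s sP] : exists s, Phi s <= 2 * #|Q|%:R * expR H.
  apply: contrapT => h.
  have : \sum_(s : {ffun I -> bool}) (2 * #|Q|%:R * expR H) < \sum_s Phi s.
    apply: ltr_sum => [|s _]; last by rewrite ltNge; apply/negP => h'; apply: h; exists s.
    by apply/hasP; exists [ffun=> true] => //; rewrite mem_index_enum.
  apply/negP; rewrite -leNgt /Phi exchange_big/=.
  apply: (@le_trans _ _ (\sum_(q : Q) 2 * (#|{ffun I -> bool}|%:R * expR H))).
    apply: ler_sum => q _; rewrite big_split/= mulr_natl mulr2n.
    have HE : 2 * l ^+ 2 * V = H by rewrite l2; field; rewrite gt_eqF.
    by apply: lerD; apply: le_trans (mgf _ _) _; rewrite ?sqrrN HE.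
  have sc (T : finType) (c : R) : \sum_(t : T) c = #|T|%:R * c by rewrite sumr_const mulr_natl.
  rewrite !sc; move: (#|{ffun I -> bool}|%:R) (#|Q|%:R) (expR H) => x y w.
  by rewrite le_eqVlt; apply/orP; left; apply/eqP; ring.
exists s => q; rewrite -/(S s q).
have le1 (y : R) : y = l * S s q \/ y = - l * S s q -> y <= H + H.
  have eH : expR H = 2 * #|Q|%:R by rewrite /H lnK// posrE; lra.
  move=> yE; rewrite -ler_expR expRD {1}eH.
  apply: le_trans sP; rewrite /Phi (bigD1 q)//=; apply: (@le_trans _ _ (expR (l * S s q) + expR (- l * S s q))).
    by case: yE => ->; rewrite ?lerDl ?lerDr expR_ge0.
  by rewrite lerDl sumr_ge0// => q' _; rewrite addr_ge0 ?expR_ge0.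
have h : l * `|S s q| <= H + H.
  rewrite -{1}(gtr0_norm l0) -normrM ler_norml lerNl -mulNr.
  by apply/andP; split; apply: le1; [right|left].
rewrite -(ler_pM2l l0); apply: le_trans h _.
rewrite mulrCA /l -sqrtrM; last by rewrite ltW// divr_gt0// mulr_gt0.
have -> : H / (2 * V) * (2 * V * H) = H ^+ 2 by field; rewrite gt_eqF.
by rewrite sqrtr_sqr gtr0_norm// mulr_natl mulr2n.
Qed.

Lemma exists_csigns (I Q : finType) (x : Q -> I -> R[i]) (V : R) : 0 < V -> (0 < #|Q|)%N ->
  (forall q, \sum_a normc (x q a) ^+ 2 <= V) ->
  exists s : {ffun I -> bool}, forall q,
    normc (\sum_a (-1) ^+ s a * x q a) <= 4 * Num.sqrt (2 * V * ln (4 * #|Q|%:R)).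
Proof.
move=> V0 Q0 xV.
pose r (q : Q * bool) a := if q.2 then complex.Re (x q.1 a) else complex.Im (x q.1 a).
have [] := @exists_signs I (Q * bool)%type r V V0.
- by rewrite card_prod card_bool muln_gt0 Q0.
- move=> [q b]; apply: le_trans (xV q); apply: ler_sum => a _; rewrite /r /=.
  rewrite -[leLHS]ger0_norm ?sqr_ge0// normrX lerXn2r ?nnegrE ?normc_ge0//.
  by case: b; [exact: norm_Re_le|exact: norm_Im_le].
move=> s sP; exists s => q.
have E : 2 * #|{: Q * bool}|%:R = 4 * #|Q|%:R :> R.
  by rewrite card_prod card_bool natrM; ring.
rewrite E in sP.
have sR (f : R[i] -> R) : (forall u v, f (u + v) = f u + f v) -> f 0 = 0 -> (forall u, f (- u) = - f u) ->
    f (\sum_a (-1) ^+ s a * x q a) = \sum_a (-1) ^+ s a * f (x q a).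
  move=> fD f0 fN; rewrite (big_morph f fD f0); apply: eq_bigr => a _.
  by case: (s a); rewrite ?expr1 ?expr0 ?mulN1r ?mul1r.
apply: le_trans (normc_le_ReIm _) _.
rewrite (sR (@complex.Re R)) => [|[? ?] [? ?]||[? ?]] //.
rewrite (sR (@complex.Im R)) => [|[? ?] [? ?]||[? ?]] //.
have := sP (q, true); have := sP (q, false); rewrite /r /=; lra.
Qed.

End Signs.

Section Homogeneous.
Variables (R : realType) (n d : nat).
Local Notation A := {ffun 'I_n -> 'I_d.+1}.
Local Notation ex a := (fun i => nat_of_ord (a i)).

Lemma sum_addi m (G : A -> R) : (m < d)%N ->
  \sum_(a : A | deg a == m) \sum_i G (addi a i) =
  \sum_(b : A | deg b == m.+1) (\sum_(i | (0 < b i)%N) G b).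
Proof.
move=> md; rewrite exchange_big/= [RHS](exchange_big_dep xpredT)//=; apply: eq_bigr => i _.
rewrite [RHS](reindex_onto (fun b : A => addi b i) (fun b => subi b i))/=; last first.
  by move=> b /andP[_ b0]; rewrite subiK.
apply: eq_big => // a; apply/idP/idP => [/eqP am|/andP[/andP[/eqP h1 h2] /eqP h3]].
  by rewrite deg_addi ?am// eqxx addiK ?am// eqxx addiE ?am// eqxx addn1.
by have := deg_subi h2; rewrite h3 h1 => -[->].
Qed.

Lemma degm0 (a : A) : (deg a == 0%N) = (a == [ffun=> ord0]).
Proof.
rewrite /deg; apply/eqP/eqP => [/eqP|->]; last by rewrite big1// => i _; rewrite ffunE.
rewrite sum_nat_eq0 => /forallP a0; apply/ffunP => i; apply: val_inj; rewrite ffunE /=.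
exact/eqP/a0.
Qed.

Lemma card_degm m : (m <= d)%N -> \sum_(a : A | deg a == m) 1 <= n%:R ^+ m :> R.
Proof.
elim: m => [|m IH] md.
  by rewrite (big_pred1 [ffun=> ord0])// => a; rewrite /= degm0.
have h := @sum_addi m (fun=> 1) md.
apply: (@le_trans _ _ (\sum_(b : A | deg b == m.+1) \sum_(i | (0 < b i)%N) 1)).
  apply: ler_sum => b /eqP bm; have [i bi] : exists i, (0 < b i)%N.
    apply/existsP; have : (0 < deg b)%N by rewrite bm.
    apply: contraTT; rewrite negb_exists => /forallP h'.
    by rewrite /deg big1// => i _; apply/eqP; rewrite -leqn0 leqNgt.
  by rewrite (bigD1 i)//= lerDl sumr_ge0.
rewrite -h exprSr (eq_bigr (fun=> 1 * n%:R)); last first.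
  by move=> a _; rewrite sumr_const card_ord mul1r.
by rewrite -mulr_suml ler_wpM2r// IH// ltnW.
Qed.

(** In the induction an exponent [b] of degree [m + 1] arises once from each index in its support,
    and there are at most [m + 1] of these. *)
Lemma multinomial_le (t : 'I_n -> R) m : (forall i, 0 <= t i) -> (m <= d)%N ->
  (\sum_i t i) ^+ m <= m`!%:R * \sum_(a : A | deg a == m) \prod_i t i ^+ a i.
Proof.
move=> t0; elim: m => [|m IH] md.
  rewrite (big_pred1 [ffun=> ord0]) => [|a]; last by rewrite /= degm0.
  rewrite [X in _ * X]big1 => [|i _]; last by rewrite ffunE expr0.
  by rewrite expr0 fact0 mulr1.
rewrite exprSr; apply: le_trans (ler_wpM2r _ (IH (ltnW md))) _; first exact: sumr_ge0.
rewrite factS natrM -mulrA [leRHS]mulrCA -mulrA ler_wpM2l//.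
pose P (a : A) := \prod_i t i ^+ a i.
have P0 a : 0 <= P a by apply: prodr_ge0 => i _; exact: exprn_ge0.
rewrite mulr_suml (eq_bigr (fun a => \sum_i P (addi a i))); last first.
  move=> a /eqP am; rewrite mulr_sumr; apply: eq_bigr => i _; rewrite /P.
  rewrite (bigD1 i)//= [in RHS](bigD1 i)//= addiE ?am// eqxx addn1 exprS mulrC mulrA; congr (_ * _).
  by apply: eq_bigr => j /negbTE ji; rewrite addiE ?am// ji addn0.
rewrite sum_addi// mulr_sumr; apply: ler_sum => b /eqP bm.
have -> : \sum_(i | (0 < b i)%N) P b = #|[pred i | (0 < b i)%N]|%:R * P b by rewrite sumr_const mulr_natl.
apply: (ler_wpM2r (P0 b)); rewrite ler_nat -bm /deg -sum1_card.
rewrite [leqRHS](bigID (fun i => 0 < b i)%N)/=; apply: (@leq_trans (\sum_(i | (0 < b i)%N) b i)%N); last exact: leq_addr.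
by apply: leq_sum.
Qed.

End Homogeneous.

(** * Lipschitz estimates and a net of the polydisc *)

Section Lipschitz.
Variable R : realType.
Local Notation C := R[i].

Lemma prod_lip (T : Type) (r : seq T) (u v : T -> C) :
  (forall i, normc (u i) <= 1) -> (forall i, normc (v i) <= 1) ->
  normc (\prod_(i <- r) u i - \prod_(i <- r) v i) <= \sum_(i <- r) normc (u i - v i).
Proof.
move=> u1 v1; elim: r => [|i r IH]; first by rewrite !big_nil subrr normc0.
rewrite !big_cons; set U := \prod_(_ <- _) _; set W := \prod_(_ <- _) _.
have -> : u i * U - v i * W = u i * (U - W) + (u i - v i) * W by ring.
have W1 : normc W <= 1.
  rewrite /W normc_prod; elim: (r) => [|k r' IHr]; first by rewrite big_nil.
  by rewrite big_cons mulr_ile1 ?normc_ge0// prodr_ge0// => l _; exact: normc_ge0.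
apply: le_trans (le_normcD _ _) _; rewrite !normcM addrC; apply: lerD.
  by rewrite ler_piMr ?normc_ge0.
by apply: le_trans IH; rewrite ler_piMl ?normc_ge0.
Qed.

Lemma mono_lip n d (u v : 'I_n -> C) (a : {ffun 'I_n -> 'I_d}) (e : R) :
  (forall i, normc (u i) <= 1) -> (forall i, normc (v i) <= 1) -> (forall i, normc (u i - v i) <= e) ->
  normc (mono u (fun i => nat_of_ord (a i)) - mono v (fun i => nat_of_ord (a i))) <= (deg a)%:R * e.
Proof.
move=> u1 v1 uv.
have pw (x y : C) k : normc x <= 1 -> normc y <= 1 -> normc (x ^+ k - y ^+ k) <= k%:R * normc (x - y).
  move=> x1 y1; have := @prod_lip 'I_k (index_enum 'I_k) (fun=> x) (fun=> y) (fun=> x1) (fun=> y1).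
  by rewrite !prodr_const sumr_const card_ord mulr_natl.
apply: le_trans (prod_lip _ _ _) _ => [i|i|].
- by rewrite normcX exprn_ile1 ?normc_ge0.
- by rewrite normcX exprn_ile1 ?normc_ge0.
rewrite /deg natr_sum mulr_suml; apply: ler_sum => i _.
by apply: le_trans (pw _ _ _ (u1 i) (v1 i)) _; rewrite ler_wpM2l.
Qed.

End Lipschitz.

Section Net.
Variables (R : realType) (n K : nat).
Hypothesis K0 : (0 < K)%N.
Local Notation C := R[i].

Definition net : finType := {ffun 'I_n -> (bool * 'I_K.+1) * (bool * 'I_K.+1)}.
Definition netR (p : bool * 'I_K.+1) : R := (-1) ^+ p.1 * p.2%:R / K%:R.
(** Grid points outside the disc are sent to 0, so that all net points are admissible. Rounding the
    coordinates towards 0, as in [netR_approx], never leads outside. *)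
Definition netC (p : (bool * 'I_K.+1) * (bool * 'I_K.+1)) : C :=
  if normc (netR p.1 +i* netR p.2)%C <= 1 then (netR p.1 +i* netR p.2)%C else 0.

Lemma card_net : #|net| = ((2 * K.+1) ^ (2 * n))%N.
Proof.
by rewrite card_ffun card_ord !card_prod card_bool card_ord mulnn -expnM.
Qed.

Lemma netC_le1 p : normc (netC p) <= 1.
Proof. by rewrite /netC; case: ifP => // _; rewrite normc0. Qed.

Lemma netR_approx (r : R) : `|r| <= 1 -> exists p, `|netR p| <= `|r| /\ `|r - netR p| <= K%:R^-1.
Proof.
move=> r1; have Kp : 0 < K%:R :> R by rewrite ltr0n.
pose k := Num.truncn (`|r| * K%:R).
have rK0 : 0 <= `|r| * K%:R by rewrite mulr_ge0.
have /andP[k1 k2] := truncn_itv rK0.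
have kK : (k <= K)%N.
  by rewrite -(ler_nat R); apply: le_trans k1 _; rewrite ler_piMl.
exists (r < 0, Ordinal (kK : k < K.+1)%N); rewrite /netR /=.
have h0 : 0 <= k%:R / K%:R :> R by rewrite divr_ge0.
have h1 : k%:R / K%:R <= `|r| by rewrite ler_pdivrMr.
have h' : `|r| - k%:R / K%:R <= K%:R^-1.
  by rewrite lerBlDr -[X in X + _]mul1r -mulrDl ler_pdivlMr// addrC natr1 ltW.
have KV : 0 <= K%:R^-1 :> R by rewrite invr_ge0.
rewrite -mulrA; move: (k%:R / K%:R) h0 h1 h' => q h0 h1 h'.
case: ltrP => r0; rewrite ?expr1 ?expr0 ?mulN1r ?mul1r.
  rewrite normrN (ger0_norm h0) opprK ler_norml; split=> //.
  by rewrite (ltr0_norm r0) in h1 h'; apply/andP; split; lra.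
rewrite (ger0_norm h0) ler_norml; split=> //.
by rewrite (ger0_norm r0) in h1 h'; apply/andP; split; lra.
Qed.

Lemma netC_approx (w : C) : normc w <= 1 -> exists p, normc (w - netC p) <= 2 / K%:R.
Proof.
case: w => a b w1.
have [p [p1 p2]] := netR_approx (le_trans (norm_Re_le _) w1).
have [q [q1 q2]] := netR_approx (le_trans (norm_Im_le _) w1).
exists (p, q); rewrite /netC /=.
have -> : normc (netR p +i* netR q)%C <= 1.
  apply: le_trans w1; rewrite /= ler_wsqrtr// lerD//.
    by rewrite -[leLHS]ger0_norm ?sqr_ge0// -[leRHS]ger0_norm ?sqr_ge0// !normrX lerXn2r ?nnegrE.
  by rewrite -[leLHS]ger0_norm ?sqr_ge0// -[leRHS]ger0_norm ?sqr_ge0// !normrX lerXn2r ?nnegrE.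
apply: le_trans (normc_le_ReIm _) _ => /=.
by rewrite mulr_natl mulr2n lerD.
Qed.

End Net.

Section RandomPolynomial.
Variables (R : realType) (n m : nat).
Local Notation C := R[i].
Local Notation A := {ffun 'I_n -> 'I_m.+1}.
Local Notation ex a := (fun i => nat_of_ord (a i)).

Lemma ln_lt_nat (k : nat) : (0 < k)%N -> ln k%:R <= k%:R - 1 :> R.
Proof.
move=> k0; have := @le_ln1Dx R (k%:R - 1); rewrite addrCA subrr addr0; apply.
by rewrite ltrBrDr addNr ltr0n.
Qed.

Lemma net_count : (0 < n)%N -> (0 < m)%N -> ln n%:R <= 2 * m%:R :> R ->
  ln (4 * #|net n (2 * m * n ^ m)|%:R) <= 15 * n%:R * m%:R ^+ 2 :> R.
Proof.
move=> n0 m0 nm; rewrite card_net natrX.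
set K1 : nat := (2 * _.+1)%N.
have K1p : 0 < K1%:R :> R by rewrite ltr0n.
have n1 : 1 <= n%:R :> R by rewrite ler1n.
have m1 : 1 <= m%:R :> R by rewrite ler1n.
have lK : ln K1%:R <= 6 * m%:R ^+ 2 :> R.
  apply: (@le_trans _ _ (ln (6 * m%:R * n%:R ^+ m))).
    rewrite ler_ln ?posrE// ?mulr_gt0 ?exprn_gt0 ?ltr0n// -natrX -!natrM ler_nat /K1.
    have : (1 <= m * n ^ m)%N by rewrite muln_gt0 m0 expn_gt0 n0.
    by rewrite -!mulnA; move: (m * n ^ m)%N => y; lia.
  rewrite lnM ?posrE ?mulr_gt0 ?exprn_gt0 ?ltr0n// lnM ?posrE ?ltr0n// lnXn ?ltr0n//.
  have := @ln_lt_nat 2 isT; have := @ln_lt_nat 3 isT; have := ln_lt_nat m0.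
  have -> : 6 = 2 * 3 :> R by ring.
  rewrite [ln (2 * 3)]lnM ?posrE// -mulr_natl.
  have : m%:R * ln n%:R <= m%:R * (2 * m%:R) :> R by rewrite ler_wpM2l.
  move: (ln _) (ln _) (ln _) (m%:R * _) => a b c e; nra.
have -> : ln (4 * K1%:R ^+ (2 * n)) = ln 2 + ln 2 + 2 * n%:R * ln K1%:R :> R.
  have -> : 4 = 2 * 2 :> R by ring.
  rewrite lnM ?posrE ?mulr_gt0 ?exprn_gt0// [ln (2 * 2)]lnM ?posrE// [ln (_ ^+ _)]lnXn//.
  by rewrite -[ln K1%:R *+ _]mulr_natl [(2 * n)%:R]natrM.
have := @ln_lt_nat 2 isT => h2.
have : 2 * n%:R * ln K1%:R <= 2 * n%:R * (6 * m%:R ^+ 2) :> R by rewrite ler_wpM2l// mulr_ge0.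
have : 1 <= n%:R * m%:R ^+ 2 :> R by rewrite mulr_ege1// exprn_ege1.
have -> : 2 * n%:R * (6 * m%:R ^+ 2) = 12 * (n%:R * m%:R ^+ 2) :> R by ring.
have -> : 15 * n%:R * m%:R ^+ 2 = 15 * (n%:R * m%:R ^+ 2) :> R by ring.
by set X := n%:R * m%:R ^+ 2; set Y := 2 * n%:R * ln _; lra.
Qed.

(** Random signs control the polynomial on a net. The mesh [K = 2 * m * n ^ m] is so fine that even
    the trivial estimate, at most [n ^ m] coefficients of modulus at most 1 and Lipschitz constant
    [m], moves the values by at most 1. Since [ln n <= 2 * m], the net still has logarithmic size
    [O(n * m ^ 2)]. *)
Lemma random_polynomial (y : A -> C) (V : R) : (0 < n)%N -> (0 < m)%N -> ln n%:R <= 2 * m%:R :> R ->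
  (forall a, deg a != m -> y a = 0) -> (forall a, normc (y a) <= 1) ->
  1 <= V -> \sum_a normc (y a) ^+ 2 <= V ->
  exists s : {ffun A -> bool}, forall w : 'I_n -> C, (forall i, normc (w i) <= 1) ->
    normc (\sum_a (-1) ^+ s a * (y a * mono w (ex a))) <= 25 * m%:R * Num.sqrt (n%:R * V).
Proof.
move=> n0 m0 nm yh y1 V1 yV; set K := (2 * m * n ^ m)%N.
have Kp : (0 < K)%N by rewrite !muln_gt0 m0 expn_gt0 n0.
have V0 : 0 < V by apply: lt_le_trans V1.
pose pt (q : net n K) : 'I_n -> C := fun i => netC R (q i).
have pt1 q i : normc (pt q i) <= 1 by exact: netC_le1.
have Q0 : (0 < #|net n K|)%N by rewrite card_net expn_gt0 muln_gt0.
have [|s sP] := @exists_csigns R _ _ (fun q a => y a * mono (pt q) (ex a)) V V0 Q0.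
  move=> q; apply: le_trans yV; apply: ler_sum => a _.
  rewrite lerXn2r ?nnegrE ?normc_ge0// normcM ler_piMr ?normc_ge0// /mono normc_prod.
  by apply: prodr_ile1 => i _; rewrite normc_ge0 normcX exprn_ile1 ?normc_ge0.
exists s => w w1.
have [q qP] : exists q : net n K, forall i, normc (w i - pt q i) <= 2 / K%:R.
  have /choice[F FP] i := netC_approx Kp (w1 i).
  by exists [ffun i => F i] => i; rewrite /pt ffunE.
have n1 : 1 <= n%:R :> R by rewrite ler1n.
have m1 : 1 <= m%:R :> R by rewrite ler1n.
have near : normc (\sum_a (-1) ^+ s a * (y a * mono w (ex a)) - \sum_a (-1) ^+ s a * (y a * mono (pt q) (ex a))) <= 1.
  rewrite -sumrB; apply: le_trans (le_normc_sum _ _ _) _.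
  apply: (@le_trans _ _ (\sum_(a : A | deg a == m) m%:R * (2 / K%:R))).
    rewrite [leRHS]big_mkcond; apply: ler_sum => a _.
    rewrite -mulrBr -mulrBr !normcM (_ : normc ((-1) ^+ s a) = 1) ?mul1r; last first.
      by case: (s a); rewrite ?expr1 ?expr0 ?normcN normc1.
    case: eqP => [am|/eqP /yh ->]; last by rewrite normc0 mul0r.
    rewrite -[leRHS]mul1r; apply: ler_pM; rewrite ?normc_ge0//.
    by have := mono_lip a w1 (pt1 q) qP; rewrite am.
  rewrite (eq_bigr (fun=> 1 * (m%:R * (2 / K%:R)))); last by move=> a _; rewrite mul1r.
  rewrite -mulr_suml; apply: le_trans (ler_wpM2r _ (card_degm R n (leqnn m))) _.
    by rewrite mulr_ge0// divr_ge0.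
  rewrite mulrA mulrA ler_pdivrMr ?ltr0n// mul1r /K !natrM natrX.
  by rewrite [leRHS]mulrC mulrA mulrAC [leRHS]mulrA mulrAC.
have -> : \sum_a (-1) ^+ s a * (y a * mono w (ex a)) = (\sum_a (-1) ^+ s a * (y a * mono w (ex a)) -
   \sum_a (-1) ^+ s a * (y a * mono (pt q) (ex a))) + \sum_a (-1) ^+ s a * (y a * mono (pt q) (ex a)).
  by rewrite subrK.
apply: le_trans (le_normcD _ _) _; apply: le_trans (lerD near (sP q)) _.
have := net_count n0 m0 nm; rewrite -/K; set H := ln _ => HK.
(* [2 * 15 <= 6 ^ 2]; with the factor 4 of [exists_csigns] and the net error 1 this gives
   [4 * 6 + 1 = 25]. *)
have sq : Num.sqrt (2 * V * H) <= 6 * m%:R * Num.sqrt (n%:R * V).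
  have -> : 6 * m%:R * Num.sqrt (n%:R * V) = Num.sqrt (36 * m%:R ^+ 2 * (n%:R * V)).
    have -> : 36 * m%:R ^+ 2 = (6 * m%:R) ^+ 2 :> R by ring.
    by rewrite [in RHS]sqrtrM ?sqr_ge0// [in RHS]sqrtr_sqr ger0_norm// mulr_ge0.
  rewrite ler_wsqrtr//.
  have : V * H <= V * (15 * n%:R * m%:R ^+ 2) by rewrite ler_wpM2l// ltW.
  have : 0 <= V * n%:R * m%:R ^+ 2 by rewrite !mulr_ge0 ?sqr_ge0// ltW.
  have -> : V * (15 * n%:R * m%:R ^+ 2) = 15 * (V * n%:R * m%:R ^+ 2) by ring.
  have -> : 36 * m%:R ^+ 2 * (n%:R * V) = 36 * (V * n%:R * m%:R ^+ 2) by ring.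
  by rewrite -[2 * V * H]mulrA; set X := V * n%:R * _; lra.
have sq1 : 1 <= m%:R * Num.sqrt (n%:R * V).
  apply: mulr_ege1 => //; rewrite -[leLHS]sqrtr1 ler_wsqrtr//.
  exact: mulr_ege1.
rewrite -!mulrA in sq *; lra.
Qed.

End RandomPolynomial.

(** * Gliding hump and necessity *)

Section Growth.
Variable R : realType.

(** The induction step is [e <= (1 + 1 / k) ^ (k + 1)]. *)
Lemma fact_le m : (0 < m)%N -> m`!%:R * expR (m%:R - 1) <= m%:R ^+ m.+1 :> R.
Proof.
case: m => // m _; elim: m => [|m IH]; first by rewrite subrr expR0 mulr1 expr1n.
set k := m.+1 in IH *; have k0 : 0 < k%:R :> R by rewrite ltr0n.
have k1 : 0 < k.+1%:R :> R by rewrite ltr0n.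
rewrite factS natrM (_ : k.+1%:R - 1 = (k%:R - 1) + 1); last by rewrite -natr1; ring.
rewrite expRD -mulrA exprS ler_wpM2l ?ler0n//.
rewrite mulrA; apply: le_trans (ler_wpM2r (expR_ge0 1) IH) _.
have -> : k.+1%:R = k%:R * (1 + k%:R^-1) :> R by rewrite mulrDr mulr1 mulfV ?gt_eqF// natr1.
rewrite exprMn ler_wpM2l ?exprn_ge0 ?(ltW k0)//.
have -> : 1 + k%:R^-1 = (1 - k.+1%:R^-1)^-1 :> R.
  have := k0; rewrite -natr1; move: (k%:R) => x x0; field.
  by apply/andP; split; rewrite gt_eqF//; lra.
have kv : k.+1%:R^-1 < 1 :> R by rewrite invf_lt1// ltr1n.
rewrite exprVn -[leLHS]invrK -expRN lef_pV2 ?posrE ?exprn_gt0 ?expR_gt0 ?subr_gt0//.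
have -> : - 1 = k.+1%:R * (- k.+1%:R^-1) :> R by rewrite mulrN mulfV ?gt_eqF.
rewrite expRM_natl lerXn2r ?nnegrE ?expR_ge0 ?subr_ge0 ?(ltW kv)//.
exact: expR_ge1Dx.
Qed.

(** The excess of [T] over [m] multiplies [m ^ m] by at least [expR (q / 4)] with [q = sqrt m],
    while [m ^ m / m!] is at least [n] up to [m] and constants. Of the exponential only
    [(q / 32) ^ 8 = m ^ 4 / 32 ^ 8] is kept. The number 2500 is [(2 * 25) ^ 2], from the norm bound
    25 and from keeping half of the terms. *)
Lemma growth (n m : nat) (T B : R) : (0 < m)%N -> (0 < n)%N -> ln n%:R <= m%:R + 1 :> R ->
  m%:R + Num.sqrt m%:R / 2 <= T -> 2500 * expR 2 * B ^+ 2 * 32 ^+ 8 <= m%:R ->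
  2500 * B ^+ 2 * m%:R ^+ 2 * n%:R <= T ^+ m / m`!%:R.
Proof.
move=> m0 n0 nm mT mB; set q := Num.sqrt m%:R in mT.
have m1 : 0 < m%:R :> R by rewrite ltr0n.
have q0 : 0 < q by rewrite sqrtr_gt0.
have q2 : q ^+ 2 = m%:R by rewrite sqr_sqrtr// ltW.
have q1 : 1 <= q by rewrite -[leLHS]sqrtr1 ler_wsqrtr// ler1n.
have f0 : 0 < m`!%:R :> R by rewrite ltr0n fact_gt0.
have nE : n%:R <= expR (m%:R + 1) :> R by rewrite -[leLHS]lnK ?posrE ?ltr0n// ler_expR.
have h1 : m%:R ^+ m * expR (q / 4) <= T ^+ m.
  apply: (@le_trans _ _ ((m%:R + q / 2) ^+ m)); last first.
    by rewrite lerXn2r// nnegrE; [|apply: le_trans mT]; rewrite addr_ge0 ?divr_ge0 ?(ltW m1) ?(ltW q0).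
  have -> : m%:R + q / 2 = m%:R * (1 + (2 * q)^-1) by rewrite -q2; field; rewrite gt_eqF.
  rewrite exprMn ler_wpM2l ?exprn_ge0 ?(ltW m1)//.
  have -> : q / 4 = m%:R * (4 * q)^-1 by rewrite -q2; field; rewrite gt_eqF.
  rewrite expRM_natl lerXn2r ?nnegrE ?expR_ge0//; first by rewrite addr_ge0 ?invr_ge0 ?mulr_ge0 ?(ltW q0).
  pose y := (4 * q)^-1; have y0 : 0 < y by rewrite invr_gt0 mulr_gt0.
  have y1 : y <= 4^-1 by rewrite lef_pV2 ?posrE ?mulr_gt0//; lra.
  have -> : (2 * q)^-1 = 2 * y by rewrite /y; field; rewrite gt_eqF.
  have y1p : 0 < 1 - y by lra.
  rewrite -/y -[leLHS]invrK -expRN invf_ple ?posrE ?expR_gt0//; last lra.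
  apply: (@le_trans _ _ (1 - y)); last by have := expR_ge1Dx (- y).
  rewrite -[leLHS]div1r ler_pdivrMr; last lra.
  nra.
have h2 : expR (m%:R - 1) / m%:R ^+ m.+1 <= m`!%:R^-1 :> R.
  rewrite ler_pdivrMr ?exprn_gt0// ler_pdivlMl//; exact: fact_le.
have h3 : m%:R ^+ 4 / 32 ^+ 8 <= expR (q / 4).
  have -> : q / 4 = 8%:R * (q / 32) by field.
  rewrite expRM_natl.
  have -> : m%:R ^+ 4 / 32 ^+ 8 = (q / 32) ^+ 8.
    by rewrite -q2 -exprM exprMn exprVn.
  rewrite lerXn2r ?nnegrE ?expR_ge0 ?divr_ge0 ?(ltW q0)//.
  by apply: le_trans (expR_ge1Dx _); rewrite lerDr.
apply: (@le_trans _ _ (m%:R ^+ m * expR (q / 4) * (expR (m%:R - 1) / m%:R ^+ m.+1))); last first.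
  by apply: ler_pM => //; rewrite ?mulr_ge0 ?exprn_ge0 ?expR_ge0 ?invr_ge0 ?exprn_ge0 ?(ltW m1).
have -> : m%:R ^+ m * expR (q / 4) * (expR (m%:R - 1) / m%:R ^+ m.+1) = expR (q / 4) * expR (m%:R - 1) / m%:R :> R.
  rewrite exprS; have : m%:R ^+ m != 0 :> R by rewrite expf_neq0// gt_eqF.
  move: (m%:R ^+ m) (expR _) (expR _) => a b c a0; field.
  by rewrite a0 gt_eqF.
have -> : expR (m%:R - 1) = expR (m%:R + 1) / expR 2 :> R.
  by rewrite -expRN -expRD; congr expR; ring.
have e2 : 0 < expR 2 :> R by exact: expR_gt0.
apply: (@le_trans _ _ (m%:R ^+ 4 / 32 ^+ 8 * (n%:R / expR 2) / m%:R)); last first.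
  rewrite ler_pM2r ?invr_gt0//; apply: ler_pM; rewrite ?divr_ge0 ?exprn_ge0 ?(ltW e2)//.
  by rewrite ler_pM2r ?invr_gt0.
have -> : m%:R ^+ 4 / 32 ^+ 8 * (n%:R / expR 2) / m%:R = m%:R / (expR 2 * 32 ^+ 8) * (m%:R ^+ 2 * n%:R) :> R.
  by field; rewrite !gt_eqF.
rewrite -[2500 * _ * _ * _]mulrA ler_wpM2r ?mulr_ge0 ?sqr_ge0//.
by rewrite ler_pdivlMr ?mulr_gt0 ?exprn_gt0//; apply: le_trans mB; rewrite le_eqVlt; apply/orP; left; apply/eqP; ring.
Qed.

End Growth.

Section Letters.
Variables (R : realType) (z : linfty R).

(** The values of the rearrangement need not be attained by coordinates, hence the loss [e]. Each
    new letter is found outside the finite set of those already chosen. *)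
Lemma greedy_letters n (e : R) : 0 < e -> exists sg : 'I_n -> nat, injective sg /\
  forall i : 'I_n, decr_rearr z i.+1 - e < normc (z (sg i)).
Proof.
move=> e0.
have [s [us ss sP]] : exists s : seq nat, [/\ uniq s, size s = n &
    forall i, (i < n)%N -> decr_rearr z i.+1 - e < normc (z (nth 0%N s i))].
  elim: n => [|n [s [us ss sP]]]; first by exists [::].
  have [|j jJ zj] := @lt_decr_rearr _ z n.+1 (decr_rearr z n.+1 - e) [fset j | j in s]%fset _ ltac:(by rewrite ltrBlDr ltrDl).
    by rewrite card_fseq undup_id// ss.
  rewrite inE /= in jJ; exists (rcons s j); split; first by rewrite rcons_uniq jJ.
    by rewrite size_rcons ss.
  move=> i; rewrite ltnS nth_rcons ss leq_eqVlt => /orP[/eqP ->|il]; first by rewrite ltnn eqxx.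
  by rewrite il; exact: sP.
exists (fun i => nth 0%N s i); split; last by move=> i; exact: sP.
by move=> i j /eqP; rewrite nth_uniq ?ss// => /eqP; exact: val_inj.
Qed.

End Letters.

Section Hump.
Variables (R : realType) (z : linfty R).
Local Notation N := (@linfty_norm R).
Local Notation C := R[i].
Local Notation A n d := {ffun 'I_n.+1 -> 'I_d.+1}.
Local Notation ex a := (fun i => nat_of_ord (a i)).

(* At [z] the terms are [+-|z^a|^2 / L]; [hE] selects the indices of one sign, so that
   nothing cancels. *)
Record hump := Hump {
  hn : nat; hm : nat; hsg : 'I_hn.+1 -> nat; hb : A hn hm -> C; hE : pred (A hn hm) }.

Definition hpoly (h : hump) (w : linfty R) : C^o :=
  \sum_(a : A (hn h) (hm h)) @hb h a * mono (fun i => w (@hsg h i)) (ex a).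

Definition hump_ok (B : R) (m0 : nat) (h : hump) := [/\ injective (@hsg h),
  homogeneous (hm h) (@hb h), (m0 < hm h)%N, forall w, N w <= 1 -> normc (hpoly h w) <= 1 &
  B <= normc (\sum_(a | (deg a == hm h) && @hE h a) @hb h a * mono (fun i => z (@hsg h i)) (ex a))].

Hypothesis z1 : N z < 1.
Hypothesis zlarge : forall n0, exists2 n, (n0 <= n)%N &
  ln n%:R + Num.sqrt (ln n%:R) <= \sum_(1 <= j < n.+1) decr_rearr z j ^+ 2.

Lemma letters_sum n : 0 < ln n.+1%:R :> R -> exists sg : 'I_n.+1 -> nat, injective sg /\
  \sum_(1 <= j < n.+2) decr_rearr z j ^+ 2 - Num.sqrt (ln n.+1%:R) / 2 <= \sum_i normc (z (sg i)) ^+ 2.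
Proof.
rewrite -sqrtr_gt0 => q0.
set q := Num.sqrt _ in q0 *.
have nn : 0 < n.+1%:R :> R by rewrite ltr0n.
(* Replacing [z*] by [z* - e] loses at most [2 * e] per square, in total [q / 2], half of the
   available excess. *)
pose e := q / (4 * n.+1%:R); have e0 : 0 < e by rewrite divr_gt0// mulr_gt0.
have [sg [sgi sgP]] := greedy_letters z n.+1 e0.
exists sg; split=> //; rewrite big_add1 big_mkord /=.
apply: (@le_trans _ _ (\sum_(i < n.+1) (decr_rearr z i.+1 ^+ 2 - 2 * e))).
  rewrite sumrB sumr_const card_ord lerD2l lerN2 -mulr_natl /e le_eqVlt; apply/orP; left; apply/eqP.
  by field; rewrite gt_eqF.
apply: ler_sum => i _; have := sgP i; have := decr_rearr_ge0 z i.+1; have := normc_ge0 (z (sg i)).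
have : decr_rearr z i.+1 <= 1.
  apply: le_trans (decr_rearr_anti z (ltn0Sn 0) (ltn0Sn i)) _.
  by apply: le_trans (decr_rearr1 z) _; exact: ltW.
move: (normc _) (decr_rearr z i.+1) => x y y1 x0 y0 xy.
have [ye|ye] := leP e y.
  have : (y - e) ^+ 2 <= x ^+ 2 by rewrite lerXn2r ?nnegrE ?subr_ge0// ltW.
  by rewrite !expr2; nra.
have : 0 <= x ^+ 2 by exact: sqr_ge0.
by rewrite !expr2; nra.
Qed.

Lemma hump_exists (B : R) (m0 : nat) : exists h, hump_ok B m0 h.
Proof.
(* A bound of at least 1 also ensures [1 <= V], as [random_polynomial] demands. *)
pose B' := Num.max B 1; have B1 : 1 <= B' by rewrite le_max lexx orbT.
have [M1 M1P] : exists M1 : nat, 2500 * expR 2 * B' ^+ 2 * 32 ^+ 8 <= M1%:R :> R.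
  by exists (Num.truncn (2500 * expR 2 * B' ^+ 2 * 32 ^+ 8)).+1; rewrite ltW// truncnS_gt.
pose M2 := (m0 + M1).+1.
have [[|n] nn zn] := zlarge (Num.truncn (expR M2%:R : R)).+1; first by [].
have n0 : 0 < n.+1%:R :> R by rewrite ltr0n.
have lnM2 : M2%:R <= ln n.+1%:R :> R.
  rewrite -[leLHS]expRK ler_ln ?posrE ?expR_gt0//.
  by apply: le_trans (ltW (truncnS_gt _)) _; rewrite ler_nat.
have ln0 : 0 <= ln n.+1%:R :> R by apply: le_trans lnM2.
pose m := Num.truncn (ln n.+1%:R : R).
have /andP[m1 m2] := truncn_itv ln0; rewrite -/m in m1 m2.
have M2m : (M2 <= m)%N by rewrite -ltnS -(ltr_nat R); apply: le_lt_trans m2.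
have mp : (0 < m)%N by apply: leq_trans M2m.
have mR : 1 <= m%:R :> R by rewrite ler1n.
have [|sg [sgi sgT]] := @letters_sum n; first by apply: lt_le_trans lnM2; rewrite ltr0n.
set T := \sum_i _ in sgT.
have mT : m%:R + Num.sqrt m%:R / 2 <= T.
  apply: le_trans sgT; apply: (@le_trans _ _ (ln n.+1%:R + Num.sqrt (ln n.+1%:R) / 2)).
    apply: lerD => //; rewrite ler_pM2r ?invr_gt0//; exact: ler_wsqrtr.
  by move: zn; lra.
have m3 : ln n.+1%:R <= m%:R + 1 :> R by rewrite natr1 ltW.
have M1m : 2500 * expR 2 * B' ^+ 2 * 32 ^+ 8 <= m%:R :> R.
  by apply: le_trans M1P _; rewrite ler_nat (leq_trans _ M2m)// leqW// leq_addl.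
have gr := growth mp (ltn0Sn n) m3 mT M1m; clear M1m M1P mT.
pose zs i := z (sg i).
pose y (a : A n m) : C := if deg a == m then ((mono zs (ex a))^*)%C else 0.
pose V := \sum_(a : A n m) normc (y a) ^+ 2.
have VE : V = \sum_(a : A n m | deg a == m) normc (mono zs (ex a)) ^+ 2.
  rewrite [RHS]big_mkcond; apply: eq_bigr => a _; rewrite /y; case: ifP => _; first by rewrite normc_conj.
  by rewrite normc0 expr0n.
have VT : 2500 * B' ^+ 2 * m%:R ^+ 2 * n.+1%:R <= V.
  apply: le_trans gr _; rewrite ler_pdivrMr ?ltr0n ?fact_gt0// mulrC.
  apply: le_trans (multinomial_le _ (leqnn m)) _ => [i|]; first exact: sqr_ge0.
  rewrite VE ler_wpM2l//; apply: ler_sum => a _; rewrite /mono normc_prod -prodrXl.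
  by rewrite le_eqVlt; apply/orP; left; apply/eqP; apply: eq_bigr => i _; rewrite normcX -!exprM mulnC.
have V1 : 1 <= V.
  apply: le_trans VT; rewrite -!mulrA mulr_ege1 ?ler1n//.
  by rewrite !mulr_ege1 ?exprn_ege1// ler1n.
have Vp : 0 < V := lt_le_trans ltr01 V1.
have zs1 i : normc (zs i) <= 1 by apply: le_trans (le_linfty_norm z _) _; exact: ltW.
have mono1 (a : A n m) : normc (mono zs (ex a)) <= 1.
  by rewrite /mono normc_prod; apply: prodr_ile1 => i _; rewrite normc_ge0 normcX exprn_ile1 ?normc_ge0.
have [|||s sP] := @random_polynomial R n.+1 m y V (ltn0Sn n) mp _ _ _ V1 (lexx _).
- by apply: le_trans m3 _; rewrite mulr_natl mulr2n lerD2l.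
- by move=> a /negbTE am; rewrite /y am.
- by move=> a; rewrite /y; case: ifP; rewrite ?normc_conj ?normc0.
have alg (e u c x : C) : e * u * c * x = e * (u * x) * c by ring.
set L := 25 * _ * _ in sP.
have Lp : 0 < L by rewrite !mulr_gt0 ?sqrtr_gt0 ?mulr_gt0 ?ltr0n.
pose b (a : A n m) := (-1) ^+ s a * y a * (L^-1)%:C%C.
pose W (E : pred (A n m)) := \sum_(a | (deg a == m) && E a) normc (mono zs (ex a)) ^+ 2.
have WE (E : pred (A n m)) (o : bool) : (forall a, E a = (s a == o)) ->
    normc (\sum_(a | (deg a == m) && E a) b a * mono zs (ex a)) = W E / L.
  move=> EE; have -> : \sum_(a | (deg a == m) && E a) b a * mono zs (ex a) = (-1) ^+ o * (W E / L)%:C%C.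
    rewrite rmorphM rmorph_sum/= mulr_suml mulr_sumr; apply: eq_bigr => a /andP[am].
    rewrite EE => /eqP so; rewrite /b /y am so -mul_conjc.
    by move: (mono _ _) => x; ring.
  rewrite normcM normc_real ger0_norm; last by rewrite divr_ge0 ?(ltW Lp)// sumr_ge0// => a _; exact: sqr_ge0.
  by case: o {EE}; rewrite ?expr1 ?expr0 ?normcN normc1 mul1r.
have key (E : pred (A n m)) : V / 2 <= W E -> B <= W E / L.
  move=> VW; rewrite ler_pdivlMr//; apply: le_trans VW; rewrite ler_pdivlMr//.
  apply: (@le_trans _ _ (B' * L * 2)).
    by rewrite !ler_wpM2r ?(ltW Lp)// le_max lexx.
  have q0 : 0 <= Num.sqrt (n.+1%:R * V) by exact: sqrtr_ge0.
  rewrite -(@ler_sqr _ _ V) ?nnegrE ?(ltW Vp) ?mulr_ge0 ?(ltW Lp) ?(le_trans ler01 B1)//.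
  have -> : (B' * L * 2) ^+ 2 = (2500 * B' ^+ 2 * m%:R ^+ 2 * n.+1%:R) * V.
    rewrite /L !exprMn sqr_sqrtr ?mulr_ge0 ?(ltW Vp)//; ring.
  by rewrite expr2 ler_wpM2r ?(ltW Vp).
have VS : V = W (fun a => ~~ s a) + W s.
  rewrite VE (bigID (fun a => s a))/= addrC; congr (_ + _).
(* The indices of one of the two signs carry at least half of [V]. *)
have [Q [eps [QE QV]]] : exists Q, exists eps, (forall a, Q a = (s a == eps)) /\ V / 2 <= W Q.
  have [h|h] := leP (V / 2) (W s); first by exists s, true; split=> // a; case: (s a).
  exists (fun a => ~~ s a), false; split; first by move=> a; case: (s a).
  by rewrite VS ler_pdivrMr// mulr_natr mulr2n lerD2l ltW//; move: h; rewrite VS ltr_pdivlMr// mulr_natr mulr2n ltrD2r.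
exists (@Hump n m sg b Q); split => //=.
- by move=> a /negbTE am; rewrite /b /y am mulr0 mul0r.
- by apply: leq_trans M2m; rewrite ltnS leq_addr.
- move=> w w1; have := sP (fun i => w (sg i)) (fun i => le_trans (le_linfty_norm w _) w1).
  set S := \sum_a _ => SL; have -> : hpoly (@Hump n m sg b Q) w = S * (L^-1)%:C%C.
    rewrite /S mulr_suml; apply: eq_bigr => a _; exact: alg.
  by rewrite normcM normc_real ger0_norm ?invr_ge0 ?(ltW Lp)// ler_pdivrMr// mul1r.
- by rewrite (WE Q eps QE); exact: key.
Qed.

End Hump.

Lemma addBB (V : zmodType) (a b : V) : a + b - a - b = 0.
Proof. by rewrite [a + b - a]addrAC subrr add0r subrr. Qed.

Lemma subB2 (V : zmodType) (a b c : V) : c - b - (c - a) = a - b.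
Proof. by rewrite opprB addrC addrA subrK. Qed.

(** * The gliding hump *)

Section GlidingHump.
Variables (R : realType) (z : linfty R).
Local Notation N := (@linfty_norm R).
Local Notation C := R[i].
Local Notation A n d := {ffun 'I_n.+1 -> 'I_d.+1}.
Local Notation ex a := (fun i => nat_of_ord (a i)).

Lemma coord_differentiable p (w : linfty R) : differentiable (fun w : linfty R => w p : C^o) w.
Proof.
pose L : linfty R -> C^o := fun w => w p.
have lin : linear L by [].
pose LL := GRing.isLinear.Build R[i] (linfty R) C^o *:%R L lin.
pose LM : {linear linfty R -> C^o} := HB.pack L LL.
have [|e e0|//] := @differentiable_bound R L w LM 1.
  by move=> v; rewrite mul1r; exact: le_linfty_norm.
exists 1 => // h _; have -> : L (w + h) - L w - LM h = 0.
  exact: (addBB (L w) (LM h)).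
by rewrite normc0 mulr_ge0 ?linfty_norm_ge0// ltW.
Qed.

Lemma differentiable_bigsum (T : Type) (r : seq T) (f : T -> linfty R -> C^o) w :
  (forall i, differentiable (f i) w) -> differentiable (fun w => \sum_(i <- r) f i w) w.
Proof.
move=> fd; elim: r => [|i r IH].
  by rewrite (_ : (fun w => _) = cst 0); [exact: differentiable_cst|apply/funext => v; rewrite big_nil].
rewrite (_ : (fun w => _) = f i + (fun w => \sum_(i <- r) f i w)); first exact: differentiableD.
by apply/funext => v; rewrite big_cons.
Qed.

Lemma differentiable_bigprod (T : Type) (r : seq T) (f : T -> linfty R -> C^o) w :
  (forall i, differentiable (f i) w) -> differentiable (fun w => \prod_(i <- r) f i w : C^o) w.
Proof.
move=> fd; elim: r => [|i r IH].
  by rewrite (_ : (fun w => _) = cst 1); [exact: differentiable_cst|apply/funext => v; rewrite big_nil].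
rewrite (_ : (fun w => _) = (f i : linfty R -> C^o) * (fun w => \prod_(i <- r) f i w : C^o)).
  exact: differentiableM.
by apply/funext => v; rewrite big_cons.
Qed.

Lemma differentiable_scale (c : C) (f : linfty R -> C^o) w : differentiable f w ->
  differentiable (fun w => c * f w : C^o) w.
Proof. by move=> fd; exact: (@differentiableZ _ _ _ f c w fd). Qed.

Lemma hpoly_differentiable (h : hump R) w : differentiable (hpoly h) w.
Proof.
apply: differentiable_bigsum => a; apply: differentiable_scale.
apply: differentiable_bigprod => i.
rewrite (_ : (fun w => _) = fun w : linfty R => \prod_(k <- index_iota 0 (a i)) (w (@hsg R h i) : C^o)).
  by apply: differentiable_bigprod => k; exact: coord_differentiable.
by apply/funext => v; rewrite prodr_const_nat subn0.
Qed.

Lemma hpolyZ B m0 (h : hump R) (t : C) w : hump_ok z B m0 h -> hpoly h (t *: w) = t ^+ hm h * hpoly h w.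
Proof.
move=> [_ hh _ _ _]; exact: (@pevalZ R _ _ _ (@hb R h) (fun i => w (@hsg R h i)) t hh).
Qed.

Variable H : nat -> hump R.
Hypothesis H_ok : forall j, exists m0, hump_ok z (4 ^+ j) m0 (H j).
Hypothesis H_mono : forall i j, (i < j)%N -> (hm (H i) < hm (H j))%N.

Lemma hm_ge j : (j <= hm (H j))%N.
Proof. by elim: j => // j IH; apply: leq_ltn_trans IH (H_mono (ltnSn j)). Qed.

Definition partial k (w : linfty R) : C^o := \sum_(j < k) (2 ^- j)%:C%C * hpoly (H j) w.

Lemma half_pos (j : nat) : 0 <= 2 ^- j :> R. Proof. by rewrite invr_ge0 exprn_ge0. Qed.

(** The case [m = 0] gives uniform convergence; larger [m] use the homogeneity of the humps and show
    that late humps do not affect low jets. *)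
Lemma partial_tail (t : C) w k l m : normc t <= 1 -> N w <= 1 -> (k <= l)%N ->
  (forall j, (k <= j)%N -> (m <= hm (H j))%N) ->
  normc (partial l (t *: w) - partial k (t *: w)) <= 2 * 2 ^- k * normc t ^+ m.
Proof.
move=> t1 w1 kl mk.
have tm : 0 <= normc t ^+ m by rewrite exprn_ge0 ?normc_ge0.
have h : normc (partial l (t *: w) - partial k (t *: w)) <= (2 * 2 ^- k - 2 * 2 ^- l) * normc t ^+ m.
  rewrite -(subnKC kl); elim: (l - k)%N => [|i IH]; first by rewrite addn0 !subrr normc0 mul0r.
  rewrite addnS; set p := (k + i)%N in IH *.
  have -> : partial p.+1 (t *: w) = partial p (t *: w) + (2 ^- p)%:C%C * hpoly (H p) (t *: w).
    by rewrite /partial big_ord_recr.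
  rewrite addrAC; apply: le_trans (le_normcD _ _) _.
  have hp : normc ((2 ^- p)%:C%C * hpoly (H p) (t *: w)) <= 2 ^- p * normc t ^+ m.
    have [m0 ok] := H_ok p; rewrite (hpolyZ _ _ ok) !normcM normc_real ger0_norm ?half_pos// normcX.
    rewrite ler_wpM2l ?half_pos//; have [_ _ _ b1 _] := ok.
    apply: (@le_trans _ _ (normc t ^+ hm (H p))).
      by rewrite ler_piMr ?exprn_ge0 ?normc_ge0// b1.
    by apply: ler_wiXn2l; rewrite ?normc_ge0// mk// leq_addr.
  apply: le_trans (lerD IH hp) _; rewrite -mulrDl ler_wpM2r//.
  have -> : 2 ^- p.+1 = 2 ^- p / 2 :> R by rewrite exprSr invfM.
  lra.
apply: le_trans h _; rewrite ler_wpM2r// lerBlDr lerDl mulr_ge0//; exact: half_pos.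
Qed.

Lemma half_small (e : R) : 0 < e -> exists k0, forall k, (k0 <= k)%N -> 2 * 2 ^- k <= e.
Proof.
move=> e0; have [|k0 k0P] := @expr_small R 2^-1 (e / 2) _ (divr_gt0 e0 (ltr0n R 2)).
  by rewrite invr_gt0 ltr0n invf_lt1// ltr1n.
by exists k0 => k /k0P; rewrite exprVn; lra.
Qed.

Lemma limit_exists : exists g : linfty R -> C^o, forall w, N w <= 1 ->
  forall k, normc (partial k w - g w) <= 2 * 2 ^- k.
Proof.
have tail w k l : N w <= 1 -> (k <= l)%N -> normc (partial l w - partial k w) <= 2 * 2 ^- k.
  move=> w1 kl; have := @partial_tail 1 w k l 0 _ w1 kl (fun j _ => leq0n _).
  by rewrite scale1r normc1 lexx expr0 mulr1 => /(_ isT).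
have /choice[g gP] w : exists y : C, N w <= 1 -> ccvg (fun k => partial k w) y.
  have [w1|w1] := leP (N w) 1; last by exists 0.
  have [|y yP] := @ccauchy R (fun k => partial k w).
    move=> e e0; have [k0 k0P] := half_small e0; exists k0 => m.
    by apply: le_trans (tail _ _ _ w1 (leq_addr _ _)) (k0P _ (leqnn _)).
  by exists y.
exists g => w w1 k; apply/ler_addgt0Pr => e e0.
have [n0 n0P] := gP w w1 e e0; pose l := maxn k n0.
rewrite -[partial k w - g w](subrK (partial l w)).
have -> : partial k w - g w - partial l w + partial l w = - (partial l w - partial k w) + (partial l w - g w).
  by rewrite subrK opprB addrA subrK.
apply: le_trans (le_normcD _ _) _; apply: lerD; first by rewrite normcN tail// leq_maxl.
by apply: n0P; rewrite leq_maxr.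
Qed.

Hypothesis z1 : N z < 1.

Lemma partial_differentiable k w : differentiable (partial k) w.
Proof.
by apply: differentiable_bigsum => j; apply: differentiable_scale; exact: hpoly_differentiable.
Qed.

Lemma partial0 w : partial 0 w = 0.
Proof. by rewrite /partial big_ord0. Qed.

Section Limit.
Variable g : linfty R -> C^o.
Hypothesis gP : forall w, N w <= 1 -> forall k, normc (partial k w - g w) <= 2 * 2 ^- k.

Lemma limit_Hoo : Hoo_ball g.
Proof.
split=> [w /ball01E w1|].
  have r0 : 0 < 1 - N w by rewrite subr_gt0.
  apply: (weierstrass r0 (F := partial) _ _).1 => [j v _|e e0]; first exact: partial_differentiable.
  have [k0 k0P] := half_small e0; exists k0 => k v kk vw.
  apply: le_trans (gP _ k) (k0P k kk).
  rewrite -[v](subrK w); apply: le_trans (ler_linfty_normD _ _) _.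
  by rewrite -lerBrDr ltW.
exists (2%:R : R)%:C%C; split; first by rewrite complex_real.
move=> M M2 w /ball01E w1; apply: le_trans (ltW M2).
rewrite -[leLHS]/((normc (g w))%:C%C) lecR.
by have := gP (ltW w1) 0; rewrite partial0 sub0r normcN expr0 invr1 mulr1.
Qed.

(** Since the degrees increase strictly, all humps after the [J]-th vanish to an order beyond
    [hm (H J)], so the partial sum up to [J] is the jet. *)
Lemma limit_jet J w : N w < 1 ->
  jet g w (fun i => \sum_(j < J.+1) (if hm (H j) == i then (2 ^- j)%:C%C * hpoly (H j) w else 0))
    (hm (H J)).+1.
Proof.
move=> w1; exists 2, 1; split=> // t /andP[t0 t1].
have tw : N (t *: w) <= 1 by apply: ltW; exact: scale_in.
have -> : \sum_(i < (hm (H J)).+1)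
    (\sum_(j < J.+1) (if hm (H j) == i then (2 ^- j)%:C%C * hpoly (H j) w else 0)) * t ^+ i =
    partial J.+1 (t *: w).
  under eq_bigr do rewrite mulr_suml; rewrite exchange_big/= /partial; apply: eq_bigr => j _.
  have jJ : (hm (H j) < (hm (H J)).+1)%N.
    rewrite ltnS; have := ltn_ord j; rewrite ltnS leq_eqVlt => /orP[/eqP ->//|/H_mono/ltnW//].
  have [m0 ok] := H_ok j.
  rewrite (bigD1 (Ordinal jJ))//= eqxx big1 ?addr0 => [|i ij].
    by rewrite (hpolyZ t w ok) [t ^+ _ * _]mulrC mulrA.
  case: eqP => [e|_]; last by rewrite mul0r.
  by case/eqP: ij; apply: val_inj.
apply/ler_addgt0Pr => e e0; have [k0 k0P] := half_small e0.
pose l := maxn k0 J.+1.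
have -> : g (t *: w) - partial J.+1 (t *: w) =
    (partial l (t *: w) - partial J.+1 (t *: w)) - (partial l (t *: w) - g (t *: w)).
  exact/esym/subB2.
apply: le_trans (le_normcB _ _) _; apply: lerD; last first.
  by apply: le_trans (gP tw l) _; apply: k0P; exact: leq_maxl.
apply: le_trans (@partial_tail t w J.+1 l (hm (H J)).+1 t1 (ltW w1) (leq_maxr k0 J.+1) (fun j Jj => H_mono Jj)) _.
rewrite ler_wpM2r ?exprn_ge0 ?normc_ge0// ler_piMr// invf_le1 ?exprn_gt0//.
by rewrite exprn_ege1// ler1n.
Qed.

(** On every line [jet_iter] identifies the part of degree [hm (H J)] of the limit with the scaled
    hump. Their difference [D] is a homogeneous polynomial that vanishes near 0, and the [L^2]
    identity on the grid kills its coefficients. *)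
Lemma limit_coef J (a : A (hn (H J)) (hm (H J))) : deg a == hm (H J) ->
  gcoef (@hsg R (H J)) g (ex a) = (2 ^- J)%:C%C * @hb R (H J) a.
Proof.
set h := H J in a *; set m := hm h in a *.
have [gh _] := Hoo_holo limit_Hoo.
have [m0 [sgi hh _ _ _]] := H_ok J.
pose D (a : A (hn h) m) := (if deg a == m then gcoef (@hsg R h) g (ex a) else 0) - (2 ^- J)%:C%C * @hb R h a.
have Dh : homogeneous m D.
  by move=> b bm; rewrite /D (negbTE bm) hh// mulr0 subr0.
have D0 v : N (emb (@hsg R h) v) < 1 -> peval D v = 0.
  move=> v1; have jt := limit_jet J v1.
  have := jet_iter gh v1 jt; rewrite (iter_derive_emb (@hsg R h) v gh (leqnn m)).
  have f0 : m`!%:R != 0 :> C by rewrite pnatr_eq0 -lt0n fact_gt0.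
  move=> /(mulfI f0); rewrite (bigD1 ord_max)//= eqxx big1 ?addr0 => [hE|j jJ]; last first.
    case: eqP => // e; have : (j < J)%N.
      by rewrite ltn_neqAle -ltnS ltn_ord andbT; apply: contra jJ => /eqP e'; apply/eqP/val_inj.
    by move/H_mono; rewrite e ltnn.
  have hp : hpoly h (emb (@hsg R h) v) = \sum_b @hb R h b * mono v (ex b) :> C.
    by apply: eq_bigr => b _; congr (_ * _); apply: eq_bigr => i _; rewrite emb_coord.
  have -> : peval D v = homog (@hsg R h) m g v m - (2 ^- J)%:C%C * \sum_b @hb R h b * mono v (ex b).
    rewrite [homog _ _ _ _ _]big_mkcond/= [X in _ = _ - X]mulr_sumr -sumrB /peval /D; apply: eq_bigr => b _.
    by rewrite mulrBl -mulrA; congr (_ - _); case: ifP; rewrite ?mul0r.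
  by rewrite hE hp; exact: subrr.
have := @grid_L2 R 'I_(hn h).+1 m.+1 isT m.+1 D (leqnn _).
rewrite (eq_mean (G := fun=> 0)) => [|u]; last first.
  (* Scaling by [1 / 2] moves the grid into the open ball, and homogeneity removes the factor
     again. *)
  have /eqP : peval D (fun l => 2^-1%:C%C * gridpt R (u l)) = 0.
    apply: D0; apply: (@le_lt_trans _ _ 2^-1); last by rewrite invf_lt1// ltr1n.
    apply: norm_emb => // i; rewrite normcM normc_real ger0_norm ?invr_ge0//.
    by rewrite (_ : normc (gridpt R (u i)) = 1) ?mulr1//; exact: normc_cis.
  rewrite (pevalZ _ _ Dh) mulf_eq0 expf_eq0 => /orP[/andP[_]|/eqP].
    by rewrite -normc_eq0 normc_real ger0_norm ?invr_ge0// invr_eq0 pnatr_eq0.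
  by rewrite /peval /gmono /mono => ->; rewrite normc0 expr0n.
rewrite /mean big1// mulr0 => /esym/eqP; rewrite psumr_eq0 => [|b _]; last exact: sqr_ge0.
move=> /allP/(_ a (mem_index_enum a)); rewrite sqrf_eq0 normc_eq0 /D => + am.
by rewrite am subr_eq0 => /eqP.
Qed.

End Limit.

(** Cauchy's criterion: convergence keeps the sum over any finite set disjoint from [S0] below 2.
    The selected monomials of the [J]-th hump have a degree above all those in [S0], yet contribute
    at least [2 ^- J * 4 ^ J = 2 ^ J]. *)
Lemma not_mon : ~ mon_Hoo_ball z.
Proof.
move=> [_ mz]; have [g gP] := limit_exists.
have gH := limit_Hoo gP; have [gh _] := Hoo_holo gH.
pose F (al : multi_index) : C := mcoef g al * monomial al z.
have FE S : partial_sum (fun a => mcoef g a * monomial a z : C^o) S = \sum_(al <- S) F al.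
  by rewrite /partial_sum big_seq_fsetE.
have nr : nbhs (g z : C^o) (fun y : C^o => normc (y - g z) < 1).
  by apply/nbhsCP; exists 1.
have [S0 _ S0P] : totally [set S : {fset multi_index} | normc (\sum_(al <- S) F al - g z) < 1].
  have [S0 _ S0P] := mz g gH _ nr.
  by exists S0 => // S /S0P /=; rewrite FE.
have [n' [d nd]] := fset_bounds S0.
pose J := d.+2; pose h := H J.
have [m0 [sgi hh _ _ big]] := H_ok J.
pose S1 : {fset multi_index} := [fset multi_index_of (@hsg R h) a | a in [pred a : A (hn h) (hm h) | (deg a == hm h) && @hE R h a]]%fset.
have S1E : \sum_(al <- S1) F al = (2 ^- J)%:C%C *
    (\sum_(a | (deg a == hm h) && @hE R h a) @hb R h a * mono (fun i => z (@hsg R h i)) (ex a)).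
  rewrite big_imfset/=; last by move=> a b _ _ /(multi_index_of_injective sgi).
  rewrite big_enum_cond/= mulr_sumr; apply: eq_big => [a|a]; first by rewrite andbT.
  rewrite andbT => /andP[am _]; rewrite /F mcoef_multi_index_of// monomial_multi_index_of// (limit_coef gP am) mulrA.
  by [].
have S1big : 2 <= normc (\sum_(al <- S1) F al).
  rewrite S1E normcM normc_real ger0_norm ?half_pos//.
  apply: le_trans (ler_wpM2l (half_pos J) big).
  rewrite (_ : 4 = 2 * 2 :> R); last by ring.
  rewrite exprMn mulrA mulVf ?mul1r ?expf_neq0// -[leLHS]expr1 ler_weXn2l// ler1n//.
have disj : [disjoint S0 & S1]%fset.
  apply/fdisjointP => al /nd[_ ald]; apply/negP => /imfsetP[a /= /andP[/eqP am _] alE].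
  move: ald; rewrite alE (big_multi_index_of sgi addn a (F := fun k m => m))// -/(deg a) am.
  by rewrite leqNgt (leq_trans _ (hm_ge J)).
have := S0P (S0 `|` S1)%fset (fsubsetUl _ _); have := S0P S0 (fsubset_refl _) => /= h0 h1.
have sub : {subset S0 <= S0 `|` S1}%fset by move=> al; rewrite inE => ->.
move: h1; rewrite (sum_fset_diff F sub).
have -> : ((S0 `|` S1) `\` S0 = S1)%fset.
  apply/fsetP => al; rewrite !inE; case al0: (al \in S0) => //=.
  by apply/esym/negbTE; move/fdisjointP: disj; apply.
rewrite addrAC => h1.
have : normc (\sum_(al <- S1) F al) < 2.
  have -> : \sum_(al <- S1) F al = (\sum_(al <- S0) F al - g z + \sum_(al <- S1) F al) - (\sum_(al <- S0) F al - g z).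
    by rewrite addrAC subrr add0r.
  by apply: le_lt_trans (le_normcB _ _) _; lra.
by rewrite ltNge S1big//.
Qed.

End GlidingHump.

(** * Necessity and the counterexample *)

Section PartTwo.
Variable R : realType.
Local Notation N := (@linfty_norm R).

Lemma not_mon_of_large (z : linfty R) : N z < 1 ->
  (forall n0, exists2 n, (n0 <= n)%N &
    ln n%:R + Num.sqrt (ln n%:R) <= \sum_(1 <= j < n.+1) decr_rearr z j ^+ 2) ->
  ~ mon_Hoo_ball z.
Proof.
move=> z1 zl.
have /choice[F FP] (p : R * nat) := hump_exists z1 zl p.1 p.2.
pose fix Hs j := if j is j'.+1 then F (4 ^+ j'.+1, hm (Hs j')) else F (4 ^+ 0, 0%N).
apply: (@not_mon R z Hs) => //.
  by case=> [|j]; [exists 0%N|exists (hm (Hs j))]; exact: FP.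
have step j : (hm (Hs j) < hm (Hs j.+1))%N by have [_ _ h _ _] := FP (4 ^+ j.+1, hm (Hs j)).
move=> i; elim=> // j IH; rewrite ltnS leq_eqVlt => /orP[/eqP ->|/IH h]; first exact: step.
exact: ltn_trans h (step j).
Qed.

Lemma ln_large (y : R) : exists n0 : nat, forall n, (n0 <= n)%N -> y <= ln n%:R.
Proof.
exists (Num.truncn (expR y)).+1 => n nn; rewrite -[leLHS]expRK ler_ln ?posrE ?expR_gt0//.
  by apply: le_trans (ltW (truncnS_gt _)) _; rewrite ler_nat.
by rewrite ltr0n (leq_trans _ nn).
Qed.

Lemma sum_of_log_mean (z : linfty R) n : 0 < ln n%:R :> R ->
  \sum_(1 <= j < n.+1) decr_rearr z j ^+ 2 = ln n%:R * log_mean_sq z n.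
Proof. by move=> n0; rewrite /log_mean_sq mulVKf// gt_eqF. Qed.

(** A mean above [1 + e] is an excess of [e * ln n], which is at least [sqrt (ln n)] as soon as
    [ln n >= e ^- 2]. *)
Lemma limsup_le1_of_mon (z : linfty R) : N z < 1 -> mon_Hoo_ball z ->
  (limn_esup (fun n => (log_mean_sq z n)%:E) <= 1%:E)%E.
Proof.
move=> z1 mz; apply: limsup_le => e e0; apply: contrapT => h.
apply: (not_mon_of_large z1 _ mz) => n0.
have [n1 n1P] := ln_large (1 + e^-1 ^+ 2).
have [n [nn zn]] : exists n, (maxn n0 n1 <= n)%N /\ 1 + e < log_mean_sq z n.
  apply: contrapT => h'; apply: h; exists (maxn n0 n1) => n nn.
  by rewrite leNgt; apply/negP => zn; apply: h'; exists n.
exists n; first by apply: leq_trans nn; exact: leq_maxl.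
have := n1P n (leq_trans (leq_maxr _ _) nn); set L := ln _ => Ll.
have eV : 0 < e^-1 by rewrite invr_gt0.
have L0 : 0 < L by apply: lt_le_trans Ll; rewrite ltr_pwDl// sqr_ge0.
rewrite (sum_of_log_mean z L0); apply: (@le_trans _ _ (L * (1 + e))); last by rewrite ler_pM2l// ltW.
rewrite mulrDr mulr1 lerD2l.
have -> : L * e = Num.sqrt ((L * e) ^+ 2) by rewrite sqrtr_sqr ger0_norm// mulr_ge0 ?ltW.
apply: ler_wsqrtr; rewrite exprMn expr2 -mulrA ler_peMr ?(ltW L0)//.
have : e^-1 ^+ 2 <= L by apply: le_trans Ll; rewrite lerDr.
by rewrite exprVn -ler_pdivrMr ?exprn_gt0// mul1r.
Qed.

Lemma decr_rearr_decreasing (z : linfty R) n : (forall i j, (i <= j)%N -> normc (z j) <= normc (z i)) ->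
  decr_rearr z n.+1 = normc (z n).
Proof.
move=> zd; apply/le_anti/andP; split.
  apply: (@decr_rearr_le _ z n.+1 _ [fset j | j in iota 0 n]%fset).
    by rewrite card_fseq undup_id ?iota_uniq// size_iota.
  by move=> j; rewrite !inE mem_iota /= -leqNgt => /zd.
apply: le_decr_rearr => // J Jn.
have [i iln iJ] : exists2 i, (i <= n)%N & i \notin J.
  apply: contrapT => h; move: Jn; apply/negP; rewrite -leqNgt.
  rewrite -(size_iota 0 n.+1); apply: uniq_leq_size; first exact: iota_uniq.
  move=> p; rewrite mem_iota /= => pn; apply: contrapT => /negP pJ; apply: h; exists p => //.
by exists i => //; exact: zd.
Qed.

(** Of the two square roots one is the excess required by [not_mon_of_large], the other absorbs the
    constant [profile 12] that remains after telescoping. Both are negligible against the logarithm,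
    so the limsup does not exceed 1. *)
Definition profile (x : R) := ln x + 2 * Num.sqrt (ln x).

Lemma profile_mono (x y : R) : 1 <= x -> x <= y -> profile x <= profile y.
Proof.
move=> x1 xy; have h : ln x <= ln y by rewrite ler_ln ?posrE//; lra.
by apply: lerD => //; rewrite ler_wpM2l// ler_wsqrtr.
Qed.

(** Concavity makes the increments decrease, so that the example is its own decreasing
    rearrangement. *)
Lemma profile_concave (x : R) : 1 <= x -> profile (x + 2) - profile (x + 1) <= profile (x + 1) - profile x.
Proof.
move=> x1; rewrite /profile.
have l0 : 0 <= ln x by rewrite ln_ge0.
have l2 : 0 <= ln (x + 2) by rewrite ln_ge0//; lra.
have l1 : 0 <= ln (x + 1) by rewrite ln_ge0//; lra.
have hl : ln x + ln (x + 2) <= 2 * ln (x + 1).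
  rewrite -lnM ?posrE; [|lra|lra].
  rewrite mulr_natl -lnXn; last lra.
  rewrite ler_ln ?posrE; [|nra|apply: exprn_gt0; lra].
  by rewrite expr2; nra.
suff : Num.sqrt (ln x) + Num.sqrt (ln (x + 2)) <= 2 * Num.sqrt (ln (x + 1)) by lra.
have [a0 b0 c0] : [/\ 0 <= Num.sqrt (ln x), 0 <= Num.sqrt (ln (x + 2)) & 0 <= Num.sqrt (ln (x + 1))].
  by split; exact: sqrtr_ge0.
rewrite -ler_sqr ?nnegrE ?addr_ge0 ?mulr_ge0//.
have := sqr_sqrtr l0; have := sqr_sqrtr l1; have := sqr_sqrtr l2.
move: (Num.sqrt _) (Num.sqrt _) (Num.sqrt _) a0 b0 c0 => a b c a0 b0 c0 ea eb ec.
have := sqr_ge0 (b - c); rewrite !expr2 in ea eb ec *; nra.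
Qed.

(* The shift by [12] makes the values at most [1/4]. *)
Definition example_sq (j : nat) : R := profile (j + 13)%:R - profile (j + 12)%:R.

Lemma example_sq_ge0 j : 0 <= example_sq j.
Proof. by rewrite subr_ge0 profile_mono ?ler1n ?ler_nat ?addnS ?leq_add. Qed.

Lemma example_sq_anti i j : (i <= j)%N -> example_sq j <= example_sq i.
Proof.
elim: j => [|j IH]; first by rewrite leqn0 => /eqP ->.
rewrite leq_eqVlt => /orP[/eqP ->//|/IH]; apply: le_trans.
have := @profile_concave (j + 12)%:R; rewrite ler1n addn_gt0 orbT => /(_ isT).
have -> : (j + 12)%:R + 2 = (j.+1 + 13)%:R :> R by rewrite -natrD addSnnS -addnA.
have -> : (j + 12)%:R + 1 = (j + 13)%:R :> R by rewrite natr1 -addnS.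
by rewrite /example_sq !addSnnS.
Qed.

(** The first increment is the largest. From 12 on the logarithm is at least 1, where the square
    root is 1-Lipschitz; with [ln 13 - ln 12 <= 1 / 12] the increment is at most [3 / 12]. *)
Lemma example_sq_le j : example_sq j <= 4^-1.
Proof.
apply: le_trans (example_sq_anti (leq0n j)) _; rewrite /example_sq /profile !add0n.
have e2 : expR 2^-1 <= 2 :> R.
  have := expR_ge1Dx (- 2^-1 : R); rewrite expRN => h.
  have : 2^-1 <= (expR 2^-1)^-1 :> R by apply: le_trans h; lra.
  by rewrite lef_pV2 ?posrE ?expR_gt0.
have l12 : 1 <= ln 12 :> R.
  rewrite -[leLHS]expRK ler_ln ?posrE ?expR_gt0//.
  have -> : expR 1 = expR 2^-1 ^+ 2 :> R by rewrite -expRM_natl mulfV.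
  apply: (@le_trans _ _ (2 ^+ 2)); last by rewrite expr2; lra.
  by rewrite lerXn2r ?nnegrE ?expR_ge0.
have d : ln 13 - ln 12 <= 12^-1 :> R.
  rewrite -ln_div ?posrE//; have := @le_ln1Dx R 12^-1.
  rewrite (_ : 1 + 12^-1 = 13 / 12); last by field.
  by apply; rewrite (lt_trans (ltrN10 R))// invr_gt0.
have d0 : ln 12 <= ln 13 :> R by rewrite ler_ln ?posrE// ler_nat.
have s12 : 1 <= Num.sqrt (ln 12) :> R by rewrite -[leLHS]sqrtr1 ler_wsqrtr.
have s13 : Num.sqrt (ln 12) <= Num.sqrt (ln 13) :> R by rewrite ler_wsqrtr.
have := sqr_sqrtr (le_trans ler01 l12); have := sqr_sqrtr (le_trans ler01 (le_trans l12 d0)).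
move: (Num.sqrt _) (Num.sqrt _) s12 s13 => a b b1 ba ea eb.
have : a - b <= 12^-1.
  apply: le_trans d; rewrite -ea -eb !expr2; nra.
lra.
Qed.

Lemma example_bounded : (fun j => (Num.sqrt (example_sq j))%:C%C) \in @bounded_seq R.
Proof.
apply/bounded_seqP; exists 2^-1 => j; rewrite normc_real ger0_norm ?sqrtr_ge0//.
rewrite (_ : 2^-1 = Num.sqrt (4^-1)); first by rewrite ler_wsqrtr// example_sq_le.
by rewrite (_ : 4^-1 = 2^-1 ^+ 2 :> R) ?sqrtr_sqr ?ger0_norm//; field.
Qed.

Definition example : linfty R := Linfty example_bounded.

Lemma normc_example j : normc (example j) = Num.sqrt (example_sq j).
Proof. by rewrite normc_real ger0_norm ?sqrtr_ge0. Qed.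

Lemma example_lt1 : N example < 1.
Proof.
apply: (@le_lt_trans _ _ 2^-1); last by rewrite invf_lt1// ltr1n.
apply: linfty_norm_le => j; rewrite normc_example.
rewrite (_ : 2^-1 = Num.sqrt (4^-1)); first by rewrite ler_wsqrtr// example_sq_le.
by rewrite (_ : 4^-1 = 2^-1 ^+ 2 :> R) ?sqrtr_sqr ?ger0_norm//; field.
Qed.

Lemma example_sum n : \sum_(1 <= j < n.+1) decr_rearr example j ^+ 2 = profile (n + 12)%:R - profile 12.
Proof.
rewrite big_add1 big_mkord /=.
rewrite (eq_bigr (fun j : 'I_n => example_sq j)) => [|j _]; last first.
  rewrite decr_rearr_decreasing => [|i k ik]; first by rewrite normc_example sqr_sqrtr ?example_sq_ge0.
  by rewrite !normc_example ler_wsqrtr// example_sq_anti.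
rewrite -(big_mkord xpredT example_sq).
rewrite (eq_bigr (fun j => profile (j.+1 + 12)%:R - profile (j + 12)%:R)) => [|j _].
  by rewrite (telescope_sumr (fun j => profile (j + 12)%:R)).
by rewrite /example_sq addSnnS.
Qed.

Lemma example_limsup : (limn_esup (fun n => (log_mean_sq example n)%:E) <= 1%:E)%E.
Proof.
apply: limsup_le => e e0.
pose c : R := ln 13; have c0 : 0 <= c by rewrite ln_ge0// ler1n.
(* Beyond this threshold [ln (n + 12) <= 2 * L], [c <= e * L / 2] and
   [2 * sqrt (2 * L) <= e * L / 2]. *)
have [n0 n0P] := ln_large (1 + c + 2 * c / e + 32 / e ^+ 2).
exists n0 => n nn; have := n0P n nn; set L := ln _ => LL.
have t1 : 0 <= 2 * c / e by rewrite divr_ge0 ?mulr_ge0// ltW.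
have t2 : 0 <= 32 / e ^+ 2 by rewrite divr_ge0 ?exprn_ge0// ltW.
have L0 : 0 < L by lra.
have n1 : (0 < n)%N by rewrite lt0n; apply/eqP => nE; move: L0; rewrite /L nE ln0// ltxx.
rewrite /log_mean_sq -/L ler_pdivrMl// example_sum.
have Lc : ln (n + 12)%:R <= L + c.
  have -> : L + c = ln (n * 13)%:R by rewrite natrM lnM ?posrE ?ltr0n.
  rewrite ler_ln ?posrE ?ltr0n ?muln_gt0 ?addn_gt0 ?n1// ler_nat.
  by rewrite mulnS leq_add// leq_pmull.
have p12 : 0 <= profile 12 by rewrite /profile addr_ge0 ?mulr_ge0 ?sqrtr_ge0 ?ln_ge0 ?ler1n.
have s : 2 * Num.sqrt (ln (n + 12)%:R) <= e * L / 2.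
  apply: (@le_trans _ _ (2 * Num.sqrt (2 * L))).
    by rewrite ler_wpM2l// ler_wsqrtr//; lra.
  have -> : e * L / 2 = 2 * Num.sqrt ((e * L / 4) ^+ 2).
    rewrite sqrtr_sqr ger0_norm; first by field.
    by rewrite divr_ge0 ?mulr_ge0 ?ltW.
  rewrite ler_wpM2l// ler_wsqrtr//.
  have : 32 <= L * e ^+ 2 by rewrite -ler_pdivrMr ?exprn_gt0//; lra.
  rewrite -(ler_pM2l L0) => h.
  have -> : (e * L / 4) ^+ 2 = L * (L * e ^+ 2) / 16 by field.
  lra.
have c2 : 2 * c <= L * e by rewrite -ler_pdivrMr//; lra.
by move: p12; rewrite /profile; lra.
Qed.

Lemma example_not_mon : ~ mon_Hoo_ball example.
Proof.
apply: not_mon_of_large example_lt1 _ => n0.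
pose p : R := profile 12.
have [n1 n1P] := ln_large (1 + p ^+ 2).
pose n := maxn n0 n1; exists n; first exact: leq_maxl.
have := n1P n (leq_maxr _ _); set L := ln _ => LL.
have p0 : 0 <= p by rewrite /p /profile addr_ge0 ?mulr_ge0 ?sqrtr_ge0 ?ln_ge0 ?ler1n.
have L0 : 0 < L by apply: lt_le_trans LL; rewrite ltr_pwDl// sqr_ge0.
have n1' : (0 < n)%N by rewrite lt0n; apply/eqP => nE; move: L0; rewrite /L nE ln0// ltxx.
rewrite example_sum -/p.
have Ln : L <= ln (n + 12)%:R by rewrite ler_ln ?posrE ?ltr0n ?addn_gt0 ?n1'// ler_nat leq_addr.
have s : p <= Num.sqrt L.
  rewrite -[leLHS](ger0_norm p0) -sqrtr_sqr ler_wsqrtr//; lra.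
have s' : Num.sqrt L <= Num.sqrt (ln (n + 12)%:R) by rewrite ler_wsqrtr.
by rewrite /profile; lra.
Qed.

End PartTwo.

Theorem theorem2p2 (R : realType) :
  (forall z : linfty R, ball (0 : linfty R) 1 z ->
     ((limn_esup (fun n => (log_mean_sq z n)%:E) < 1%:E)%E ->
        mon_Hoo_ball z) /\
     (mon_Hoo_ball z ->
        (limn_esup (fun n => (log_mean_sq z n)%:E) <= 1%:E)%E)) /\
  (exists z : linfty R,
     [/\ ball (0 : linfty R) 1 z,
         (limn_esup (fun n => (log_mean_sq z n)%:E) <= 1%:E)%E &
         ~ mon_Hoo_ball z]).
Proof.
split=> [z z1|]; first split.
- exact: mon_of_limsup_lt1.
- by apply: limsup_le1_of_mon; exact/ball01E.
exists (example R); split; [exact/ball01E/example_lt1|exact: example_limsup|exact: example_not_mon].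
Qed.
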